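(* Let $\mathcal{P}\leqslant\mathrm{Iso}(\mathbb{H}^n)$ be a discrete, torsion free parabolic subgroup and let $\xi\in\partial\mathbb{H}^n$ be a point which is not fixed by $\mathcal{P}$. Then $$\delta_{\mathcal{P}}=\dim_B\left(\bigcup_{p\in\mathcal{P}}\{p\xi\}\right),$$ where $\dim_B$ is the box dimension computed using the spherical metric on $\partial\mathbb{H}^n$ (in particular the box dimension exists).
   Context: $\mathbb{H}^n$ is $n$-dimensional hyperbolic space with distance $d$, and $\partial\mathbb{H}^n$ is its Gromov boundary; $\mathrm{Iso}(\mathbb{H}^n)$ is the isometry group, acting on $\partial\mathbb{H}^n$ by homeomorphisms. A subgroup $G\leqslant\mathrm{Iso}(\mathbb{H}^n)$ is parabolic if there exists a unique point $w\in\partial\mathbb{H}^n$ that is fixed by every element of $G$. Critical exponent: fix $o\in\mathbb{H}^n$. The Poincaré series of $G$ is $\sum_{g\in G}e^{-s\,d(o,go)}$, and $\delta_G=\inf\{s\in\mathbb{R}:\sum_{g\in G}e^{-s\,d(o,go)}<\infty\}$; it does not depend on $o$. The spherical metric on $\partial\mathbb{H}^n$ is the metric on the unit sphere $S^{n-1}=\partial\mathbb{H}^n$ in the ball model, given by the angle at the origin. Box dimension: for a subset $F$ of a metric space, $N_\delta(F)$ is the smallest number of sets of diameter at most $\delta$ needed to cover $F$; $\dim_B(F)=\lim_{\delta\to0}\frac{\log N_\delta(F)}{-\log\delta}$ when this limit exists. *)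

(* Defs.v *)
From HB Require Import structures.
From mathcomp Require Import all_boot all_order all_algebra.
From mathcomp Require Import ring lra.
From mathcomp Require Import all_classical all_reals all_analysis.

Set Implicit Arguments.
Unset Strict Implicit.
Unset Printing Implicit Defensive.

Import Order.TTheory GRing.Theory Num.Theory.
Import numFieldNormedType.Exports.

Local Open Scope classical_set_scope.
Local Open Scope ring_scope.

Section euclidean.
Context {R : realType} {n : nat}.
Implicit Types (u v w : 'rV[R]_n) (a b c : R).

Definition dot u v : R := \sum_i u 0 i * v 0 i.

Lemma dotC u v : dot u v = dot v u.
Proof. by apply: eq_bigr => i _; rewrite mulrC. Qed.

Lemma dotDl u v w : dot (u + v) w = dot u w + dot v w.
Proof. by rewrite -big_split; apply: eq_bigr => i _; rewrite !mxE mulrDl. Qed.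

Lemma dotZl a u v : dot (a *: u) v = a * dot u v.
Proof. by rewrite mulr_sumr; apply: eq_bigr => i _; rewrite !mxE mulrA. Qed.

Lemma dotNl u v : dot (- u) v = - dot u v.
Proof. by rewrite -scaleN1r dotZl mulN1r. Qed.

Lemma dotDr u v w : dot u (v + w) = dot u v + dot u w.
Proof. by rewrite dotC dotDl !(dotC u). Qed.

Lemma dotZr a u v : dot u (a *: v) = a * dot u v.
Proof. by rewrite dotC dotZl (dotC u). Qed.

Lemma dotNr u v : dot u (- v) = - dot u v.
Proof. by rewrite dotC dotNl (dotC u). Qed.

Definition dotE := (dotDl, dotDr, dotZl, dotZr, dotNl, dotNr).

Lemma dot_ge0 u : 0 <= dot u u.
Proof. by apply: sumr_ge0 => i _; rewrite -expr2 sqr_ge0. Qed.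

Lemma dot_eq0 u : dot u u = 0 -> u = 0.
Proof.
move=> /eqP; rewrite psumr_eq0 => [/allP u0|i _]; last by rewrite -expr2 sqr_ge0.
apply/rowP => i; have := u0 i (mem_index_enum _).
by rewrite -expr2 sqrf_eq0 mxE => /eqP.
Qed.

Lemma psd_discr a b c :
  (forall s t : R, 0 <= a * s ^+ 2 + 2 * b * s * t + c * t ^+ 2) ->
  b ^+ 2 <= a * c.
Proof.
move=> psd.
have c0 : 0 <= c by have := psd 0 1; nra.
have [c_gt0|] := ltP 0 c.
  have := psd c (- b).
  have -> : a * c ^+ 2 + 2 * b * c * - b + c * (- b) ^+ 2 = c * (a * c - b ^+ 2).
    by ring.
  by rewrite pmulr_rge0// subr_ge0.
move=> c_le0; have {c0 c_le0}cE : c = 0 by apply/eqP; rewrite eq_le c_le0 c0.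
rewrite cE in psd *; rewrite mulr0 leNgt; apply/negP => b2.
have b0 : b != 0 by apply: contraTneq b2 => ->; rewrite expr0n ltxx.
have := psd 1 (- (a + 1) / (2 * b)).
have -> : a * 1 ^+ 2 + 2 * b * 1 * (- (a + 1) / (2 * b)) +
  0 * (- (a + 1) / (2 * b)) ^+ 2 = -1 by field.
by move=> h; lra.
Qed.

Lemma dot_CauchySchwarz u v : dot u v ^+ 2 <= dot u u * dot v v.
Proof.
apply: psd_discr => s t; have := dot_ge0 (s *: u + t *: v).
rewrite !dotE (dotC v u); congr (0 <= _); ring.
Qed.

End euclidean.

Section arcosh.
Context {R : realType}.
Implicit Types a b c : R.

Definition arcosh a : R := ln (a + Num.sqrt (a ^+ 2 - 1)).

Lemma arcosh_arg_gt0 a : 1 <= a -> 0 < a + Num.sqrt (a ^+ 2 - 1).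
Proof. by move=> a1; rewrite ltr_wpDr ?sqrtr_ge0// (lt_le_trans ltr01). Qed.

Lemma arcosh1 : arcosh 1 = 0.
Proof. by rewrite /arcosh expr1n subrr sqrtr0 addr0 ln1. Qed.

Lemma arcosh_inj a b : 1 <= a -> 1 <= b -> arcosh a = arcosh b -> a = b.
Proof.
move=> a1 b1 /ln_inj; rewrite !posrE !arcosh_arg_gt0// => /(_ erefl erefl).
have := sqr_sqrtr (_ : 0 <= a ^+ 2 - 1); have := sqr_sqrtr (_ : 0 <= b ^+ 2 - 1).
have := sqrtr_ge0 (a ^+ 2 - 1); have := sqrtr_ge0 (b ^+ 2 - 1).
set s := Num.sqrt _; set t := Num.sqrt _ => s0 t0.
move=> /(_ ltac:(nra)) sE /(_ ltac:(nra)) tE eq.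
have : (a - b) * (a + t) = 0 by nra.
by move/eqP; rewrite mulf_eq0 subr_eq0 => /orP[/eqP//|/eqP]; lra.
Qed.

Lemma arcosh_le a b c : 1 <= a -> 1 <= b -> 1 <= c ->
  c <= a * b + Num.sqrt (a ^+ 2 - 1) * Num.sqrt (b ^+ 2 - 1) ->
  arcosh c <= arcosh a + arcosh b.
Proof.
move=> a1 b1 c1.
rewrite /arcosh -lnM ?posrE ?arcosh_arg_gt0//.
have a0 : 0 <= a ^+ 2 - 1 by nra.
have b0 : 0 <= b ^+ 2 - 1 by nra.
have := sqr_sqrtr a0; have := sqr_sqrtr b0.
have := sqrtr_ge0 (a ^+ 2 - 1); have := sqrtr_ge0 (b ^+ 2 - 1).
set s := Num.sqrt (b ^+ 2 - 1); set t := Num.sqrt (a ^+ 2 - 1).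
move=> s0 t0 sE tE cab.
have d0 : 0 <= a * s + b * t by nra.
rewrite ler_ln ?posrE ?arcosh_arg_gt0//; last by apply: mulr_gt0; lra.
have -> : (a + t) * (b + s) = (a * b + t * s) + (a * s + b * t) by ring.
apply: lerD => //; rewrite -[leRHS]ger0_norm// -sqrtr_sqr ler_sqrt ?sqr_ge0//.
have -> : (a * s + b * t) ^+ 2 = (a * b + t * s) ^+ 2 - 1.
  transitivity (a ^+ 2 * s ^+ 2 + b ^+ 2 * t ^+ 2 + 2 * a * b * s * t).
    by ring.
  transitivity (a ^+ 2 * b ^+ 2 + t ^+ 2 * s ^+ 2 + 2 * a * b * s * t - 1).
    by rewrite sE tE; ring.
  by ring.
by rewrite lerD2r lerXn2r// nnegrE; lra.
Qed.

End arcosh.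

(* Hyperboloid counterpart of the triangle inequality. *)
Lemma minkowski_triangle (R : realType) (n : nat) (x0 y0 z0 : R)
    (x y z : 'rV[R]_n) :
  x0 ^+ 2 = dot x x + 1 -> y0 ^+ 2 = dot y y + 1 -> z0 ^+ 2 = dot z z + 1 ->
  let a := x0 * y0 - dot x y in let b := y0 * z0 - dot y z in
  1 <= a -> 1 <= b ->
  x0 * z0 - dot x z <= a * b + Num.sqrt (a ^+ 2 - 1) * Num.sqrt (b ^+ 2 - 1).
Proof.
move=> hx hy hz a b a1 b1.
pose u := x - a *: y; pose u0 := x0 - a * y0.
pose v := z - b *: y; pose v0 := z0 - b * y0.
have uE : dot u u - u0 ^+ 2 = a ^+ 2 - 1.
  rewrite /u /u0 !dotE (dotC y x).
  have -> : dot x x = x0 ^+ 2 - 1 by rewrite hx addrK.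
  have -> : dot y y = y0 ^+ 2 - 1 by rewrite hy addrK.
  have -> : dot x y = x0 * y0 - a by rewrite /a; ring.
  ring.
have vE : dot v v - v0 ^+ 2 = b ^+ 2 - 1.
  rewrite /v /v0 !dotE (dotC z y).
  have -> : dot z z = z0 ^+ 2 - 1 by rewrite hz addrK.
  have -> : dot y y = y0 ^+ 2 - 1 by rewrite hy addrK.
  have -> : dot y z = y0 * z0 - b by rewrite /b; ring.
  ring.
have uvE : dot u v - u0 * v0 = a * b - (x0 * z0 - dot x z).
  rewrite /v /v0 /u /u0 !dotE.
  have -> : dot y y = y0 ^+ 2 - 1 by rewrite hy addrK.
  have -> : dot y z = y0 * z0 - b by rewrite /b; ring.
  have -> : dot x y = x0 * y0 - a by rewrite /a; ring.
  ring.
have uy : u0 * y0 = dot u y.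
  rewrite /u0 /u !dotE.
  have -> : dot y y = y0 ^+ 2 - 1 by rewrite hy addrK.
  have -> : dot x y = x0 * y0 - a by rewrite /a; ring.
  ring.
have vy : v0 * y0 = dot v y.
  rewrite /v0 /v !dotE (dotC z y).
  have -> : dot y y = y0 ^+ 2 - 1 by rewrite hy addrK.
  have -> : dot y z = y0 * z0 - b by rewrite /b; ring.
  ring.
clearbody u u0 v v0.
have y0_gt0 : 0 < y0 ^+ 2 by rewrite hy; have := dot_ge0 y; lra.
have CS : (dot u v - u0 * v0) ^+ 2 <= (dot u u - u0 ^+ 2) * (dot v v - v0 ^+ 2).
  apply: psd_discr => s t.
  pose w := s *: u + t *: v.
  have -> : (dot u u - u0 ^+ 2) * s ^+ 2 + 2 * (dot u v - u0 * v0) * s * t +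
    (dot v v - v0 ^+ 2) * t ^+ 2 = dot w w - (s * u0 + t * v0) ^+ 2.
    by rewrite /w !dotE (dotC v u); ring.
  rewrite -(pmulr_rge0 _ y0_gt0) mulrBr -exprMn.
  have -> : y0 * (s * u0 + t * v0) = dot w y.
    by rewrite /w !dotE -uy -vy; ring.
  have := dot_CauchySchwarz w y; have := dot_ge0 w; rewrite hy; nra.
rewrite uE vE uvE in CS.
have a0 : 0 <= a ^+ 2 - 1 by nra.
rewrite -lerBlDl -sqrtrM//; apply: le_trans (ler_norm _) _.
by rewrite -sqrtr_sqr ler_sqrt ?(le_trans (sqr_ge0 _) CS)// -sqrrN opprB.
Qed.

(* The open unit ball model of hyperbolic n-space (curvature -1). *)
Record hyperbolic_space (R : realType) (n : nat) := Hyperbolic {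
  hval : 'rV[R]_n ;
  hvalP : dot hval hval < 1 }.

Section hyperbolic_metric.
Context {R : realType} {n : nat}.
Local Notation H := (hyperbolic_space R n).
Implicit Types x y z : H.

HB.instance Definition _ := [isSub for @hval R n].
HB.instance Definition _ := [Choice of H by <:].

Definition hcosh x y : R :=
  1 + 2 * dot (hval x - hval y) (hval x - hval y) /
      ((1 - dot (hval x) (hval x)) * (1 - dot (hval y) (hval y))).

Definition hdist x y : R := arcosh (hcosh x y).

Let den_gt0 x : 0 < 1 - dot (hval x) (hval x).
Proof. by rewrite subr_gt0; exact: hvalP. Qed.

Lemma hcosh_ge1 x y : 1 <= hcosh x y.
Proof.
rewrite lerDl; apply: divr_ge0; first by rewrite mulr_ge0// dot_ge0.
by rewrite mulr_ge0// ltW.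
Qed.

Lemma hcoshxx x : hcosh x x = 1.
Proof. by rewrite /hcosh subrr -(scale0r 0) dotZl mul0r mulr0 mul0r addr0. Qed.

Lemma hcosh_eq1 x y : hcosh x y = 1 -> x = y.
Proof.
rewrite /hcosh => /eqP; rewrite -subr_eq0 addrAC subrr add0r.
rewrite mulf_eq0 invr_eq0 !mulf_eq0 pnatr_eq0 !(gt_eqF (den_gt0 _))/= !orbF.
by move/eqP/dot_eq0/eqP; rewrite subr_eq0 => /eqP/val_inj.
Qed.

Lemma hcoshC x y : hcosh x y = hcosh y x.
Proof.
rewrite /hcosh -opprB dotNl dotNr opprK; congr (_ + _ / _).
by rewrite mulrC.
Qed.

Let h0 x := (1 + dot (hval x) (hval x)) / (1 - dot (hval x) (hval x)).
Let hv x := (2 / (1 - dot (hval x) (hval x))) *: hval x.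

Let h0E x : h0 x ^+ 2 = dot (hv x) (hv x) + 1.
Proof.
rewrite /h0 /hv !dotE; have := den_gt0 x.
by set p := dot _ _ => p1; field; lra.
Qed.

Lemma hcoshE x y : hcosh x y = h0 x * h0 y - dot (hv x) (hv y).
Proof.
rewrite /hcosh /h0 /hv !dotE (dotC (hval y) (hval x)).
have := den_gt0 x; have := den_gt0 y.
by set p := dot _ _ => p1; set q := dot _ _ => q1; field; lra.
Qed.

Let hdistxx x : hdist x x = 0.
Proof. by rewrite /hdist hcoshxx arcosh1. Qed.

Let hdist_positivity x y : hdist x y = 0 -> x = y.
Proof.
rewrite /hdist -arcosh1 => /arcosh_inj xy; apply: hcosh_eq1.
by apply: xy => //; exact: hcosh_ge1.
Qed.

Let hdist_sym x y : hdist x y = hdist y x.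
Proof. by rewrite /hdist hcoshC. Qed.

Let hdist_triangle y x z : hdist x z <= hdist x y + hdist y z.
Proof.
apply: arcosh_le; rewrite ?hcosh_ge1//.
have := @minkowski_triangle R n _ _ _ _ _ _ (h0E x) (h0E y) (h0E z).
by rewrite /= -!hcoshE; apply; exact: hcosh_ge1.
Qed.

HB.instance Definition _ :=
  isMetric.Build R H hdistxx hdist_positivity hdist_sym hdist_triangle.

Lemma mdist_hyperbolicE x y : mdist x y = hdist x y.
Proof. by []. Qed.

End hyperbolic_metric.

(* The boundary at infinity, as the unit sphere around the ball model. *)
Record boundary (R : realType) (n : nat) := Boundary {
  bval : 'rV[R]_n ;
  bvalP : dot bval bval == 1 }.

Section spherical_metric.
Context {R : realType} {n : nat}.
Local Notation S := (boundary R n).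
Implicit Types x y z : S.

HB.instance Definition _ := [isSub for @bval R n].
HB.instance Definition _ := [Choice of S by <:].

Definition angle x y : R := acos (dot (bval x) (bval y)).

Let dot1 x : dot (bval x) (bval x) = 1.
Proof. exact/eqP/bvalP. Qed.

Let dot_itv x y : -1 <= dot (bval x) (bval y) <= 1.
Proof.
have := dot_CauchySchwarz (bval x) (bval y); rewrite !dot1 mulr1.
by move=> h; apply/andP; split; nra.
Qed.

Let anglexx x : angle x x = 0.
Proof. by rewrite /angle dot1 acos1. Qed.

Let angle_positivity x y : angle x y = 0 -> x = y.
Proof.
rewrite /angle => /(congr1 cos); rewrite acosK ?in_itv/= ?dot_itv// cos0 => xy.
apply/val_inj/eqP; rewrite -subr_eq0; apply/eqP/dot_eq0.
rewrite !dotE (dotC (bval y) (bval x)) /= ; rewrite !dot1 xy; ring.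
Qed.

Let angle_sym x y : angle x y = angle y x.
Proof. by rewrite /angle dotC. Qed.

Let angle_triangle y x z : angle x z <= angle x y + angle y z.
Proof.
have /andP[a0 api] : 0 <= angle x y <= pi by rewrite acos_ge0 ?acos_lepi.
have /andP[b0 bpi] : 0 <= angle y z <= pi by rewrite acos_ge0 ?acos_lepi.
have /andP[c0 cpi] : 0 <= angle x z <= pi by rewrite acos_ge0 ?acos_lepi.
have [abpi|] := leP (angle x y + angle y z) pi; last first.
  by move=> /ltW; exact: le_trans.
rewrite leNgt; apply/negP => abc.
have : cos (angle x z) < cos (angle x y + angle y z).
  by rewrite ltr_cos// in_itv/= ?c0 ?cpi ?addr_ge0.
apply/negP; rewrite -leNgt cosD.
rewrite /angle !sin_acos ?acosK ?in_itv/= ?dot_itv//.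
set p := dot (bval x) (bval y); set q := dot (bval y) (bval z).
set r := dot (bval x) (bval z).
have /andP[p1 p2] : -1 <= p <= 1 := dot_itv _ _.
have /andP[q1 q2] : -1 <= q <= 1 := dot_itv _ _.
have p0 : 0 <= 1 - p ^+ 2 by nra.
have := dot_CauchySchwarz (bval x - p *: bval y) (bval z - q *: bval y).
rewrite !dotE (dotC (bval y) (bval x)) (dotC (bval z) (bval y)) !dot1 -/p -/q -/r.
move=> CS; rewrite -sqrtrM// lerBlDr -lerBlDl.
apply: le_trans (ler_norm _) _.
rewrite -sqrtr_sqr ler_sqrt; last by apply: mulr_ge0 => //; nra.
move: CS; congr (_ <= _); ring.
Qed.

HB.instance Definition _ :=
  isMetric.Build R S anglexx angle_positivity angle_sym angle_triangle.

Lemma mdist_boundaryE x y : mdist x y = angle x y.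
Proof. by []. Qed.

End spherical_metric.

Record Iso (R : realType) (T : metricType R) := MkIso {
  iso_fun :> T -> T ;
  iso_mdist : forall x y,
    mdist (iso_fun x) (iso_fun y) = mdist x y ;
  iso_surj : forall y, exists x, iso_fun x = y }.

Section isometry_group.
Context {R : realType} {T : metricType R}.
Implicit Types f g h : Iso T.

Lemma isoP f g : (f : T -> T) =1 g -> f = g.
Proof.
case: f g => [f fd fs] [g gd gs] /= /funext fg; case: _ / fg gd gs => gd gs.
by congr MkIso; exact: Prop_irrelevance.
Qed.

HB.instance Definition _ := gen_eqMixin (Iso T).
HB.instance Definition _ := gen_choiceMixin (Iso T).

Definition iso_one : Iso T :=
  @MkIso R T id (fun x y => erefl) (fun y => ex_intro _ y erefl).

Fact iso_mul_dist f g x y : mdist (f (g x)) (f (g y)) = mdist x y.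
Proof. by rewrite !iso_mdist. Qed.

Fact iso_mul_surj f g y : exists x, f (g x) = y.
Proof.
by have [z <-] := iso_surj f y; have [x <-] := iso_surj g z; exists x.
Qed.

Definition iso_mul f g : Iso T :=
  @MkIso R T (f \o g) (iso_mul_dist f g) (iso_mul_surj f g).

Definition iso_invfun f (y : T) : T := projT1 (cid (iso_surj f y)).

Lemma iso_invfunK f : cancel (iso_invfun f) f.
Proof. by move=> y; rewrite /iso_invfun; case: cid. Qed.

Lemma iso_inj f : injective f.
Proof.
move=> x y fxy; apply: mdist_positivity.
by rewrite -(iso_mdist f) fxy mdistxx.
Qed.

Lemma iso_funK f : cancel f (iso_invfun f).
Proof. by move=> x; apply: (@iso_inj f); rewrite iso_invfunK. Qed.

Fact iso_inv_dist f x y :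
  mdist (iso_invfun f x) (iso_invfun f y) = mdist x y.
Proof. by rewrite -(iso_mdist f) !iso_invfunK. Qed.

Fact iso_inv_surj f y : exists x, iso_invfun f x = y.
Proof. by exists (f y); rewrite iso_funK. Qed.

Definition iso_inv f : Iso T :=
  @MkIso R T (iso_invfun f) (iso_inv_dist f) (iso_inv_surj f).

Fact iso_mulA : associative iso_mul.
Proof. by move=> f g h; exact: isoP. Qed.

Fact iso_mul1g : left_id iso_one iso_mul.
Proof. by move=> f; exact: isoP. Qed.

Fact iso_mulg1 : right_id iso_one iso_mul.
Proof. by move=> f; exact: isoP. Qed.

Fact iso_mulVg : left_inverse iso_one iso_inv iso_mul.
Proof. by move=> f; apply: isoP => x /=; rewrite iso_funK. Qed.

Fact iso_mulgV : right_inverse iso_one iso_inv iso_mul.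
Proof. by move=> f; apply: isoP => x /=; rewrite iso_invfunK. Qed.

HB.instance Definition _ := isGroup.Build (Iso T) iso_mulA
  iso_mul1g iso_mulg1 iso_mulVg iso_mulgV.

Lemma iso_mulE f g x : (f * g)%g x = f (g x).
Proof. by []. Qed.

Lemma iso_oneE x : (1%g : Iso T) x = x.
Proof. by []. Qed.

HB.instance Definition _ := Topological.copy (Iso T)
  (initial_topology
    (@iso_fun R T : Iso T -> {compact-open, T -> T})).

End isometry_group.

Definition discrete_subset (T : topologicalType) (A : set T) : Prop :=
  forall x, A x -> isolated A x.

Definition torsion_free (G : groupType) (A : set G) : Prop :=
  forall (g : G) (k : nat), A g -> (0 < k)%N -> (g ^+ k = 1)%g -> g = 1%g.

Section critical_exponent.
Context {R : realType} {T : metricType R}.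

Definition poincare_series (o : T) (G : set (Iso T)) (s : R) : \bar R :=
  \esum_(g in G) (expR (- s * mdist o (g o)))%:E.

Definition critical_exponent (o : T) (G : set (Iso T)) : \bar R :=
  ereal_inf [set s%:E | s in [set s | (poincare_series o G s < +oo)%E]].

End critical_exponent.

Section box_dimension.
Context {R : realType} {T : metricType R}.
Implicit Types (A F : set T) (r : R).

Definition diameter A : \bar R :=
  ereal_sup [set (mdist x y)%:E | x in A & y in A].

(* +oo if there is no finite cover. *)
Definition covering_number F r : \bar R :=
  ereal_inf [set k%:R%:E | k in [set k : nat | exists U : 'I_k -> set T,
    F `<=` \bigcup_i U i /\ forall i, (diameter (U i) <= r%:E)%E]].

Definition box_ratio F r : \bar R :=
  (lne (covering_number F r) * ((- ln r)^-1)%:E)%E.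

Definition has_box_dim F : Prop := cvg (box_ratio F r @[r --> 0^'+]).

Definition box_dim F : \bar R := lim (box_ratio F r @[r --> 0^'+]).

End box_dimension.

Section boundary_action.
Context {R : realType} {n : nat}.
Local Notation H := (hyperbolic_space R n).
Local Notation S := (boundary R n).
Implicit Types (g : Iso H) (xi eta : S).

(* Convergence in the closed Euclidean ball, i.e. to the Gromov boundary point
   represented by [xi]. *)
Definition tends_to_boundary (u : nat -> H) xi : Prop :=
  hval (u k) @[k --> \oo] --> bval xi.

Definition extends_at g xi eta : Prop :=
  forall u, tends_to_boundary u xi -> tends_to_boundary (g \o u) eta.

(* [xget] never takes its default value: see [boundary_actP] and
   [boundary_act_unique] below. *)
Definition boundary_act g xi : S := xget xi (extends_at g xi).

End boundary_action.

Section euclidean_topology.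
Context {R : realType} {n : nat}.
Implicit Types (u v w l : 'rV[R]_n).

Lemma dot_ball u v (e : R) : 0 < e ->
  dot (u - v) (u - v) < e ^+ 2 -> ball u e v.
Proof.
move=> e0 uve; split => // i j; rewrite (ord1 i) /ball/= -ltr_sqr ?nnegrE//; last exact: ltW.
apply: le_lt_trans uve; rewrite real_normK ?num_real// /dot (bigD1 j)//= !mxE -expr2.
by rewrite lerDl sumr_ge0// => k _; rewrite -expr2 sqr_ge0.
Qed.

Lemma cvg_dot (f g : nat -> 'rV[R]_n) u v :
  f k @[k --> \oo] --> u -> g k @[k --> \oo] --> v ->
  dot (f k) (g k) @[k --> \oo] --> dot u v.
Proof.
move=> fu gv; apply: cvg_big => [|i _]; first exact: add_continuous.
have comp (h : nat -> 'rV[R]_n) w : h k @[k --> \oo] --> w -> h k 0 i @[k --> \oo] --> w 0 i.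
  move=> hw; have := @continuous_cvg _ _ _ _ _ h (fun M : 'rV[R]_n => M 0 i) w (@coord_continuous R 1 n 0 i w) hw; exact.
by apply: cvgM; exact: comp.
Qed.

Lemma cvg_dotB (f : nat -> 'rV[R]_n) l :
  dot (f k - l) (f k - l) @[k --> \oo] --> 0 -> f k @[k --> \oo] --> l.
Proof.
move=> fl; apply/cvg_ballP => e e0.
have e2 : 0 < e ^+ 2 by rewrite exprn_gt0.
have : \forall k \near \oo, dot (f k - l) (f k - l) < e ^+ 2.
  by exact: cvgr_lt fl _ e2.
by apply: filterS => k fk; apply: ball_sym; exact: dot_ball.
Qed.

End euclidean_topology.

Section boundary_extension.
Context {R : realType} {n : nat}.
Local Notation H := (hyperbolic_space R n).
Local Notation S := (boundary R n).
Implicit Types (g : Iso H) (x y : H) (xi eta : S).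

Lemma hcosh_iso g x y : hcosh (g x) (g y) = hcosh x y.
Proof. by apply: arcosh_inj (iso_mdist g x y); exact: hcosh_ge1. Qed.

Lemma hval_lt1 x : 0 < 1 - dot (hval x) (hval x).
Proof. by rewrite subr_gt0; exact: hvalP. Qed.

Lemma dot0 : dot (0 : 'rV[R]_n) 0 < 1.
Proof. by rewrite -(scale0r 0) dotZl mul0r. Qed.

Definition horigin : H := Hyperbolic dot0.

Lemma hcosh_origin x :
  hcosh horigin x + 1 = 2 / (1 - dot (hval x) (hval x)).
Proof.
have h := hval_lt1 x; rewrite /hcosh/= sub0r !dotE.
have -> : dot (0 : 'rV[R]_n) 0 = 0 by rewrite -(scale0r 0) dotZl mul0r.
by field; lra.
Qed.

Lemma hcosh_lb a : exists2 c : R, 0 < c & forall x,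
  c / (1 - dot (hval x) (hval x)) <= hcosh a x + 1.
Proof.
pose p := dot (hval a) (hval a).
have p0 : 0 <= p := dot_ge0 _; have p1 : p < 1 := hvalP a.
pose r := Num.sqrt p.
have r0 : 0 <= r := sqrtr_ge0 _; have rE : r ^+ 2 = p := sqr_sqrtr p0.
have r1 : r < 1 by nra.
exists (2 * (1 - r) ^+ 2 / (1 - p)).
  by apply: divr_gt0; [apply: mulr_gt0 => //; apply: exprn_gt0|]; lra.
move=> x; have q0 := dot_ge0 (hval x); have q1 := hval_lt1 x.
have CS := dot_CauchySchwarz (hval a) (hval x).
rewrite /hcosh !dotE (dotC (hval x) (hval a)) -/p.
rewrite -/p in CS; move: q0 q1 CS.
set q := dot (hval x) (hval x); set m := dot (hval a) (hval x).
move=> q0 q1 CS.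
rewrite -subr_ge0.
have -> : 1 + 2 * (p + - m + (- m + - - q)) / ((1 - p) * (1 - q)) + 1 -
  2 * (1 - r) ^+ 2 / (1 - p) / (1 - q) =
  2 * (1 + p * q - 2 * m - (1 - r) ^+ 2) / ((1 - p) * (1 - q)).
  by field; lra.
apply: divr_ge0; last by apply: mulr_ge0; lra.
apply: mulr_ge0 => //.
have mr : m <= r by have := sqr_ge0 (m - r); nra.
nra.
Qed.

Lemma iso_lipschitz g : exists2 C : R, 0 < C &
  (forall x, 1 - dot (hval (g x)) (hval (g x)) <=
             C * (1 - dot (hval x) (hval x))) /\
  (forall x y, dot (hval (g x) - hval (g y)) (hval (g x) - hval (g y)) <=
               C ^+ 2 * dot (hval x - hval y) (hval x - hval y)).
Proof.
have [c c0 hc] := hcosh_lb (iso_invfun g horigin).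
have C0 : 0 < 2 / c by exact: divr_gt0.
have C1 x : 1 - dot (hval (g x)) (hval (g x)) <=
             2 / c * (1 - dot (hval x) (hval x)).
  have := hc x; rewrite -(hcosh_iso g) iso_invfunK hcosh_origin.
  have gx := hval_lt1 (g x); have xx := hval_lt1 x.
  rewrite ler_pdivlMr// mulrAC ler_pdivrMr// => h.
  by rewrite mulrAC ler_pdivlMr// mulrC.
exists (2 / c) => //; split => // x y.
have := hcosh_iso g x y; rewrite /hcosh => /addrI.
have := C1 x; have := C1 y.
have := hval_lt1 (g x); have := hval_lt1 (g y).
have := hval_lt1 x; have := hval_lt1 y.
set X := 1 - dot (hval x) (hval x); set Y := 1 - dot (hval y) (hval y).
set X' := 1 - dot (hval (g x)) (hval (g x)).
set Y' := 1 - dot (hval (g y)) (hval (g y)).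
have := dot_ge0 (hval x - hval y).
set D := dot (hval x - hval y) _; set D' := dot (hval (g x) - hval (g y)) _.
set K := 2 / c in C0 *.
move=> D0 y0 x0 gy0 gx0 gyC gxC e.
have -> : D' = D * (X' / X) * (Y' / Y).
  move/eqP: e.
  rewrite eqr_div ?mulf_neq0 ?lt0r_neq0// => /eqP h.
  apply: (mulfI (_ : 2 * X * Y != 0)); first by rewrite !mulf_neq0 ?lt0r_neq0.
  transitivity (2 * D' * (X * Y)); first by ring.
  by rewrite h; field; rewrite !lt0r_neq0.
rewrite -mulrA mulrC expr2 ler_wpM2r//.
have XK : X' / X <= K by rewrite ler_pdivrMr.
have YK : Y' / Y <= K by rewrite ler_pdivrMr.
by apply: ler_pM => //; apply: divr_ge0; exact: ltW.
Qed.

Lemma bval1 xi : dot (bval xi) (bval xi) = 1.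
Proof. exact/eqP/bvalP. Qed.

Lemma tends_to_boundaryP (u : nat -> H) xi : tends_to_boundary u xi <->
  dot (hval (u k) - bval xi) (hval (u k) - bval xi) @[k --> \oo] --> 0.
Proof.
split=> [uxi|]; last exact: cvg_dotB.
rewrite -[X in _ --> X](_ : dot (bval xi - bval xi) (bval xi - bval xi) = 0).
  by apply: cvg_dot; apply: cvgB => //; exact: cvg_cst.
by rewrite subrr -(scale0r 0) dotZl mul0r.
Qed.

Fact ray_subproof xi (k : nat) :
  dot ((1 - (k.+1%:R)^-1) *: bval xi) ((1 - (k.+1%:R)^-1) *: bval xi) < 1.
Proof.
rewrite !dotE bval1 mulr1.
have : 0 < k.+1%:R^-1 :> R by rewrite invr_gt0.
have : k.+1%:R^-1 <= 1 :> R by rewrite invf_le1 ?ler1n.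
by set t := _^-1; nra.
Qed.

Definition ray xi (k : nat) : H := Hyperbolic (ray_subproof xi k).

Lemma ray_tends_to xi : tends_to_boundary (ray xi) xi.
Proof.
apply/tends_to_boundaryP.
have -> : (fun k => dot (hval (ray xi k) - bval xi) (hval (ray xi k) - bval xi)) =
    (fun k => harmonic k * harmonic k).
  apply/funext => k /=; rewrite scalerBl scale1r addrAC subrr add0r.
  by rewrite !dotE bval1 /harmonic/=; ring.
by rewrite -[X in _ --> X](mulr0 0); apply: cvgM; exact: cvg_harmonic.
Qed.

Lemma dot_le2 (u v w : 'rV[R]_n) :
  dot (u - v) (u - v) <= 2 * dot (u - w) (u - w) + 2 * dot (v - w) (v - w).
Proof.
have := dot_ge0 (u + v - 2 *: w); rewrite !dotE.
rewrite (dotC v u) (dotC w u) (dotC w v); lra.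
Qed.

Lemma extends_at_ex g xi : exists eta, extends_at g xi eta.
Proof.
have [C C0 [gC gL]] := iso_lipschitz g.
pose u := ray xi.
have /tends_to_boundaryP uxi := @ray_tends_to xi.
have /cvg_ex[l gul] : cvg (hval (g (u k)) @[k --> \oo]).
  apply: cauchy_cvg; apply: cauchy_exP => e e0.
  have d0 : 0 < e ^+ 2 / (4 * C ^+ 2).
    by rewrite divr_gt0 ?mulr_gt0 ?exprn_gt0.
  have uN : \forall k \near \oo, dot (hval (u k) - bval xi)
    (hval (u k) - bval xi) < e ^+ 2 / (4 * C ^+ 2) by exact: cvgr_lt uxi _ d0.
  have [N _ NP] := uN.
  exists (hval (g (u N))).
  suff : \forall k \near \oo, ball (hval (g (u N))) e (hval (g (u k))) by [].
  apply: filterS uN => k uk; apply: dot_ball => //.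
  apply: le_lt_trans (gL _ _) _.
  rewrite mulrC -ltr_pdivlMr ?exprn_gt0//.
  apply: le_lt_trans (dot_le2 _ _ (bval xi)) _.
  have uNN : dot (hval (u N) - bval xi) (hval (u N) - bval xi) <
    e ^+ 2 / (4 * C ^+ 2) := NP N (leqnn N).
  have -> : e ^+ 2 / C ^+ 2 = 4 * (e ^+ 2 / (4 * C ^+ 2)).
    by field; rewrite gt_eqF.
  by move: uk uNN; lra.
have l1 : dot l l == 1.
  have gg : dot (hval (g (u k))) (hval (g (u k))) @[k --> \oo] --> dot l l.
    exact: cvg_dot.
  apply/eqP; apply: (cvg_unique _ gg) => //.
  have uu : dot (hval (u k)) (hval (u k)) @[k --> \oo] --> (1 : R).
    by rewrite -(bval1 xi); apply: cvg_dot; exact: ray_tends_to.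
  apply: (@squeeze_cvgr _ _ _ _
    (fun k => 1 - C * (1 - dot (hval (u k)) (hval (u k)))) (cst 1)).
  - apply: nearW => k /=; apply/andP; split; last exact: ltW (hvalP _).
    by have := gC (u k); lra.
  - rewrite -[X in _ --> X](_ : 1 - C * (1 - 1) = 1); last by ring.
    apply: cvgB; first exact: cvg_cst.
    by apply: cvgM; [exact: cvg_cst|apply: cvgB => //; exact: cvg_cst].
  - exact: cvg_cst.
exists (Boundary l1) => v /tends_to_boundaryP vxi.
apply: cvg_dotB => /=.
pose D k := dot (hval (v k) - bval xi) (hval (v k) - bval xi).
pose E k := dot (hval (u k) - bval xi) (hval (u k) - bval xi).
pose B k := dot (hval (g (u k)) - l) (hval (g (u k)) - l).
apply: (@squeeze_cvgr _ _ _ _ (cst 0)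
  (fun k => 2 * (C ^+ 2 * (2 * D k + 2 * E k)) + 2 * B k)).
- apply: nearW => k /=; rewrite dot_ge0/=.
  apply: le_trans (dot_le2 _ _ (hval (g (u k)))) _.
  have -> : dot (l - hval (g (u k))) (l - hval (g (u k))) = B k.
    by rewrite /B -opprB dotNl dotNr opprK.
  rewrite lerD2r ler_pM2l//; apply: le_trans (gL _ _) _.
  by rewrite ler_wpM2l ?sqr_ge0//; exact: dot_le2.
- exact: cvg_cst.
rewrite -[X in _ --> X](_ : 2 * (C ^+ 2 * (2 * 0 + 2 * 0)) + 2 * 0 = 0); last by ring.
have B0 : B k @[k --> \oo] --> (0 : R).
  rewrite -[X in _ --> X](_ : dot (l - l) (l - l) = 0).
    by apply: cvg_dot; apply: cvgB => //; exact: cvg_cst.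
  by rewrite subrr -(scale0r 0) dotZl mul0r.
have DE0 : 2 * D k + 2 * E k @[k --> \oo] --> (2 * 0 + 2 * 0 : R).
  apply: cvgD.
    by apply: cvgM; [exact: cvg_cst|exact: vxi].
  by apply: cvgM; [exact: cvg_cst|exact: uxi].
apply: cvgD; last by apply: cvgM; [exact: cvg_cst|exact: B0].
apply: cvgM; first exact: cvg_cst.
by apply: cvgM; [exact: cvg_cst|exact: DE0].
Qed.

Lemma boundary_actP g xi : extends_at g xi (boundary_act g xi).
Proof. exact: (@xgetPex _ xi (extends_at g xi) (extends_at_ex g xi)). Qed.

Lemma boundary_act_unique g xi eta :
  extends_at g xi eta -> boundary_act g xi = eta.
Proof.
move=> geta; apply: xget_unique => // eta' geta'; apply: val_inj.
have := geta _ (@ray_tends_to xi); have := geta' _ (@ray_tends_to xi).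
exact: cvg_unique.
Qed.

End boundary_extension.

Section parabolic.
Context {R : realType} {n : nat}.
Implicit Types P : set (Iso (hyperbolic_space R n)).

Definition fixed_by P (xi : boundary R n) : Prop :=
  forall p, P p -> boundary_act p xi = xi.

Definition parabolic P : Prop := exists! w, fixed_by P w.

End parabolic.

(* Main.v *)
Require Import Defs.
From mathcomp Require Import all_boot all_order all_algebra.
From mathcomp Require Import finmap ring lra.
From mathcomp Require Import all_classical all_reals all_analysis.

(** Send the fixed point [w] to infinity by an inversion, so that [P] acts on the
    horospheres at [w] by similarities of a Euclidean space.  A similarity with
    ratio different from 1 would have a fixed point [e]; if some [p] in [P] moved
    [e], the conjugates [g^k p g^-k] would be infinitely many elements of a proper
    set, so [P] would fix a second boundary point.  Hence [P] is a discrete group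
    of Euclidean isometries, and by Bieberbach's commutator argument the elements
    whose linear part is close to 1 commute and span an abelian subgroup [L] of
    finite index, acting by translations on an invariant affine subspace.  If [q]
    is the index of the squares in [L], doubling the radius of a ball multiplies
    the number of its orbit points by [q] up to bounded changes of the radius, so
    the number of orbit points at distance at most [r] is comparable to [r ^ k],
    [k = log_2 q].

    On the one hand [exp d(o, p o)] is comparable to [(1 + a_p)^2], where [a_p] is
    the Euclidean displacement of [p], so the critical exponent is [k / 2].  On
    the other hand two orbit points of [xi] at Euclidean distance [D] have chordal
    distance comparable to [D / ((1 + a_p) (1 + a_q))].  So the points with
    [a_p <= delta^(-1/2)] are about [delta]-separated, which bounds the covering
    number from below by [delta^(-k/2)]; a maximal [delta]-separated family is
    controlled from above by the convergent series of the [(1 + a_p)^(-2s)],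
    [s > k / 2]. *)

Set Implicit Arguments.
Unset Strict Implicit.
Unset Printing Implicit Defensive.

Import Order.TTheory GRing.Theory Num.Theory.
Import numFieldNormedType.Exports.

Local Open Scope classical_set_scope.
Local Open Scope ring_scope.

(** * Euclidean norm and Frobenius norm *)

Section euclidean_norm.
Context {R : realType}.

(** Both sides of the theorem are logarithmic rates, so multiplicative constants and bounded shifts
    of radii are free everywhere. That is why the index of the squares can stand in for a basis of
    the lattice, and why [k] is handled as a real number only. The factor 1/2 has a different source
    on each side. Between points of equal height, cosh of the distance is quadratic in the Euclidean
    displacement. On the boundary, the inversion shrinks distances by one factor for each of the two
    end points. The obstacle for the covers is that the orbit thins out unevenly towards [w]: at
    scale [delta] a set holds one orbit point far from [w] and very many close to it. Weighing the
    points by a convergent series treats all scales at once; the loss is an arbitrarily small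
    increase of the exponent, harmless in a limit of ratios. Horospheres are modelled by the
    hyperplane orthogonal to [w] inside the ambient space, with linear parts fixing [w], so that no
    basis of the hyperplane is chosen. Parabolicity speaks of boundary points only; that the
    similarity ratios are 1 has to be drawn from discreteness. *)

Definition enorm n (u : 'rV[R]_n) : R := Num.sqrt (dot u u).

Section vectors.
Context {n : nat}.
Implicit Types (u v w : 'rV[R]_n) (a : R).

Lemma enorm_ge0 u : 0 <= enorm u. Proof. exact: sqrtr_ge0. Qed.

Lemma enorm_sqr u : enorm u ^+ 2 = dot u u.
Proof. exact/sqr_sqrtr/dot_ge0. Qed.

Lemma enorm_le u a : 0 <= a -> (enorm u <= a) = (dot u u <= a ^+ 2).
Proof. by move=> a0; rewrite -enorm_sqr ler_sqr ?nnegrE// enorm_ge0. Qed.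

Lemma dot0l u : dot 0 u = 0.
Proof. by rewrite -(scale0r 0) dotZl mul0r. Qed.

Lemma enorm0 : enorm (0 : 'rV[R]_n) = 0.
Proof. by rewrite /enorm dot0l sqrtr0. Qed.

Lemma enorm_eq0 u : enorm u = 0 -> u = 0.
Proof. by move=> u0; apply: dot_eq0; rewrite -enorm_sqr u0 expr0n. Qed.

Lemma dot_le_enorm u v : `|dot u v| <= enorm u * enorm v.
Proof.
rewrite -ler_sqr ?nnegrE ?mulr_ge0 ?enorm_ge0// exprMn !enorm_sqr.
by rewrite real_normK ?num_real// dot_CauchySchwarz.
Qed.

Lemma enormD u v : enorm (u + v) <= enorm u + enorm v.
Proof.
rewrite enorm_le ?addr_ge0 ?enorm_ge0// sqrrD !enorm_sqr !dotE (dotC v u).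
have := le_trans (ler_norm _) (dot_le_enorm u v).
by rewrite mulr2n; lra.
Qed.

Lemma enormZ a u : enorm (a *: u) = `|a| * enorm u.
Proof.
by rewrite /enorm !dotE mulrA -expr2 sqrtrM ?sqr_ge0// sqrtr_sqr.
Qed.

Lemma enormN u : enorm (- u) = enorm u.
Proof. by rewrite -scaleN1r enormZ normrN1 mul1r. Qed.

Lemma enormB u v : enorm (u - v) = enorm (v - u).
Proof. by rewrite -opprB enormN. Qed.

Lemma enorm_triangle v u w : enorm (u - w) <= enorm (u - v) + enorm (v - w).
Proof. by apply: le_trans (enormD _ _); rewrite addrA subrK. Qed.

Lemma enorm_dist u v : enorm u <= enorm v + enorm (u - v).
Proof. by apply: le_trans (enormD _ _); rewrite addrC subrK. Qed.

Lemma coord_le_enorm u i : `|u 0 i| <= enorm u.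
Proof.
rewrite -ler_sqr ?nnegrE ?enorm_ge0// real_normK ?num_real// enorm_sqr.
rewrite /dot (bigD1 i)//= -expr2 lerDl sumr_ge0// => k _.
by rewrite -expr2 sqr_ge0.
Qed.

Lemma enorm_le_coord u a : 0 <= a -> (forall i, `|u 0 i| <= a) ->
  enorm u <= n%:R * a.
Proof.
move=> a0 ua; rewrite enorm_le ?mulr_ge0//.
have : dot u u <= \sum_(i < n) a ^+ 2.
  apply: ler_sum => i _; rewrite -expr2 -real_normK ?num_real//.
  by rewrite lerXn2r// nnegrE.
move=> /le_trans; apply; rewrite sumr_const card_ord exprMn -[leLHS]mulr_natl.
by rewrite ler_wpM2r ?sqr_ge0// -natrX ler_nat -mulnn; case: (n) => // k; rewrite leq_pmull.
Qed.

End vectors.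

(** Total boundedness as a finite colouring by the cells of a cubical grid; in this form it feeds
    [ncard_fibers] and [infinite_pigeonhole] directly. *)
Lemma grid_coloring n (B eta : R) : 0 < eta ->
  exists (T : finType) (c : 'rV[R]_n -> T), forall u v,
    enorm u <= B -> enorm v <= B -> c u = c v -> enorm (u - v) <= eta.
Proof.
(* A cell of side [e] has diameter at most [n%:R * e]; dividing by [n.+1] keeps [e] positive also
   for [n = 0]. *)
move=> eta0; pose e : R := eta / n.+1%:R.
have e0 : 0 < e by rewrite divr_gt0.
pose K := Num.truncn (2 * B / e).
exists {ffun 'I_n -> 'I_K.+1}.
exists (fun u => [ffun i => inord (Num.truncn ((u 0 i + B) / e))]) => u v uB vB cuv.
have ltK (w : 'rV[R]_n) i : enorm w <= B ->
    0 <= (w 0 i + B) / e /\ (Num.truncn ((w 0 i + B)%R / e) < K.+1)%N.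
  move=> wB; have := le_trans (coord_le_enorm w i) wB; rewrite ler_norml => /andP[w1 w2].
  split; first by rewrite divr_ge0 ?(ltW e0)//; lra.
  by rewrite ltnS; apply: le_truncn; rewrite ler_pM2r ?invr_gt0//; lra.
apply: (@le_trans _ _ (n%:R * e)).
  apply: enorm_le_coord; first exact: ltW.
  move=> i; rewrite !mxE.
  have [u0 uK] := ltK u i uB; have [v0 vK] := ltK v i vB.
  have := congr1 (fun f : {ffun 'I_n -> 'I_K.+1} => val (f i)) cuv.
  rewrite /= !ffunE !inordK// => tuv.
  have := truncn_itv u0; have := truncn_itv v0; rewrite tuv.
  move=> /andP[v1 v2] /andP[u1 u2].
  have -> : u 0 i - v 0 i = ((u 0 i + B) / e - (v 0 i + B) / e) * e.
    by field; rewrite gt_eqF.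
  rewrite normrM (gtr0_norm e0) -[leRHS]mul1r ler_wpM2r ?(ltW e0)//.
  by rewrite ler_norml; rewrite -natr1 in u2 v2; apply/andP; split; lra.
rewrite /e mulrA ler_pdivrMr// mulrC ler_wpM2l ?(ltW eta0)// ler_nat.
exact: leqnSn.
Qed.

(** The Frobenius norm. Vectorizing lets it inherit the triangle inequality and [grid_coloring] from
    [enorm]. *)
Definition fnorm n (A : 'M[R]_n) : R := enorm (mxvec A).

Section matrices.
Context {n : nat}.
Implicit Types (A B : 'M[R]_n) (u v : 'rV[R]_n).

Lemma dot_mx k (u v : 'rV[R]_k) : dot u v = (u *m v^T) 0 0.
Proof. by rewrite mxE; apply: eq_bigr => i _; rewrite !mxE. Qed.

Lemma dot_mxvec A B : dot (mxvec A) (mxvec B) = \tr (A *m B^T).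
Proof.
rewrite /dot (reindex _ (curry_mxvec_bij _ _))/=.
rewrite (eq_bigr (fun p => A p.1 p.2 * B p.1 p.2)); last first.
  by move=> [i j] _ /=; rewrite !mxvecE.
rewrite -(pair_big xpredT xpredT (fun i j => A i j * B i j))/=.
by apply: eq_bigr => i _; rewrite mxE; apply: eq_bigr => j _; rewrite mxE.
Qed.

Lemma dot_mulmx A u v : dot (u *m A) v = dot u (v *m A^T).
Proof. by rewrite !dot_mx trmx_mul trmxK mulmxA. Qed.

Lemma dot_orthogonal A u v : A *m A^T = 1%:M -> dot (u *m A) (v *m A) = dot u v.
Proof. by move=> A1; rewrite dot_mulmx -mulmxA A1 mulmx1. Qed.

Lemma enorm_orthogonal A u : A *m A^T = 1%:M -> enorm (u *m A) = enorm u.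
Proof. by move=> A1; rewrite /enorm dot_orthogonal. Qed.

Lemma fnorm_sqr A : fnorm A ^+ 2 = \tr (A *m A^T).
Proof. by rewrite /fnorm enorm_sqr dot_mxvec. Qed.

Lemma fnorm_rows A : fnorm A ^+ 2 = \sum_i dot (row i A) (row i A).
Proof.
rewrite fnorm_sqr; apply: eq_bigr => i _; rewrite mxE; apply: eq_bigr => j _.
by rewrite !mxE.
Qed.

Lemma fnorm_tr A : fnorm A^T = fnorm A.
Proof. by rewrite /fnorm /enorm !dot_mxvec trmxK mxtrace_mulC. Qed.

Lemma enorm_mulmx A u : enorm (u *m A) <= enorm u * fnorm A.
Proof.
rewrite enorm_le ?mulr_ge0 ?enorm_ge0// exprMn enorm_sqr -(fnorm_tr A) fnorm_rows.
rewrite mulr_sumr; apply: ler_sum => i _; rewrite -expr2.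
have -> : (u *m A) 0 i = dot u (row i A^T).
  by rewrite mxE; apply: eq_bigr => j _; rewrite !mxE.
exact: dot_CauchySchwarz.
Qed.

Lemma fnorm_mul A B : fnorm (A *m B) <= fnorm A * fnorm B.
Proof.
rewrite -ler_sqr ?nnegrE ?mulr_ge0 ?enorm_ge0// exprMn !fnorm_rows mulr_suml.
apply: ler_sum => i _; rewrite row_mul -!enorm_sqr -fnorm_rows -exprMn.
by rewrite lerXn2r ?nnegrE ?mulr_ge0 ?enorm_ge0// enorm_mulmx.
Qed.

Lemma fnorm_orthogonall A B : A *m A^T = 1%:M -> fnorm (A *m B) = fnorm B.
Proof.
move=> A1; rewrite /fnorm /enorm !dot_mxvec trmx_mul.
rewrite mxtrace_mulC -mulmxA (mulmxA A^T).
by rewrite (mulmx1C A1) mul1mx mxtrace_mulC.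
Qed.

Lemma fnorm_orthogonalr A B : A *m A^T = 1%:M -> fnorm (B *m A) = fnorm B.
Proof.
move=> A1; rewrite -fnorm_tr trmx_mul fnorm_orthogonall ?fnorm_tr//.
by rewrite trmxK (mulmx1C A1).
Qed.

Lemma fnormD A B : fnorm (A + B) <= fnorm A + fnorm B.
Proof. by rewrite /fnorm linearD; exact: enormD. Qed.

Lemma fnormN A : fnorm (- A) = fnorm A.
Proof. by rewrite /fnorm linearN; exact: enormN. Qed.

Lemma fnorm_ge0 A : 0 <= fnorm A. Proof. exact: enorm_ge0. Qed.

Lemma fnorm_eq0 A : fnorm A = 0 -> A = 0.
Proof. by move/enorm_eq0/eqP; rewrite mxvec_eq0 => /eqP. Qed.

Lemma fnorm_orthogonal A : A *m A^T = 1%:M -> fnorm A = Num.sqrt n%:R.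
Proof. by move=> A1; rewrite /fnorm /enorm dot_mxvec A1 mxtrace1. Qed.

End matrices.
End euclidean_norm.

(** * Counting functions with power growth *)

Section counting.

(** An infinite set gets the value 0, which is why the counting lemmas ask for finiteness. *)
Definition ncard (T : choiceType) (A : set T) : nat := #|` fset_set A|.

Lemma ncard_gt0 (T : choiceType) (A : set T) x :
  finite_set A -> A x -> (0 < ncard A)%N.
Proof.
move=> fA Ax; rewrite cardfs_gt0; apply/eqP => A0.
by move: Ax; rewrite (fset_set_set0 fA A0).
Qed.

Lemma ncard_inj (T U : choiceType) (A : set T) (B : set U) (f : T -> U) :
  finite_set A -> finite_set B ->
  (forall x, A x -> B (f x)) ->
  (forall x y, A x -> A y -> f x = f y -> x = y) ->
  (ncard A <= ncard B)%N.
Proof.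
move=> fA fB AB finj; rewrite /ncard.
rewrite -(_ : #|` [fset f x | x in fset_set A]%fset| = #|` fset_set A|); last first.
  by rewrite card_in_imfset// => x y; rewrite !in_fset_set// !inE; exact: finj.
apply/fsubset_leq_card/fsubsetP => _ /imfsetP[x /= + ->].
by rewrite !in_fset_set// !inE; exact: AB.
Qed.

Lemma ncard_sub (T : choiceType) (A B : set T) :
  finite_set B -> A `<=` B -> (ncard A <= ncard B)%N.
Proof. by move=> fB AB; apply: (@ncard_inj _ _ _ _ id) => //; exact: sub_finite_set AB fB. Qed.

Lemma ncard_prod (I : finType) (T U : choiceType) (A : set T) (B : set U)
    (f : I -> T -> U) :
  finite_set A -> finite_set B ->
  (forall i x, A x -> B (f i x)) ->
  (forall i j x y, A x -> A y -> f i x = f j y -> i = j /\ x = y) ->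
  (#|I| * ncard A <= ncard B)%N.
Proof.
move=> fA fB AB finj.
have -> : (#|I| * ncard A)%N = size [seq f i x | i <- enum I, x <- fset_set A].
  by rewrite size_allpairs -cardE.
apply: uniq_leq_size.
  apply: allpairs_uniq; rewrite ?enum_uniq ?fset_uniq// => -[i x] [j y].
  move=> /allpairsP[[i' x'] [_ /= xA [-> ->]]].
  move=> /allpairsP[[j' y'] [_ /= yA [-> ->]]].
  move: xA yA; rewrite !in_fset_set// !inE => xA yA /finj[]//.
  by move=> -> ->.
move=> _ /allpairsP[[i x] [_ /= xA ->]].
by move: xA; rewrite !in_fset_set// !inE; exact: AB.
Qed.

Lemma ncard_fibers (I : finType) (T : choiceType) (A : set T) (c : T -> I) m :
  finite_set A -> (forall i, (ncard [set x | A x /\ c x = i] <= m)%N) ->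
  (ncard A <= #|I| * m)%N.
Proof.
move=> fA cm; rewrite /ncard card_fset_sum1 (partition_big c xpredT)//=.
rewrite -sum_nat_const; apply: leq_sum => i _.
apply: leq_trans (cm i); rewrite /ncard -big_filter sum1_size.
rewrite card_fset_sum1 sum1_size; apply: uniq_leq_size.
  by rewrite filter_uniq// fset_uniq.
move=> x; rewrite mem_filter in_fset_set// => /andP[/eqP cx xA].
rewrite in_fset_set; first by rewrite inE/=; split => //; exact: set_mem.
by apply: sub_finite_set fA => y [].
Qed.

Lemma ncard_set1 (T : choiceType) (x : T) : ncard [set x] = 1%N.
Proof. by rewrite /ncard fset_set1 cardfs1. Qed.

End counting.

Section power_growth.
Context {R : realType}.
Implicit Types (N : R -> nat) (k r c : R).

Definition power_growth N k := exists2 C : R, 0 < C & forall r, 1 <= r ->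
  r `^ k / C <= (N r)%:R <= C * r `^ k.

Lemma dyadic_scale r : 1 <= r -> exists j : nat, 2 ^+ j <= r < 2 ^+ j.+1.
Proof.
move=> r1; have [m rm] : exists m : nat, r < 2 ^+ m.
  exists (Num.bound r); apply: lt_le_trans (archi_boundP _) _; first lra.
  by rewrite -natrX ler_nat ltnW// ltn_expl.
have ex : exists m, r < 2 ^+ m by exists m.
case: (ex_minnP ex) => -[|j] jr jmin; first by move: jr; rewrite expr0 ltNge r1.
by exists j; rewrite jr andbT leNgt; apply/negP => /jmin; rewrite ltnn.
Qed.

(** Iterating along [2 ^+ j] multiplies the count by [q ^ j], whence the exponent log_2 [q]. The
    error [c] does not pile up, since every later doubling happens at a larger radius. *)
Lemma power_growth_doubling N (q : nat) c :
  {homo N : x y / x <= y >-> (x <= y)%N} -> (forall r, 0 <= r -> (0 < N r)%N) ->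
  (0 < q)%N -> 0 <= c ->
  (forall r, 0 <= r -> (N (2 * r)%R <= q * N (r + c)%R)%N) ->
  (forall r, 0 <= r -> (q * N r <= N (2 * r + c)%R)%N) ->
  power_growth N (ln q%:R / ln 2).
Proof.
move=> mN N1 q0 c0 up lo.
set k := ln q%:R / ln 2.
have ln2 : 0 < ln 2 :> R by rewrite ln_gt0// ltr1n.
have k0 : 0 <= k by rewrite divr_ge0 ?ln_ge0 ?ler1n// ltW.
have two_pow j : (2 ^+ j) `^ k = q%:R ^+ j :> R.
  rewrite -powR_mulrn// -powRrM mulrC powRrM -powR_mulrn//; congr (_ `^ _).
  by rewrite /powR pnatr_eq0/= /k divfK ?gt_eqF// lnK ?posrE ?ltr0n.
(* The shift [a] is stable under a doubling with error [c]: [a / 2 + c <= a] serves the radii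
   [2 ^+ j * s + a], and [c <= a] the radii [2 ^+ j * a - a]. The summand 1 gives [1 <= a]. *)
pose a := 2 * c + 1.
have upj j s : 0 <= s -> (N (2 ^+ j * s + a)%R <= q ^ j * N (s + a)%R)%N.
  move=> s0; elim: j => [|j ih]; first by rewrite expr0 mul1r expn0 mul1n.
  rewrite expnS -mulnA.
  have j0 : 0 <= 2 ^+ j * s by rewrite mulr_ge0// exprn_ge0.
  apply: (@leq_trans (q * N ((2 ^+ j * s + a / 2) + c)%R)).
    rewrite -[X in N X](_ : 2 * (2 ^+ j * s + a / 2) = _); last by rewrite exprS; field.
    by apply: up; rewrite /a; lra.
  by apply: leq_trans (leq_mul (leqnn _) ih); rewrite leq_mul2l mN ?orbT// /a; lra.
have loj j : (q ^ j <= N (2 ^+ j * a - a)%R)%N.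
  elim: j => [|j ih]; first by rewrite expr0 expn0 N1// /a; lra.
  have j1 : 1 <= 2 ^+ j :> R by rewrite exprn_ege1// ler1n.
  rewrite expnS; apply: leq_trans (leq_mul (leqnn _) ih) _.
  apply: leq_trans (lo _ _) _; first by rewrite /a; nra.
  by apply: mN; rewrite exprS /a; lra.
pose C := q%:R * (N (1 + a)%R)%:R + q%:R * (a) `^ k.
have a1 : 1 <= a by rewrite /a; lra.
have ak : 1 <= a `^ k by rewrite -[leLHS](powRr0 a) ler_powR.
have qq : 1 <= q%:R :> R by rewrite ler1n.
have C1 : q%:R * (N (1 + a)%R)%:R <= C by rewrite lerDl; nra.
have C2 : q%:R * a `^ k <= C by rewrite lerDr mulr_ge0.
have C0 : 0 < C by apply: lt_le_trans C2; nra.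
exists C => // r r1; apply/andP; split; last first.
  have [j /andP[jr rj]] := dyadic_scale r1.
  have : (N r <= q ^ j.+1 * N (1 + a)%R)%N.
    by apply: leq_trans (upj _ _ ler01); apply: mN; lra.
  rewrite -(ler_nat R) natrM natrX => /le_trans; apply.
  rewrite exprS mulrAC ler_pM ?mulr_ge0 ?exprn_ge0//.
  by rewrite -two_pow ge0_ler_powR// nnegrE ?exprn_ge0//; lra.
have ra : 1 <= (r + a) / a by rewrite ler_pdivlMr; lra.
have [j /andP[jr rj]] := dyadic_scale ra.
have a0 : 0 < a by lra.
have {}jr : 2 ^+ j * a <= r + a by rewrite -ler_pdivlMr.
have {}rj : r / a <= 2 ^+ j.+1.
  by apply: le_trans (ltW rj); rewrite ler_pM2r ?invr_gt0//; lra.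
have Nr : (q ^ j <= N r)%N by apply: leq_trans (loj j) _; apply: mN; lra.
rewrite ler_pdivrMr// mulrC.
have -> : r = r / a * a by rewrite divfK// gt_eqF.
rewrite powRM ?divr_ge0//; [|lra..]; rewrite divfK ?gt_eqF//.
have rak : (r / a) `^ k <= q%:R ^+ j.+1.
  by rewrite -two_pow ge0_ler_powR// nnegrE ?exprn_ge0// divr_ge0//; lra.
apply: le_trans (ler_wpM2r (powR_ge0 _ _) rak) _.
apply: le_trans (ler_wpM2r _ C2) => //.
rewrite exprS -!mulrA ler_wpM2l// mulrC ler_wpM2l ?powR_ge0//.
by rewrite -natrX ler_nat.
Qed.

Lemma power_growth_comparable N N' k (m : nat) c : 0 <= k -> (0 < m)%N -> 0 <= c ->
  {homo N' : x y / x <= y >-> (x <= y)%N} -> (forall r, 0 <= r -> (0 < N' r)%N) ->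
  (forall r, 0 <= r -> (N' r <= m * N (r + c)%R)%N) ->
  (forall r, 0 <= r -> (N r <= m * N' (r + c)%R)%N) ->
  power_growth N k -> power_growth N' k.
Proof.
move=> k0 m0 c0 mN' N'1 up lo [C C0 NC].
have m1 : 1 <= m%:R :> R by rewrite ler1n.
(* For [1 <= r] one has [r + c <= (1 + c) * r], so [d] is the price of one shift of the radius. *)
pose d := (1 + c) `^ k.
have d0 : 0 < d by rewrite powR_gt0; lra.
have mCd : 0 <= d * (m%:R * C) by rewrite !mulr_ge0// ltW.
have dC : d <= d * (m%:R * C) + d by rewrite lerDr.
have dCd : d * (m%:R * C) <= d * (m%:R * C) + d by rewrite lerDl ltW.
exists (d * (m%:R * C) + d); first by apply: lt_le_trans dC.
move=> r r1; have rk0 := powR_ge0 r k; apply/andP; split; last first.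
  have r0 : 0 <= r by lra.
  have := up _ r0; rewrite -(ler_nat R) natrM => /le_trans; apply.
  apply: le_trans (ler_wpM2r rk0 dCd).
  have rc1 : 1 <= r + c by lra.
  have /andP[_ /(ler_wpM2l (ler0n R m)) ] := NC _ rc1 => /le_trans; apply.
  have -> : d * (m%:R * C) * r `^ k = m%:R * (C * (d * r `^ k)) by ring.
  rewrite ler_wpM2l// ler_wpM2l// ?(ltW C0)// -powRM//; last lra.
  by rewrite ge0_ler_powR// ?nnegrE; nra.
rewrite ler_pdivrMr; last by apply: lt_le_trans dC.
(* Below [1 + c] the radius [r - c] leaves the range of [NC]; there the power of [r] is at most [d]
   while [N' r] is at least 1. *)
have [rc|rc] := leP (1 + c) r; last first.
  have : 1 <= (N' r)%:R :> R by rewrite ler1n N'1//; lra.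
  have : r `^ k <= d by rewrite ge0_ler_powR// ?nnegrE; lra.
  by nra.
have rc1 : 1 <= r - c by lra.
have rc0 : 0 <= r - c by lra.
have /andP[+ _] := NC _ rc1; rewrite ler_pdivrMr// => NCr.
have := lo _ rc0; rewrite subrK -(ler_nat R) natrM => loN.
apply: le_trans (ler_wpM2l _ dCd) => //.
apply: (@le_trans _ _ (d * (r - c) `^ k)).
  rewrite -powRM//; last lra.
  by rewrite ge0_ler_powR// ?nnegrE; nra.
have -> : (N' r)%:R * (d * (m%:R * C)) = d * (m%:R * (N' r)%:R * C) by ring.
rewrite ler_wpM2l ?(ltW d0)//; apply: le_trans NCr _.
by rewrite ler_wpM2r// ltW.
Qed.
End power_growth.

(** * Orbit growth of lattices *)

Section subgroups.
Context {G : groupType}.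
Implicit Types (L : set G) (g h : G).

Lemma group_closed_one L : group_closed (mem L) -> L 1%g.
Proof. by case=> /set_mem. Qed.

Lemma group_closed_mul L g h : group_closed (mem L) -> L g -> L h -> L (g * h)%g.
Proof. by move=> cL Lg Lh; apply/set_mem/(group_closedM cL); exact: mem_set. Qed.

Lemma group_closed_inv L g : group_closed (mem L) -> L g -> L g^-1%g.
Proof. by move=> cL Lg; apply/set_mem/(group_closedV cL); exact: mem_set. Qed.

Lemma group_closedI L : L 1%g -> (forall g h, L g -> L h -> L (g * h)%g) ->
  (forall g, L g -> L g^-1%g) -> group_closed (mem L).
Proof.
move=> L1 LM LV; split; first exact: mem_set.
by move=> g h /set_mem Lg /set_mem Lh; apply/mem_set/LM/LV.
Qed.

Lemma group_closed_exp L g k : group_closed (mem L) -> L g -> L (g ^+ k)%g.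
Proof.
move=> cL Lg; elim: k => [|k ih]; first by rewrite expg0; exact: group_closed_one.
by rewrite expgS; exact: group_closed_mul.
Qed.

Definition commuting L := forall g h, L g -> L h -> (g * h = h * g)%g.

End subgroups.

Section orbit_growth.
Context {R : realType} {G : groupType} {n : nat}.
Variables (L : set G) (pos : G -> 'rV[R]_n).
Hypothesis cL : group_closed (mem L).
Hypothesis posM : forall k g h, L k -> L g -> L h ->
  enorm (pos (k * g)%g - pos (k * h)%g) = enorm (pos g - pos h).

Let L1 : L 1%g := group_closed_one cL.
Let LM g h : L g -> L h -> L (g * h)%g := @group_closed_mul _ L g h cL.
Let LV g : L g -> L g^-1%g := @group_closed_inv _ L g cL.

Definition displacement (g : G) : R := enorm (pos g - pos 1%g).

Definition orbit_ball (r : R) : set G := [set g | L g /\ displacement g <= r].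

Definition orbit_count (r : R) : nat := ncard (orbit_ball r).

Hypothesis proper : forall r, finite_set (orbit_ball r).

Lemma displacement1 : displacement 1%g = 0.
Proof. by rewrite /displacement subrr enorm0. Qed.

Lemma displacement_dist g h : L g -> L h ->
  displacement (g^-1 * h)%g = enorm (pos h - pos g).
Proof.
move=> Lg Lh; rewrite /displacement -(posM Lg (LM (LV Lg) Lh) L1).
by rewrite mulgA mulgV mul1g mulg1.
Qed.

Lemma displacementV g : L g -> displacement g^-1%g = displacement g.
Proof.
by move=> Lg; rewrite -[g^-1%g]mulg1 displacement_dist// enormB.
Qed.

Lemma displacementM g h : L g -> L h ->
  displacement (g * h)%g <= displacement g + displacement h.
Proof.
move=> Lg Lh; have := displacement_dist (LV Lg) Lh; rewrite invgK => ->.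
rewrite -(displacementV Lg) [leRHS]addrC /displacement (enormB (pos g^-1%g) (pos 1%g)).
exact: enorm_triangle.
Qed.

Lemma orbit_count_homo : {homo orbit_count : x y / x <= y >-> (x <= y)%N}.
Proof.
by move=> r s rs; apply: ncard_sub => // g [Lg gr]; split => //; exact: le_trans rs.
Qed.

Lemma orbit_count_gt0 r : 0 <= r -> (0 < orbit_count r)%N.
Proof. by move=> r0; apply: (@ncard_gt0 _ _ 1%g) => //; split; rewrite ?displacement1. Qed.

(** Rescaling by [r^-1] reduces every radius to one colouring of the ball of radius 4. Orbit points
    of one colour are within [r] of each other, and the inverse of one of them carries them into the
    ball of radius [r]. That [K] is independent of [r] is what bounds the index of the squares
    below. *)
Lemma orbit_count_doubling :
  exists K : nat, forall r, 0 < r -> (orbit_count (4 * r)%R <= K * orbit_count r)%N.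
Proof.
have [T [c cP]] := @grid_coloring R n 4 1 ltr01.
exists #|T| => r r0.
apply: (@ncard_fibers _ _ _ (fun g => c (r^-1 *: (pos g - pos 1%g)))) => // t.
have [[g0 [[Lg0 g0r] g0t]]|no] := pselect (exists g, orbit_ball (4 * r) g /\
    c (r^-1 *: (pos g - pos 1%g)) = t); last first.
  rewrite (_ : [set x | _] = set0) ?/ncard ?fset_set0 ?cardfs0//.
  by apply/seteqP; split => // g ?; apply: no; exists g.
apply: (@ncard_inj _ _ _ _ (fun g => g0^-1 * g)%g) => //.
- by apply: sub_finite_set (proper (4 * r)) => g [].
- move=> g [[Lg gr] gt]; split; first exact: LM (LV Lg0) Lg.
  rewrite displacement_dist//.
  have := cP (r^-1 *: (pos g - pos 1%g)) (r^-1 *: (pos g0 - pos 1%g)).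
  rewrite -scalerBr opprB addrA subrK !enormZ gtr0_norm ?invr_gt0//.
  rewrite ![r^-1 * _]mulrC !ler_pdivrMr// mul1r; apply => //.
  by rewrite gt g0t.
- by move=> g h _ _ /mulgI.
Qed.

End orbit_growth.

Section lattice_growth.
Context {R : realType} {G : groupType} {n : nat}.
Variables (L : set G) (pos : G -> 'rV[R]_n).
Hypothesis cL : group_closed (mem L).
Hypothesis posM : forall k g h, L k -> L g -> L h ->
  enorm (pos (k * g)%g - pos (k * h)%g) = enorm (pos g - pos h).
Hypothesis proper : forall r, finite_set (orbit_ball L pos r).
Hypothesis cmL : commuting L.
Hypothesis tfL : torsion_free L.
Hypothesis disp2 : forall g, L g ->
  displacement pos (g * g)%g = 2 * displacement pos g.

Local Notation N := (orbit_count L pos).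
Local Notation disp := (displacement pos).

Let LM g h : L g -> L h -> L (g * h)%g := @group_closed_mul _ L g h cL.
Let LV g : L g -> L g^-1%g := @group_closed_inv _ L g cL.

(** In a commuting [L] this is congruence modulo the subgroup of squares; an [indep] family
    represents distinct classes. *)
Let same g h := exists2 k, L k & h = (g * (k * k))%g.

Let indep q (v : 'I_q -> G) :=
  (forall i, L (v i)) /\ (forall i j, same (v i) (v j) -> i = j).

Let same_sym g h : same g h -> same h g.
Proof.
by case=> k Lk ->; exists k^-1%g; [exact: LV|rewrite -mulgA -invgM mulgV mulg1].
Qed.

Let square_inj g h : L g -> L h -> (g * g = h * h)%g -> g = h.
Proof.
move=> Lg Lh gh; apply/(mulIg h^-1)%g; rewrite mulgV.
apply: (tfL (k := 2)) => //; first exact: LM (LV Lh).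
rewrite expgS expg1 {1}(cmL Lg (LV Lh)) -mulgA (mulgA g) gh -(mulgA h).
by rewrite mulgV mulg1 mulVg.
Qed.

(** The products [v i * (g * g)] are pairwise distinct: different indices stay in different classes,
    and squaring is injective because [L] is commuting and torsion free. *)
Let indep_lower q (v : 'I_q -> G) c r : indep v ->
  (forall i, disp (v i) <= c) -> (q * N r <= N (2 * r + c)%R)%N.
Proof.
move=> [Lv iv] vc; rewrite -[X in (X * _)%N]card_ord.
apply: (ncard_prod (f := fun i g => (v i * (g * g))%g)) => //.
- move=> i g [Lg gr]; split; first by apply/LM/LM.
  apply: le_trans (displacementM cL posM _ _) _ => //; first exact: LM.
  by rewrite disp2//; have := vc i; lra.
- move=> i j g h [Lg _] [Lh _] ij.
  suff {}ijE : i = j by subst j; split => //; apply: square_inj => //; exact: mulgI ij.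
  have [k Lk kh] : exists2 k, L k & (k * h)%g = g.
    by exists (g * h^-1)%g; [exact: LM (LV Lh)|rewrite -mulgA mulVg mulg1].
  apply: iv; exists k => //; apply/(mulIg (h * h))%g; rewrite -ij -mulgA.
  congr (_ * _)%g; rewrite -[in LHS]kh -!mulgA; congr (_ * _)%g.
  by rewrite !mulgA (cmL Lh Lk).
Qed.

(** The index of the squares is finite: at [r = c] the lower estimate reads [q * N c <= N (3 * c)],
    while [orbit_count_doubling] bounds [N (4 * c)] by [K * N c]. *)
Let indep_bounded : exists K : nat, forall q (v : 'I_q -> G), indep v -> (q <= K)%N.
Proof.
have [K KP] := orbit_count_doubling cL posM proper; exists K => q v iv.
pose c := 1 + \sum_i disp (v i).
have vc i : disp (v i) <= c.
  rewrite /c (bigD1 i)//= addrCA lerDl addr_ge0// sumr_ge0// => j _.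
  exact: enorm_ge0.
have c0 : 0 < c by rewrite ltr_pwDl// sumr_ge0// => j _; exact: enorm_ge0.
have N0 := orbit_count_gt0 cL proper (ltW c0).
rewrite -(leq_pmul2r N0); apply: leq_trans (indep_lower _ iv vc) _.
apply: leq_trans (KP _ c0); apply: orbit_count_homo => //; lra.
Qed.

(** An [indep] family of maximal size [q] meets every class, so each [g] in [L] is some
    [v i * (k * k)]. As squares double displacements exactly, [disp k] is half of [disp g] up to a
    constant, which is the upper doubling estimate; the lower one is [indep_lower]. *)
Lemma lattice_power_growth : exists2 k : R, 0 <= k & power_growth N k.
Proof.
have [K KP] := indep_bounded.
pose Q q := `[< exists v : 'I_q -> G, indep v >].
have Q1 : Q 1%N.
  apply/asboolP; exists (fun=> 1%g); split=> [_|i j _]; last by rewrite !ord1.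
  exact: group_closed_one cL.
have QK q : Q q -> (q <= K)%N by move=> /asboolP[v]; exact: KP.
have exQ : exists q, Q q by exists 1%N.
case: (ex_maxnP exQ QK) => q /asboolP[v iv] qmax.
have q0 : (0 < q)%N := qmax _ Q1.
have cover g : L g -> exists i, same (v i) g.
  move=> Lg; apply: contrapT => no.
  suff /qmax : Q q.+1 by rewrite ltnn.
  apply/asboolP; exists (fun i => if unlift ord_max i is Some j then v j else g).
  have [Lv sv] := iv; split=> [i|i j].
    by case: (unlift _ _) => [j|//].
  case: (unliftP ord_max i) => [i' ->|->]; case: (unliftP ord_max j) => [j' ->|->] //.
  - by move=> /sv ->.
  - by move=> ?; case: no; exists i'.
  - by move=> /same_sym ?; case: no; exists j'.
pose c := \sum_i disp (v i).
have vc i : disp (v i) <= c.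
  rewrite /c (bigD1 i)//= lerDl sumr_ge0// => j _; exact: enorm_ge0.
have c0 : 0 <= c by rewrite sumr_ge0// => j _; exact: enorm_ge0.
exists (ln q%:R / ln 2).
  by rewrite divr_ge0 ?ln_ge0 ?ler1n//.
apply: (@power_growth_doubling _ _ q c) => //.
- exact: orbit_count_homo.
- exact: orbit_count_gt0.
- move=> r r0.
  (* A default index for the elements outside [L]. *)
  have i0 : 'I_q by case: (q) q0 => // q' _; exact: ord0.
  have /choice[f fP] g : exists ik : 'I_q * G, L g -> L ik.2 /\
      g = (v ik.1 * (ik.2 * ik.2))%g.
    have [/cover[i [k Lk gE]]|] := pselect (L g); first by exists (i, k).
    by exists (i0, 1%g).
  rewrite -[X in (_ <= X * _)%N]card_ord.
  apply: (@ncard_fibers _ _ _ (fun g => (f g).1)) => // i.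
  apply: (@ncard_inj _ _ _ _ (fun g => (f g).2)) => //.
  + by apply: sub_finite_set (proper (2 * r)) => g [].
  + move=> g [[Lg gr] fg]; have [Lk gE] := fP _ Lg; split => //.
    have vL := iv.1 i.
    have kkE : ((f g).2 * (f g).2 = (v i)^-1 * g)%g.
      by rewrite [in RHS]gE fg mulgA mulVg mul1g.
    have : disp ((f g).2 * (f g).2)%g <= c + 2 * r.
      rewrite kkE; apply: le_trans (displacementM cL posM (LV vL) Lg) _.
      by rewrite (displacementV cL posM vL) lerD.
    by rewrite disp2//; lra.
  + move=> g h [[Lg _] fg] [[Lh _] fh] gh.
    by rewrite (fP _ Lg).2 (fP _ Lh).2 fg fh gh.
- by move=> r r0; exact: indep_lower iv vc.
Qed.

End lattice_growth.

(** * Discrete groups of Euclidean isometries *)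

Lemma finite_set_pos_lb (R : realDomainType) (T : choiceType) (X : set T) (f : T -> R) :
  finite_set X -> (forall x, X x -> 0 < f x) ->
  exists2 e, 0 < e & forall x, X x -> e <= f x.
Proof.
move=> /finite_seqP[s ->] fs.
elim: s fs => [|x s ih] fs; first by exists 1.
have [y ys|e e0 es] := ih; first by apply: fs; rewrite /= in_cons ys orbT.
have fx : 0 < f x by apply: fs; rewrite /= mem_head.
exists (Num.min e (f x)); first by rewrite lt_min e0.
move=> y; rewrite /= in_cons => /orP[/eqP ->|ys]; first by rewrite ge_min lexx orbT.
by rewrite ge_min es.
Qed.

Lemma geometric_small (R : archiRealFieldType) (s e : R) : 0 < e ->
  exists k : nat, s / 2 ^+ k < e.
Proof.
move=> e0; exists (Num.bound (`|s| / e)).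
rewrite ltr_pdivrMr ?exprn_gt0// mulrC -ltr_pdivrMr//.
apply: (@le_lt_trans _ _ (`|s| / e)).
  by rewrite ler_pM2r ?invr_gt0// ler_norm.
apply: lt_le_trans (archi_boundP _) _; first by rewrite divr_ge0// ltW.
by rewrite -natrX ler_nat ltnW// ltn_expl.
Qed.

Section orthogonal_matrices.
Context {R : realType} {n : nat}.
Implicit Types (A B C D : 'M[R]_n) (u v : 'rV[R]_n).

(* With [D = A - A'], [C D = C A - A C], hence [tr (D^T C D)] is the trace of a
   commutator while [C] is almost the identity. *)
Lemma commute_conjugate_near1 A A' C :
  A *m A^T = 1%:M -> A' *m A'^T = 1%:M -> fnorm (C - 1%:M) < 1 ->
  C *m A' = A *m C -> A *m A' = A' *m A -> A *m C = C *m A.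
Proof.
move=> A1 A'1 C1 CA' AA'.
pose D := A - A'.
have CD : C *m D = C *m A - A *m C by rewrite /D mulmxBr CA'.
have AA'T : A *m A'^T = A'^T *m A.
  have /(congr1 (mulmx A'^T)) /(congr1 (mulmxr A'^T)) /= := AA'.
  rewrite -!mulmxA A'1 mulmx1 => ->.
  by rewrite !mulmxA (mulmx1C A'1) mul1mx.
have ADT : A *m D^T = D^T *m A.
  by rewrite /D linearB/= mulmxBr mulmxBl A1 (mulmx1C A1) AA'T.
have tr0 : dot (mxvec (C *m D)) (mxvec D) = 0.
  rewrite dot_mxvec CD mulmxBl -!mulmxA ADT linearB/= [X in _ - X]mxtrace_mulC.
  by rewrite -!mulmxA subrr.
clearbody D; suff : fnorm D = 0.
  move=> /fnorm_eq0 D0; apply/eqP; rewrite eq_sym -subr_eq0 -CD D0.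
  by rewrite mulmx0.
have : fnorm D ^+ 2 <= fnorm (C - 1%:M) * fnorm D * fnorm D.
  rewrite {1}/fnorm enorm_sqr.
  have -> : dot (mxvec D) (mxvec D) = - dot (mxvec ((C - 1%:M) *m D)) (mxvec D).
    by rewrite mulmxBl mul1mx linearB/= dotDl dotNl tr0 sub0r opprK.
  apply: le_trans (ler_norm _) _; rewrite normrN.
  apply: le_trans (dot_le_enorm _ _) _.
  by rewrite ler_wpM2r ?enorm_ge0// fnorm_mul.
have := fnorm_ge0 D; have := fnorm_ge0 (C - 1%:M).
move: C1; set x := fnorm D; set y := fnorm _ => y1 y0 x0 xy.
apply/eqP; rewrite eq_le x0 andbT leNgt; apply/negP => x_gt0.
have : 0 < (1 - y) * (x * x) by rewrite !mulr_gt0// subr_gt0.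
by nra.
Qed.

(** The image of [C - 1%:M] is orthogonal to the vectors fixed by [C], so a vector killed by a power
    of [C - 1%:M] is already killed by the first one. *)
Lemma orthogonal_sub1_nilpotent C u k : C *m C^T = 1%:M ->
  iter k (fun w => w *m C - w) u = 0 -> (0 < k)%N -> u *m C = u.
Proof.
move=> C1; have step v : (v *m C - v) *m C - (v *m C - v) = 0 -> v *m C - v = 0.
  set w := v *m C - v; move=> /eqP; rewrite subr_eq0 => /eqP wC.
  apply: dot_eq0; rewrite {2}/w dotDr dotNr -{1}wC dot_orthogonal//.
  by rewrite subrr.
elim: k => // -[|k] ih; first by move=> /= /eqP; rewrite subr_eq0 => /eqP.
by move=> /= /step H _; exact: ih.
Qed.

End orthogonal_matrices.

(** * Bieberbach's commutator argument *)

Section euclidean_action.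
Context {R : realType} {G : groupType} {n : nat}.
Variables (P : set G) (A : G -> 'M[R]_n) (b : G -> 'rV[R]_n).

(** Vectors are rows: [g] acts by sending [z] to [z *m A g + b g], hence the reversed order of the
    linear parts in a product. *)
Definition euclidean_action : Prop :=
  [/\ forall g, P g -> A g *m (A g)^T = 1%:M,
      forall g h, P g -> P h -> A (g * h)%g = A h *m A g &
      forall g h, P g -> P h -> b (g * h)%g = b h *m A g + b g].

Hypothesis cP : group_closed (mem P).
Hypothesis actP : euclidean_action.
Hypothesis properP : forall r, finite_set [set g | P g /\ enorm (b g) <= r].
Hypothesis faithfulP : forall g, P g -> A g = 1%:M -> b g = 0 -> g = 1%g.

Let P1 : P 1%g := group_closed_one cP.
Let PM g h : P g -> P h -> P (g * h)%g := @group_closed_mul _ P g h cP.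
Let PV g : P g -> P g^-1%g := @group_closed_inv _ P g cP.
Let AT g : P g -> A g *m (A g)^T = 1%:M. Proof. by have [] := actP; move=> + _ _; apply. Qed.
Let TA g : P g -> (A g)^T *m A g = 1%:M. Proof. by move=> /AT /mulmx1C. Qed.
Let AM g h : P g -> P h -> A (g * h)%g = A h *m A g.
Proof. by have [] := actP; move=> _ + _; apply. Qed.
Let bM g h : P g -> P h -> b (g * h)%g = b h *m A g + b g.
Proof. by have [] := actP; move=> _ _ +; apply. Qed.

Lemma linear_part1 : A 1%g = 1%:M.
Proof.
have := AM P1 P1; rewrite mulg1 => /(congr1 (mulmx (A 1%g)^T)).
by rewrite mulmxA TA// mul1mx.
Qed.

Lemma translation_part1 : b 1%g = 0.
Proof.
have := bM P1 P1; rewrite mulg1 linear_part1 mulmx1 => /eqP.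
by rewrite -subr_eq0 opprD addNKr oppr_eq0 => /eqP.
Qed.

Lemma linear_partV g : P g -> A g^-1%g = (A g)^T.
Proof.
move=> Pg; have := AM Pg (PV Pg); rewrite mulgV linear_part1.
by move=> /(congr1 (mulmxr (A g)^T))/=; rewrite mul1mx -mulmxA AT// mulmx1.
Qed.

Definition commutator (g h : G) : G := (g * h * (h * g)^-1)%g.

Lemma commutator_eq1 g h : (commutator g h = 1)%g -> (g * h = h * g)%g.
Proof.
by move=> gh; rewrite -[RHS]mul1g -gh /commutator -mulgA mulVg mulg1.
Qed.

Lemma commutator_closed g h : P g -> P h -> P (commutator g h).
Proof. by move=> Pg Ph; apply/PM/PV; exact: PM. Qed.

Lemma commutatorK g h : (commutator g h * (h * g) = g * h)%g.
Proof. by rewrite /commutator -mulgA mulVg mulg1. Qed.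

Lemma commutator_linear g h : P g -> P h ->
  A g *m A h *m A (commutator g h) = A h *m A g.
Proof.
move=> Pg Ph; rewrite -[RHS]AM// -commutatorK.
rewrite (AM (commutator_closed Pg Ph) (PM Ph Pg)).
by rewrite (AM Ph Pg).
Qed.

Lemma commutator_translation g h : P g -> P h -> b (commutator g h) =
  b h *m (A g - 1%:M) - b g *m (A h - 1%:M)
  - (b g *m A h + b h) *m (A (commutator g h) - 1%:M).
Proof.
move=> Pg Ph; have := bM (commutator_closed Pg Ph) (PM Ph Pg).
rewrite commutatorK (bM Pg Ph) (bM Ph Pg).
move: (b (commutator g h)) (A (commutator g h)) => x B E.
transitivity (b h *m A g + b g - (b g *m A h + b h) *m B).
  by rewrite E addrAC subrr add0r.
rewrite !mulmxBr !mulmx1; move: (_ *m B) => y.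
by apply/rowP => i; rewrite !mxE; ring.
Qed.

(** Up to orthogonal factors, which preserve [fnorm], the left side is the norm of the additive
    commutator of [A h] and [A g]. Subtracting the identity from both matrices does not change that
    commutator, so it is quadratically small. *)
Lemma commutator_linear_near g h : P g -> P h ->
  fnorm (A (commutator g h) - 1%:M) <=
    2 * fnorm (A g - 1%:M) * fnorm (A h - 1%:M).
Proof.
move=> Pg Ph.
have -> : fnorm (A (commutator g h) - 1%:M) =
    fnorm ((A h - 1%:M) *m (A g - 1%:M) - (A g - 1%:M) *m (A h - 1%:M)).
  rewrite -(fnorm_orthogonall _ (AT Ph)) -(fnorm_orthogonall _ (AT Pg)).
  rewrite mulmxA !(mulmxBr, mulmxBl) commutator_linear// !(mulmx1, mul1mx).
  congr fnorm.
  by apply/matrixP => i j; rewrite !mxE; ring.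
apply: le_trans (fnormD _ _) _; rewrite fnormN.
have := fnorm_mul (A h - 1%:M) (A g - 1%:M).
have := fnorm_mul (A g - 1%:M) (A h - 1%:M).
by lra.
Qed.

Lemma commutator_translation_near g h : P g -> P h -> enorm (b (commutator g h)) <=
  enorm (b h) * fnorm (A g - 1%:M) + enorm (b g) * fnorm (A h - 1%:M) +
  (enorm (b g) + enorm (b h)) *
    (2 * fnorm (A g - 1%:M) * fnorm (A h - 1%:M)).
Proof.
move=> Pg Ph; rewrite commutator_translation//.
apply: le_trans (enormD _ _) _; apply: lerD.
  apply: le_trans (enormD _ _) _; rewrite enormN.
  by apply: lerD; exact: enorm_mulmx.
rewrite enormN; apply: le_trans (enorm_mulmx _ _) _.
apply: ler_pM; rewrite ?enorm_ge0//; last exact: commutator_linear_near.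
apply: le_trans (enormD _ _) _.
by rewrite enorm_orthogonal// AT.
Qed.

(** The radius 1/8 makes the set stable under commutators and leaves room for the halving in
    [iter_commutator_eq1]. *)
Definition near1 : set G := [set g | P g /\ fnorm (A g - 1%:M) <= 8^-1].

Lemma commutator_near1 g h : near1 g -> near1 h -> near1 (commutator g h).
Proof.
move=> [Pg g1] [Ph h1]; split; first exact: commutator_closed.
apply: le_trans (commutator_linear_near Pg Ph) _.
have := fnorm_ge0 (A g - 1%:M); have := fnorm_ge0 (A h - 1%:M); nra.
Qed.

(* The quantity [s] is halved by each commutator with [g], while properness bounds
   it away from 0 on the nontrivial elements. *)
Lemma iter_commutator_eq1 g h : near1 g -> near1 h ->
  exists k, iter k (commutator g) h = 1%g.
Proof.
(* The weight has to absorb the term [enorm (b g) * fnorm (A f - 1%:M)] in the translation part of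
   the next commutator; the summand 1 keeps it positive when [b g] vanishes. *)
move=> ng nh; pose M := 8 * enorm (b g) + 1.
have M0 : 0 < M by have := enorm_ge0 (b g); rewrite /M; lra.
pose s f := enorm (b f) + M * fnorm (A f - 1%:M).
have s_ge f : enorm (b f) <= s f by rewrite lerDl mulr_ge0 ?fnorm_ge0// ltW.
have halve f : near1 f -> s (commutator g f) <= s f / 2.
  move=> nf; rewrite /s.
  have := commutator_translation_near ng.1 nf.1.
  have := commutator_linear_near ng.1 nf.1.
  have := enorm_ge0 (b g); have := enorm_ge0 (b f).
  have := fnorm_ge0 (A g - 1%:M); have := fnorm_ge0 (A f - 1%:M).
  move: ng.2 nf.2; rewrite /M.
  set x := fnorm (A g - _); set y := fnorm (A f - _).
  set z := fnorm (A (commutator _ _) - _).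
  set p := enorm (b g); set q := enorm (b f); set t := enorm _.
  move=> x8 y8 y0 x0 q0 p0 zxy txy.
  have z4 : z <= y / 4 by nra.
  have pz : p * z <= p * y / 4 by nra.
  have qx : q * x <= q / 8 by nra.
  have t1 : (p + q) * (2 * x * y) <= p * y / 4 + q / 32.
    have -> : (p + q) * (2 * x * y) = p * (2 * x * y) + q * (2 * x * y) by ring.
    have xy : 2 * x * y <= y / 4 by nra.
    have xy' : 2 * x * y <= 32^-1 by nra.
    by apply: lerD; nra.
  by nra.
pose u k := iter k (commutator g) h.
have nu k : near1 (u k) by elim: k => //= k ih; exact: commutator_near1.
have su k : s (u k) <= s h / 2 ^+ k.
  elim: k => [|k ih]; first by rewrite expr0 divr1.
  rewrite exprS invfM mulrCA mulrC; apply: le_trans (halve _ (nu k)) _.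
  by rewrite ler_pM2r.
have s0 f : 0 <= s f by apply: le_trans (s_ge f); exact: enorm_ge0.
pose X := [set f | (P f /\ enorm (b f) <= s h) /\ f <> 1%g].
have [||e e0 eX] := @finite_set_pos_lb R G X s.
- by apply: sub_finite_set (properP (s h)) => f [].
- move=> f [[Pf _] f1]; rewrite lt_neqAle s0 andbT; apply/eqP => /esym sf.
  apply: f1; apply: faithfulP => //.
    apply/eqP; rewrite -subr_eq0; apply/eqP/fnorm_eq0.
    have := enorm_ge0 (b f); have := fnorm_ge0 (A f - 1%:M).
    by move: sf; rewrite /s; nra.
  apply: enorm_eq0.
  have := enorm_ge0 (b f); have := s_ge f; rewrite sf; lra.
have [k ke] := geometric_small (s h) e0.
exists k; apply: contrapT => uk1.
have : X (u k).
  split => //; split; first exact: (nu k).1.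
  apply: le_trans (s_ge _) _; apply: le_trans (su k) _.
  by rewrite ler_pdivrMr ?exprn_gt0// ler_peMr// exprn_ege1// ler1n.
by move=> /eX; rewrite leNgt (le_lt_trans (su k) ke).
Qed.

(** As [d] commutes with [a], so does the conjugate [c * a * c^-1], which equals [d^-1 * a]; then
    [commute_conjugate_near1] makes the linear parts of [a] and [c] commute, and [d] is a
    translation. Its vector is fixed by both linear parts, but it also lies in the sum of the images
    of [A a - 1%:M] and [A c - 1%:M], which is orthogonal to all such vectors. So it vanishes. *)
Lemma commutator_descent a c : near1 a -> near1 c ->
  commutator a (commutator a c) = 1%g -> commutator a c = 1%g.
Proof.
move=> na nc; set d := commutator a c => /commutator_eq1 ad.
have [Pa a8] := na; have [Pc c8] := nc.
have Pd : P d by exact: commutator_closed.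
have Pa' : P (c * a * c^-1)%g by apply/PM/PV => //; exact: PM.
have da' : (d * (c * a * c^-1) = a)%g.
  by rewrite mulgA commutatorK -mulgA mulgV mulg1.
have aa' : (a * (c * a * c^-1) = c * a * c^-1 * a)%g.
  by apply: (mulgI d); rewrite [RHS]mulgA da' mulgA -ad -mulgA da'.
have AC : A a *m A c = A c *m A a.
  apply: (@commute_conjugate_near1 _ _ _ (A (c * a * c^-1)%g)); try exact: AT.
  - by apply: le_lt_trans c8 _; rewrite invf_lt1// ltr1n.
  - by rewrite -!AM//; congr A; rewrite -mulgA mulVg mulg1.
  - by rewrite -!AM// aa'.
have Ad : A d = 1%:M.
  have := commutator_linear Pa Pc; rewrite AC -/d => /(congr1 (mulmx (A c *m A a)^T)).
  rewrite mulmxA trmx_mul -[(A a)^T *m _ *m _]mulmxA (mulmxA (A c)^T).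
  by rewrite TA// mul1mx TA// mul1mx.
have trans_comm f : P f -> A f = 1%:M -> A (commutator c f) = 1%:M /\
    b (commutator c f) = b f *m A c - b f.
  move=> Pf Af; have Ac1 : A (commutator c f) = 1%:M.
    have := commutator_linear Pc Pf; rewrite Af mulmx1 mul1mx.
    by move=> /(congr1 (mulmx (A c)^T)); rewrite mulmxA TA// mul1mx.
  split=> //; rewrite commutator_translation// Ac1 Af subrr !mulmx0 !subr0.
  by rewrite mulmxBr mulmx1.
have vA : b d *m A a = b d.
  have := congr1 b ad; rewrite (bM Pa Pd) (bM Pd Pa) Ad mulmx1 addrC.
  by move/addrI.
(* Commutators of [c] with translations are translations, whose vectors are transformed by
   [A c - 1%:M]. The iterates reach 1, so a power of [A c - 1%:M] kills [b d]. *)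
have vC : b d *m A c = b d.
  have nd : near1 d by rewrite /near1/= Ad subrr /fnorm linear0 enorm0.
  have [k dk] := iter_commutator_eq1 nc nd.
  apply: (@orthogonal_sub1_nilpotent _ _ _ _ k.+1 (AT Pc)) => //.
  have it j : [/\ P (iter j (commutator c) d), A (iter j (commutator c) d) = 1%:M &
      b (iter j (commutator c) d) = iter j (fun w => w *m A c - w) (b d)].
    elim: j => [|j [Pj Aj bj]]; first by [].
    have [Aj1 bj1] := trans_comm _ Pj Aj.
    by split; [exact: commutator_closed|exact: Aj1|rewrite /= bj1 bj].
  by have [_ _ /=] := it k; rewrite dk translation_part1 => <-; rewrite mul0mx subr0.
have fix_orth (B : 'M[R]_n) u : B *m B^T = 1%:M -> b d *m B = b d ->
    dot (b d) (u *m (B - 1%:M)) = 0.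
  move=> B1 dB; rewrite mulmxBr mulmx1 dotDr dotNr -{1}dB dot_orthogonal//.
  by rewrite subrr.
apply: faithfulP => //; apply: dot_eq0.
rewrite {2}commutator_translation// -/d Ad subrr mulmx0 subr0 dotDr dotNr.
by rewrite !fix_orth ?AT// subr0.
Qed.

(** The iterated commutators of [a] with [c] reach 1, and [commutator_descent] shortens the sequence
    from its end until [commutator a c] itself is 1. *)
Lemma near1_commute a c : near1 a -> near1 c -> (a * c = c * a)%g.
Proof.
move=> na nc; have [k] := iter_commutator_eq1 na nc.
have nu j : near1 (iter j (commutator a) c).
  by elim: j => //= j ih; exact: commutator_near1.
elim: k => [/= ->|[|k] ih]; first by rewrite mulg1 mul1g.
  by move=> /= /commutator_eq1.
by move=> /= uk; apply: ih; exact: commutator_descent (nu k) uk.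
Qed.

End euclidean_action.

(** * A common axis of commuting isometries *)

Section common_axis.
Context {R : realType} {G : groupType} {n : nat}.
Variables (L : set G) (A : G -> 'M[R]_n) (b : G -> 'rV[R]_n).
Hypothesis cL : group_closed (mem L).
Hypothesis actL : euclidean_action L A b.
Hypothesis cmL : commuting L.

(** A Gram matrix: [dot (u *m T s) u] is the sum of the squared norms of the [u *m (A h - 1%:M)], so
    its kernel consists of the vectors fixed by all [A h] with [h] in [s]. *)
Let T (s : seq G) : 'M[R]_n := \sum_(h <- s) (A h - 1%:M) *m (A h - 1%:M)^T.

Let ker_T s p (K : 'M[R]_(p, n)) :
  K *m T s = 0 -> forall h, h \in s -> K *m (A h - 1%:M) = 0.
Proof.
move=> KT h hs; apply/row_matrixP => i; rewrite row_mul row0.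
have {}KT : row i K *m T s = 0 by rewrite -row_mul KT row0.
move: (row i K) KT => u uT.
have : \sum_(h <- s) dot (u *m (A h - 1%:M)) (u *m (A h - 1%:M)) = 0.
  transitivity (dot (u *m T s) u); last by rewrite uT dot0l.
  rewrite /T mulmx_sumr.
  elim: s {hs uT} => [|k s ih]; first by rewrite !big_nil dot0l.
  by rewrite !big_cons ih dotDl mulmxA [dot (_ *m _^T) _]dot_mulmx trmxK.
move/eqP; rewrite psumr_eq0; last by move=> k _; exact: dot_ge0.
by move=> /allP /(_ _ hs) /eqP /dot_eq0.
Qed.

Let T_sym s : (T s)^T = T s.
Proof.
rewrite /T; elim: s => [|h s ih]; first by rewrite !big_nil trmx0.
by rewrite !big_cons linearD/= ih trmx_mul trmxK.
Qed.

(** A list with [T s] of maximal rank works: adding [g] to it could only shrink the kernel, and that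
    would raise the rank. *)
Let L_sub_fixed : exists2 s : seq G, (forall h, h \in s -> L h) &
  forall u : 'rV[R]_n, u *m T s = 0 -> forall g, L g -> u *m (A g - 1%:M) = 0.
Proof.
pose Q q := `[< exists2 s : seq G, (forall h, h \in s -> L h) & \rank (T s) = q >].
have exQ : exists q, Q q by exists (\rank (T [::])); apply/asboolP; exists [::].
have Qn q : Q q -> (q <= n)%N by move=> /asboolP[s _ <-]; exact: rank_leq_row.
case: (ex_maxnP exQ Qn) => q /asboolP[s Ls <-] smax.
exists s => // u uT g Lg.
have sub : (kermx (T (g :: s)) <= kermx (T s))%MS.
  apply/sub_kermxP; rewrite /T mulmx_sumr big_seq big1// => h hs.
  rewrite mulmxA (@ker_T (g :: s)) ?mul0mx ?mulmx_ker//.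
  by rewrite in_cons hs orbT.
have : (kermx (T s) <= kermx (T (g :: s)))%MS.
  rewrite -(geq_leqif (mxrank_leqif_sup sub)) !mxrank_ker leq_sub2l//.
  apply: smax; apply/asboolP; exists (g :: s) => // h.
  by rewrite in_cons => /orP[/eqP ->//|/Ls].
move=> /(submx_trans (introT sub_kermxP uT))/sub_kermxP ugT.
by apply: (ker_T ugT); rewrite mem_head.
Qed.

(* The point [y] minimizes the sum of squared displacements of finitely many
   elements whose linear parts have the smallest common fixed space. *)
Lemma common_axis : exists y, forall g h, L g -> L h ->
  (y *m A g + b g - y) *m A h = y *m A g + b g - y.
Proof.
have [A1 AM bM] := actL.
have LV g : L g -> L g^-1%g by exact: group_closed_inv.
have AC g h : L g -> L h -> A g *m A h = A h *m A g.
  by move=> Lg Lh; rewrite -!AM// cmL.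
have ATC g h : L g -> L h -> A g *m (A h)^T = (A h)^T *m A g.
  by move=> Lg Lh; rewrite -(linear_partV cL actL Lh); exact/AC/LV.
have bC g h : L g -> L h -> b h *m (A g - 1%:M) = b g *m (A h - 1%:M).
  move=> Lg Lh; have := congr1 b (cmL Lg Lh); rewrite !bM// => E.
  rewrite !mulmxBr !mulmx1; apply/eqP; rewrite subr_eq addrAC eq_sym subr_eq.
  by rewrite E.
have [s Ls sfix] := L_sub_fixed.
(* The equation [c = y *m T s] is the normal equation of the least squares problem. It is solvable
   because the image of the symmetric matrix [T s] is the orthogonal complement of its kernel, and
   [c] is orthogonal to that kernel. *)
pose c := - \sum_(h <- s) b h *m (A h - 1%:M)^T.
have /submxP[y cE] : (c <= T s)%MS.
  rewrite submxE; apply/eqP.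
  have KT : (cokermx (T s))^T *m T s = 0.
    by rewrite -[X in _ *m X]T_sym -trmx_mul mulmx_coker trmx0.
  rewrite /c mulNmx mulmx_suml big_seq big1 ?oppr0// => h hs.
  by rewrite -mulmxA -[cokermx _]trmxK -trmx_mul (ker_T KT)// trmx0 mulmx0.
exists y => g h Lg Lh; set v := _ - y.
(* By the choice of [s], a vector in the kernel of [T s] is fixed by all of [L]. To get there, [A g]
   is moved across [T s] and [bC] exchanges [g] with the members of [s], which leaves the normal
   equation. *)
suff vT : v *m T s = 0.
  by have /eqP := sfix _ vT _ Lh; rewrite mulmxBr mulmx1 subr_eq0 => /eqP.
have TA : A g *m T s = T s *m A g.
  rewrite /T mulmx_sumr mulmx_suml big_seq [RHS]big_seq; apply: eq_bigr => k ks.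
  have Lk := Ls _ ks.
  rewrite linearB/= trmx1 !(mulmxBr, mulmxBl) !(mulmx1, mul1mx).
  by rewrite mulmxA AC// -!mulmxA ATC// !mulmxA.
have -> : v = y *m (A g - 1%:M) + b g.
  by rewrite /v mulmxBr mulmx1 addrAC.
rewrite mulmxDl -mulmxA mulmxBl mul1mx TA -[X in _ - X]mulmx1 -mulmxBr mulmxA -cE.
rewrite /c mulNmx mulmx_suml /T mulmx_sumr addrC; apply/eqP; rewrite subr_eq0.
apply/eqP; rewrite big_seq [RHS]big_seq; apply: eq_bigr => k ks.
have Lk := Ls _ ks.
rewrite mulmxA -bC// -!mulmxA; congr (_ *m _).
rewrite !linearB/= trmx1 !(mulmxBr, mulmxBl) !(mulmx1, mul1mx).
by rewrite ATC//; apply/matrixP => i j; rewrite !mxE; ring.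
Qed.

End common_axis.

(** * The growth exponent of a discrete group of Euclidean isometries *)

Section bieberbach_growth.
Context {R : realType} {G : groupType} {n : nat}.
Variables (P : set G) (A : G -> 'M[R]_n) (b : G -> 'rV[R]_n).
Hypothesis cP : group_closed (mem P).
Hypothesis actP : euclidean_action P A b.
Hypothesis properP : forall r, finite_set [set g | P g /\ enorm (b g) <= r].
Hypothesis faithfulP : forall g, P g -> A g = 1%:M -> b g = 0 -> g = 1%g.
Hypothesis tfP : torsion_free P.

Let P1 : P 1%g := group_closed_one cP.
Let PM g h : P g -> P h -> P (g * h)%g := @group_closed_mul _ P g h cP.
Let PV g : P g -> P g^-1%g := @group_closed_inv _ P g cP.

Definition affine_act (z : 'rV[R]_n) (g : G) : 'rV[R]_n := z *m A g + b g.

Lemma affine_act1 z : affine_act z 1%g = z.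
Proof.
by rewrite /affine_act (linear_part1 cP actP) (translation_part1 cP actP) mulmx1 addr0.
Qed.

Lemma affine_actM z g h : P g -> P h ->
  affine_act z (g * h)%g = affine_act (affine_act z h) g.
Proof.
move=> Pg Ph; have [_ AM bM] := actP.
by rewrite /affine_act AM// bM// mulmxDl addrA mulmxA.
Qed.

Lemma affine_act_isometry u v g : P g ->
  enorm (affine_act u g - affine_act v g) = enorm (u - v).
Proof.
move=> Pg; have [A1 _ _] := actP.
by rewrite /affine_act opprD addrACA subrr addr0 -mulmxBl enorm_orthogonal// A1.
Qed.

Lemma affine_act_translate z k g h : P k -> P g -> P h ->
  enorm (affine_act z (k * g)%g - affine_act z (k * h)%g) =
  enorm (affine_act z g - affine_act z h).
Proof. by move=> Pk Pg Ph; rewrite !affine_actM// affine_act_isometry. Qed.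

Lemma displacement_change y z g : P g ->
  displacement (affine_act z) g <=
    displacement (affine_act y) g + 2 * enorm (z - y).
Proof.
move=> Pg; rewrite /displacement !affine_act1.
have := enorm_triangle (affine_act y g) (affine_act z g) z.
have := enorm_triangle y (affine_act y g) z.
by rewrite affine_act_isometry// [X in _ <= _ + X -> _]enormB; lra.
Qed.

Lemma orbit_ball_finite z r : finite_set (orbit_ball P (affine_act z) r).
Proof.
apply: sub_finite_set (properP (r + 2 * enorm z)) => g [Pg gr]; split => //.
have := displacement_change 0 z Pg; have := @displacement_change z 0 g Pg.
rewrite {1}/displacement affine_act1 /affine_act mul0mx add0r !subr0 sub0r enormN.
by lra.
Qed.

Let near := near1 P A.
(* The double centralizer of the elements with almost trivial linear part is
   abelian and contains them; it has finite index because the linear parts of [P]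
   form a totally bounded set. *)
Let cent (U : set G) := [set g | P g /\ forall h, U h -> (g * h = h * g)%g].
Let L := cent (cent near).

Let cent_closed U : group_closed (mem (cent U)).
Proof.
apply: group_closedI => [|g h [Pg gU] [Ph hU]|g [Pg gU]].
- by split => // h _; rewrite mul1g mulg1.
- by split; [exact: PM|move=> k Uk; rewrite -mulgA hU// !mulgA gU].
- split; first exact: PV.
  move=> h Uh; apply: (mulgI g); rewrite !mulgA mulgV mul1g gU// -mulgA.
  by rewrite mulgV mulg1.
Qed.

Let near_cent g : near g -> cent near g.
Proof.
move=> ng; split; first exact: ng.1.
by move=> h nh; exact: (near1_commute cP actP properP faithfulP ng nh).
Qed.

Let near_L g : near g -> L g.
Proof. by move=> ng; split; [exact: ng.1|move=> h [_ ->]]. Qed.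

Let L_P : L `<=` P. Proof. by move=> g []. Qed.

Let L_commuting : commuting L.
Proof.
move=> g h [Pg gZ] [Ph hZ]; apply: gZ; split => // k nk.
exact/hZ/near_cent.
Qed.

Let L_act : euclidean_action L A b.
Proof.
have [A1 AM bM] := actP.
by split => [g /L_P|g h /L_P ? /L_P|g h /L_P ? /L_P]; [exact: A1|exact: AM|exact: bM].
Qed.

(** Finite index in the form the counts use: two elements whose linear parts have the same colour
    differ by an element of [near]. Orthogonal matrices have Frobenius norm [Num.sqrt n%:R], and the
    precision of the colouring is the radius in [near1]. *)
Let L_index z : exists (m : nat) (c : R), [/\ (0 < m)%N, 0 <= c & forall r,
  (orbit_count P (affine_act z) r <= m * orbit_count L (affine_act z) (r + c)%R)%N].
Proof.
have [A1 AM bM] := actP.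
have e0 : 0 < 8^-1 :> R by rewrite invr_gt0.
have [T [col colP]] := @grid_coloring R (n * n) (Num.sqrt n%:R) 8^-1 e0.
pose cg g := col (mxvec (A g)).
have /choice[rep repP] t : exists g, P g /\ ((exists2 h, P h & cg h = t) -> cg g = t).
  have [[h Ph ht]|no] := pselect (exists2 h, P h & cg h = t); first by exists h.
  by exists 1%g; split.
pose disp g := displacement (affine_act z) g.
exists #|T|, (\sum_t disp (rep t)); split.
- by apply/card_gt0P; exists (cg 1%g).
- by apply: sumr_ge0 => t _; exact: enorm_ge0.
move=> r; apply: (ncard_fibers (c := cg)); first exact: orbit_ball_finite.
move=> t; apply: (ncard_inj (f := fun g => ((rep t)^-1 * g)%g)).
- by apply: sub_finite_set (orbit_ball_finite z r) => g [].
- apply: sub_finite_set (orbit_ball_finite z (r + \sum_t disp (rep t))).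
  by move=> g [/L_P].
- move=> g [[Pg gr] gt]; have [Pt tg] := repP t.
  have {}tg : cg (rep t) = t by apply: tg; exists g.
  split.
    apply: near_L; split; first by apply: PM => //; exact: PV.
    rewrite AM//; last exact: PV.
    rewrite (linear_partV cP actP)// -(fnorm_orthogonalr _ (A1 _ Pt)).
    rewrite mulmxBl -mulmxA (mulmx1C (A1 _ Pt)) mulmx1 mul1mx /fnorm linearB/=.
    have gtE : cg g = cg (rep t) by rewrite gt tg.
    apply: colP gtE; rewrite -/(fnorm _) fnorm_orthogonal//; exact: A1.
  have := displacementM cP (@affine_act_translate z) (PV Pt) Pg.
  rewrite (displacementV cP (@affine_act_translate z))// => /le_trans; apply.
  rewrite addrC lerD// (bigD1 t)//= lerDl sumr_ge0// => u _; exact: enorm_ge0.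
- by move=> g h _ _ /mulgI.
Qed.

(** The exponent is read off at a point [y] of the common axis. A change of base point only shifts
    radii, so one [k] serves all [z]; it is applied both at the base point of the Poincare series
    and at [xi]. *)
Theorem orbit_power_growth : exists2 k : R, 0 <= k &
  forall z, power_growth (orbit_count P (affine_act z)) k.
Proof.
have [y yL] := common_axis (cent_closed _) L_act L_commuting.
have finL z r : finite_set (orbit_ball L (affine_act z) r).
  by apply: sub_finite_set (orbit_ball_finite z r) => g [/L_P].
have [|||||k k0 kL] := @lattice_power_growth R G n L (affine_act y) (cent_closed _).
- by move=> k g h /L_P ? /L_P ? /L_P ?; exact: affine_act_translate.
- exact: finL.
- exact: L_commuting.
- by move=> g j /L_P; exact: tfP.
(* The displacement vector of [y] under [g] is fixed by [A g], so applying [g] twice adds it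
   twice. *)
- move=> g Lg; have Pg := L_P Lg; rewrite /displacement affine_act1 affine_actM//.
  have := yL _ _ Lg Lg; rewrite -(@ger0_norm _ 2)// -enormZ /affine_act.
  move Eu : (y *m A g + b g) => u fixu; congr enorm.
  have -> : u *m A g = y *m A g + (u - y) by rewrite -fixu mulmxBl addrC subrK.
  by rewrite [_ *m _ + _ + _]addrAC Eu addrAC scaler_nat mulr2n.
exists k; [exact: k0|move=> z].
have [m [c [m0 c0 mc]]] := L_index y.
have d0 := enorm_ge0 (z - y).
have fP := orbit_ball_finite.
apply: (@power_growth_comparable _ (orbit_count L (affine_act y)) _ k m
  (c + 2 * enorm (z - y))); last exact: kL.
- exact: k0.
- exact: m0.
- by rewrite addr_ge0// mulr_ge0.
- by apply: orbit_count_homo => r; exact: fP.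
- by apply: orbit_count_gt0 => // r; exact: fP.
- move=> r r0; rewrite addrCA addrC -addrA [X in (_ + X)%R]addrC.
  rewrite addrA.
  apply: (@leq_trans (orbit_count P (affine_act y) (r + 2 * enorm (z - y)))).
    apply: ncard_sub; first exact: fP.
    move=> g [Pg gr]; split => //.
    by apply: le_trans (displacement_change z y Pg) _; rewrite lerD// enormB.
  apply: leq_trans (mc _) _; rewrite leq_mul2l; apply/orP; right.
  by apply: orbit_count_homo; [exact: finL|lra].
- move=> r r0.
  apply: (@leq_trans (orbit_count P (affine_act z) (r + (c + 2 * enorm (z - y))))).
    apply: ncard_sub; first exact: fP.
    move=> g [/L_P Pg gr]; split => //.
    by apply: le_trans (displacement_change y z Pg) _; lra.
  by rewrite leq_pmull.
Qed.

End bieberbach_growth.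

(** * Horospherical coordinates *)

Section similarities.
Context {R : realType} {n : nat}.
Implicit Types (u v : 'rV[R]_n).

Lemma dot_delta u i : dot u (delta_mx 0 i) = u 0 i.
Proof.
rewrite /dot (bigD1 i)//= mxE !eqxx mulr1 big1 ?addr0// => j ji.
by rewrite mxE eqxx/= (negbTE ji) mulr0.
Qed.

(** After normalization [h] fixes 0 and preserves dot products by polarization. With [A] built from
    the images of the basis vectors, the squared distance of [h u] and [u *m A] expands to 0. *)
Lemma similarity_affine (f : 'rV[R]_n -> 'rV[R]_n) (lam : R) : 0 < lam ->
  (forall u v, dot (f u - f v) (f u - f v) = lam ^+ 2 * dot (u - v) (u - v)) ->
  exists2 A : 'M[R]_n, A *m A^T = 1%:M & forall u, f u = lam *: (u *m A) + f 0.
Proof.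
move=> lam0 fE; pose h u := lam^-1 *: (f u - f 0).
have hB u v : dot (h u - h v) (h u - h v) = dot (u - v) (u - v).
  rewrite /h -scalerBr opprB addrA subrK dotZl dotZr fE.
  by field; rewrite gt_eqF.
have h0 : h 0 = 0 by rewrite /h subrr scaler0.
have fh u : f u = lam *: h u + f 0.
  by rewrite /h scalerA mulfV ?gt_eqF// scale1r subrK.
clearbody h.
have h1 u : dot (h u) (h u) = dot u u by have := hB u 0; rewrite h0 !subr0.
have h2 u v : dot (h u) (h v) = dot u v.
  have := hB u v; rewrite !dotE !h1 (dotC (h v)) (dotC v u); lra.
pose A : 'M[R]_n := \matrix_(i, j) h (delta_mx 0 i) 0 j.
have rowA i : row i A = h (delta_mx 0 i).
  by apply/rowP => j; rewrite !mxE.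
have A1 : A *m A^T = 1%:M.
  apply/matrixP => i j; rewrite !mxE.
  transitivity (dot (h (delta_mx 0 i)) (h (delta_mx 0 j))).
    by apply: eq_bigr => k _; rewrite !mxE.
  by rewrite h2 dot_delta mxE eqxx/= eq_sym.
exists A => // u.
rewrite fh; congr (_ *: _ + _).
apply/eqP; rewrite -subr_eq0; apply/eqP/dot_eq0.
have uA : dot (h u) (u *m A) = dot u u.
  rewrite dotC dot_mulmx; apply: eq_bigr => i _; congr (_ * _).
  rewrite mxE -(dot_delta u) -h2 -rowA; apply: eq_bigr => j _.
  by rewrite !mxE.
by rewrite !dotE dot_orthogonal// h1 (dotC (u *m A)) uA; ring.
Qed.

End similarities.

(* Inversion in the sphere of radius 1 centred at the boundary point [w] maps
   the ball onto the half-space [<v, w> < - 1/2]; [horo] and [height] are its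
   horizontal and vertical coordinates. *)
Section horospherical_coordinates.
Context {R : realType} {n : nat}.
Variable w : boundary R n.
Local Notation H := (hyperbolic_space R n).
Implicit Types (u v z : 'rV[R]_n) (x y : H) (t : R) (g h : Iso H).

Local Notation W := (bval w).

Definition sqd v : R := dot (v - W) (v - W).
Definition height v : R := (1 - dot v v) / (2 * sqd v).
Definition horo v : 'rV[R]_n := (sqd v)^-1 *: (v - W) + (height v + 2^-1) *: W.

Lemma sqdE v : sqd v = dot v v - 2 * dot v W + 1.
Proof. by rewrite /sqd !dotE bval1 (dotC W v); ring. Qed.

Lemma horo_orthogonal v : sqd v != 0 -> dot (horo v) W = 0.
Proof.
move=> q0; rewrite /horo /height !dotE bval1.
have -> : dot v v = sqd v + 2 * dot v W - 1 by rewrite sqdE; ring.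
by field.
Qed.

Lemma pythagoras z t : dot z W = 0 ->
  dot (z - t *: W) (z - t *: W) = dot z z + t ^+ 2.
Proof. by move=> zW; rewrite !dotE (dotC W z) zW bval1; ring. Qed.

(** The distance formula of an inversion, split into horizontal and vertical parts. Inside the ball
    it yields the hyperbolic distance; on the sphere, where heights vanish, it yields the chordal
    distance of orbit points. *)
Lemma horo_height_dist u v : sqd u != 0 -> sqd v != 0 ->
  dot (horo u - horo v) (horo u - horo v) + (height u - height v) ^+ 2 =
  dot (u - v) (u - v) / (sqd u * sqd v).
Proof.
move=> qu qv.
pose i a := (sqd a)^-1 *: (a - W).
have hi a : i a = horo a - (height a + 2^-1) *: W by rewrite /horo addrK.
transitivity (dot (i u - i v) (i u - i v)).
  rewrite !hi.
  have -> : horo u - (height u + 2^-1) *: W - (horo v - (height v + 2^-1) *: W) =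
      (horo u - horo v) - (height u - height v) *: W.
    by apply/rowP => j; rewrite !mxE; ring.
  by rewrite pythagoras// dotDl dotNl !horo_orthogonal// subrr.
clear hi; have iE : dot (i u - i v) (i u - i v) =
    (sqd u)^-1 + (sqd v)^-1 - 2 * dot (u - W) (v - W) / (sqd u * sqd v).
  move: qu qv; rewrite /i /sqd; move: (u - W) (v - W) => a c qa qc.
  by rewrite !dotE (dotC c a); field; rewrite qa qc.
rewrite iE.
have -> : dot (u - v) (u - v) = sqd u + sqd v - 2 * dot (u - W) (v - W).
  by rewrite /sqd !dotE (dotC W u) (dotC W v) (dotC v u); ring.
by field; rewrite qu qv.
Qed.

(** The inversion turns the distance from its centre [w] into its reciprocal. *)
Lemma sqd_horo v : sqd v != 0 ->
  sqd v * (dot (horo v) (horo v) + (height v + 2^-1) ^+ 2) = 1.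
Proof.
move=> qv; have o := horo_orthogonal qv.
have : dot (horo v - (height v + 2^-1) *: W) (horo v - (height v + 2^-1) *: W) =
    (sqd v)^-1.
  by rewrite {1 2}/horo addrK dotZl dotZr -/(sqd v); field.
by rewrite pythagoras// => ->; rewrite mulfV.
Qed.

Lemma sqd_hval x : 0 < sqd (hval x).
Proof.
rewrite lt_neqAle dot_ge0 andbT eq_sym; apply/eqP => /dot_eq0/eqP.
rewrite subr_eq0 => /eqP xW; have := hvalP x.
by rewrite xW bval1 ltxx.
Qed.

Lemma sqd_bval (xi : boundary R n) : xi <> w -> sqd (bval xi) != 0.
Proof.
move=> xiw; apply/eqP => /dot_eq0/eqP; rewrite subr_eq0 => /eqP/val_inj.
exact: xiw.
Qed.

Lemma height_hval x : 0 < height (hval x).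
Proof. by rewrite divr_gt0 ?hval_lt1// mulr_gt0// sqd_hval. Qed.

Lemma height_bval (xi : boundary R n) : height (bval xi) = 0.
Proof. by rewrite /height bval1 subrr mul0r. Qed.

(** The distance formula of the upper half-space model. *)
Lemma hcosh_horo x y : hcosh x y = 1 +
  (dot (horo (hval x) - horo (hval y)) (horo (hval x) - horo (hval y)) +
   (height (hval x) - height (hval y)) ^+ 2) /
  (2 * height (hval x) * height (hval y)).
Proof.
have qx := sqd_hval x; have qy := sqd_hval y.
rewrite horo_height_dist ?gt_eqF// /height /hcosh.
have := hval_lt1 x; have := hval_lt1 y.
move: qx qy; set p := sqd _; set q := sqd _; set X := 1 - _; set Y := 1 - _.
by move=> *; congr (1 + _); field; rewrite !gt_eqF.
Qed.

Lemma coordinates_inj u v : sqd u != 0 -> sqd v != 0 ->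
  horo u = horo v -> height u = height v -> u = v.
Proof.
move=> qu qv huv tuv; apply/eqP; rewrite -subr_eq0; apply/eqP/dot_eq0.
have := horo_height_dist qu qv; rewrite huv tuv !subrr dot0l expr0n addr0 => /esym/eqP.
by rewrite mulf_eq0 invr_eq0 mulf_eq0 (negbTE qu) (negbTE qv) !orbF => /eqP.
Qed.

(** An inversion is its own inverse, so it is applied here to the point with horizontal part [z] and
    height [t]. The value [t = 0] gives boundary points. *)
Definition uncoord z t : 'rV[R]_n :=
  W + (dot z z + (t + 2^-1) ^+ 2)^-1 *: (z - (t + 2^-1) *: W).

Section uncoord.
Variables (z : 'rV[R]_n) (t : R).
Hypotheses (zW : dot z W = 0) (t0 : 0 <= t).

Let m := dot z z + (t + 2^-1) ^+ 2.
Let m0 : 0 < m.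
Proof. by rewrite ltr_wpDl ?dot_ge0// exprn_gt0// ltr_wpDl. Qed.

Let uE : dot (z - (t + 2^-1) *: W) (z - (t + 2^-1) *: W) = m.
Proof. exact: pythagoras. Qed.

Lemma sqd_uncoord : sqd (uncoord z t) = m^-1.
Proof.
rewrite /sqd /uncoord (addrC W) addrK dotZl dotZr uE -/m.
by field; rewrite gt_eqF.
Qed.

Lemma dot_uncoord : dot (uncoord z t) (uncoord z t) = 1 - 2 * t / m.
Proof.
rewrite /uncoord dotDl !dotDr !dotZl !dotZr uE bval1 (dotC W) !dotE zW bval1 -/m.
by field; rewrite gt_eqF.
Qed.

Lemma height_uncoord : height (uncoord z t) = t.
Proof.
by rewrite /height sqd_uncoord dot_uncoord; field; rewrite gt_eqF.
Qed.

Lemma horo_uncoord : horo (uncoord z t) = z.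
Proof.
rewrite /horo sqd_uncoord height_uncoord {1}/uncoord (addrC W) addrK invrK.
by rewrite scalerA -/m mulfV ?gt_eqF// scale1r subrK.
Qed.

Lemma uncoord_lt1 : 0 < t -> dot (uncoord z t) (uncoord z t) < 1.
Proof. by move=> t1; rewrite dot_uncoord ltrBlDr ltrDl divr_gt0// mulr_gt0. Qed.

Lemma uncoord_eq1 : t = 0 -> dot (uncoord z t) (uncoord z t) == 1.
Proof. by move=> tE; rewrite dot_uncoord {1}tE mulr0 mul0r subr0. Qed.

End uncoord.

Lemma cvg_coordinates (s : nat -> 'rV[R]_n) v : sqd v != 0 -> s k @[k --> \oo] --> v ->
  [/\ sqd (s k) @[k --> \oo] --> sqd v, height (s k) @[k --> \oo] --> height v &
      horo (s k) @[k --> \oo] --> horo v].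
Proof.
move=> qv sv.
have c1 : s k - W @[k --> \oo] --> v - W by apply: cvgB => //; exact: cvg_cst.
have c2 : sqd (s k) @[k --> \oo] --> sqd v by exact: cvg_dot.
have c3 : height (s k) @[k --> \oo] --> height v.
  apply: cvgM; first by apply: cvgB; [exact: cvg_cst|exact: cvg_dot].
  apply: cvgV; first by rewrite mulf_neq0.
  by apply: cvgM => //; exact: cvg_cst.
split => //; apply: cvgD.
  by apply: cvgZ => //; exact: cvgV.
by apply: cvgZ; [apply: cvgD => //; exact: cvg_cst|exact: cvg_cst].
Qed.

(** Only the hyperplane orthogonal to [W] matters; the convention [W *m A = W] extends the linear
    part to an orthogonal matrix of the ambient size and makes it unique. *)
Definition similarity g (lam : R) (A : 'M[R]_n) (b : 'rV[R]_n) : Prop :=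
  [/\ 0 < lam, A *m A^T = 1%:M, W *m A = W, dot b W = 0 & forall x,
      height (hval (g x)) = lam * height (hval x) /\
      horo (hval (g x)) = lam *: (horo (hval x) *m A) + b].

Definition horizontal z := z - dot z W *: W.

Lemma horizontal_orthogonal z : dot (horizontal z) W = 0.
Proof. by rewrite /horizontal dotDl dotNl dotZl bval1 mulr1 subrr. Qed.

Lemma horizontal_id z : dot z W = 0 -> horizontal z = z.
Proof. by move=> zW; rewrite /horizontal zW scale0r subr0. Qed.

Definition above z : H :=
  Hyperbolic (uncoord_lt1 (horizontal_orthogonal z) ler01 ltr01).

Lemma horo_above z : horo (hval (above z)) = horizontal z.
Proof. by rewrite horo_uncoord// horizontal_orthogonal. Qed.

Lemma height_above z : height (hval (above z)) = 1.
Proof. by rewrite height_uncoord// horizontal_orthogonal. Qed.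

Section fixing_w.
Variable g : Iso H.
Hypothesis gw : boundary_act g w = w.

(** As [s] tends to [w], the expression in [lim] tends to the reciprocal of the height of [x]: this
    is the Busemann function at [w] in exponential form. An isometry fixing [w] multiplies it by a
    factor that does not depend on [x]. *)
Lemma fixing_scales_height : exists2 lam, 0 < lam &
  forall x, height (hval (g x)) = lam * height (hval x).
Proof.
have lim (s : nat -> H) x : tends_to_boundary s w ->
    (hcosh x (s k) - 1) * (1 - dot (hval (s k)) (hval (s k))) @[k --> \oo] -->
    (height (hval x))^-1.
  move=> sw; have x1 := hval_lt1 x.
  have -> : (height (hval x))^-1 =
      2 * dot (hval x - W) (hval x - W) / (1 - dot (hval x) (hval x)).
    by rewrite /height invf_div.
  rewrite (_ : (fun k => _) = (fun k => 2 * dot (hval x - hval (s k))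
      (hval x - hval (s k)) / (1 - dot (hval x) (hval x)))); last first.
    apply/funext => k; rewrite /hcosh; have := hval_lt1 (s k); move: x1.
    set X := 1 - _; set Y := 1 - _ => X0 Y0.
    by rewrite addrAC subrr add0r; field; rewrite !gt_eqF.
  apply: cvgM; last exact: cvg_cst.
  apply: cvgM; first exact: cvg_cst.
  by apply: cvg_dot; apply: cvgB => //; exact: cvg_cst.
have rw := @ray_tends_to R n w.
have grw : tends_to_boundary (g \o ray w) w.
  by rewrite -[X in tends_to_boundary _ X]gw; exact: boundary_actP.
pose o : H := horigin.
exists (height (hval (g o)) / height (hval o)); first by rewrite divr_gt0 ?height_hval.
move=> x.
(* Comparing [x] with [o] crosswise cancels the unknown ratio of the factors at [ray w k] and at its
   image: both sides are limits of the same sequence. *)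
have E : (height (hval (g x)))^-1 * (height (hval o))^-1 =
         (height (hval (g o)))^-1 * (height (hval x))^-1.
  have l1 := cvgM (lim _ (g x) grw) (lim _ o rw).
  have l2 := cvgM (lim _ (g o) grw) (lim _ x rw).
  rewrite (_ : _ \* _ = (fun k => (hcosh x (ray w k) - 1) *
      (1 - dot (hval (g (ray w k))) (hval (g (ray w k)))) *
      ((hcosh o (ray w k) - 1) *
       (1 - dot (hval (ray w k)) (hval (ray w k)))))) in l1; last first.
    by apply/funext => k /=; rewrite hcosh_iso.
  rewrite (_ : _ \* _ = (fun k => (hcosh x (ray w k) - 1) *
      (1 - dot (hval (g (ray w k))) (hval (g (ray w k)))) *
      ((hcosh o (ray w k) - 1) *
       (1 - dot (hval (ray w k)) (hval (ray w k)))))) in l2; last first.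
    by apply/funext => k /=; rewrite hcosh_iso; ring.
  exact: (cvg_unique _ (l1 _) (l2 _)).
have {}E : height (hval (g x)) * height (hval o) =
    height (hval (g o)) * height (hval x) by apply: invr_inj; rewrite [LHS]invfM [RHS]invfM.
by rewrite mulrAC -E mulfK// gt_eqF// height_hval.
Qed.

Lemma horo_similar lam x y : (forall x, height (hval (g x)) = lam * height (hval x)) ->
  0 < lam ->
  dot (horo (hval (g x)) - horo (hval (g y))) (horo (hval (g x)) - horo (hval (g y))) =
  lam ^+ 2 * dot (horo (hval x) - horo (hval y)) (horo (hval x) - horo (hval y)).
Proof.
move=> gh lam0; have := hcosh_iso g x y; rewrite !hcosh_horo !gh => /addrI.
have := height_hval x; have := height_hval y.
set a := height (hval x); set c := height (hval y).
set D := dot (horo (hval x) - _) _; set D' := dot (horo (hval (g x)) - _) _.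
move=> c0 a0 /eqP; clearbody a c D D'.
have ac : 2 * a * c != 0 by rewrite lt0r_neq0// !mulr_gt0.
have lac : 2 * (lam * a) * (lam * c) != 0 by rewrite lt0r_neq0// !mulr_gt0.
rewrite eqr_div// => /eqP E.
apply: (mulIf ac); apply: (addIr ((lam * a - lam * c) ^+ 2 * (2 * a * c))).
by rewrite -mulrDl E; ring.
Qed.

Lemma similarity_exists : exists lam A b, similarity g lam A b.
Proof.
have [lam lam0 gh] := fixing_scales_height.
(* The last summand extends the map from the hyperplane to all vectors, scaling the direction [W] by
   [lam], as [similarity_affine] requires. *)
pose f z := horo (hval (g (above z))) + (lam * dot z W) *: W.
have horoW x : dot (horo (hval x)) W = 0.
  by rewrite horo_orthogonal// gt_eqF// sqd_hval.
have [z1 z2|A A1 fA] := @similarity_affine R n f lam lam0.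
  have -> : f z1 - f z2 = (horo (hval (g (above z1))) - horo (hval (g (above z2))))
      - (lam * dot (z2 - z1) W) *: W.
    by rewrite /f dotDl dotNl; apply/rowP => i; rewrite !mxE; ring.
  rewrite pythagoras; last by rewrite dotDl dotNl !horoW subrr.
  rewrite (@horo_similar lam)// !horo_above exprMn -mulrDr; congr (_ * _).
  have -> : horizontal z1 - horizontal z2 = (z1 - z2) - dot (z1 - z2) W *: W.
    by rewrite /horizontal dotDl dotNl; apply/rowP => i; rewrite !mxE; ring.
  rewrite -[z2 - z1]opprB; move: (z1 - z2) => z.
  by rewrite !dotE (dotC W z) bval1; ring.
have f0 : f 0 = horo (hval (g (above 0))) by rewrite /f dot0l mulr0 scale0r addr0.
exists lam, A, (f 0); split => //.
- have := fA W; rewrite /f bval1 dot0l mulr0 scale0r addr0 mulr1 addrC.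
  have -> : above W = above 0.
    by apply: val_inj; rewrite /= /horizontal bval1 dot0l !scale0r scale1r !subrr.
  by move/addIr/(scalerI (lt0r_neq0 lam0)).
- by rewrite f0 horoW.
move=> x; split; first exact: gh.
(* The point [x] and the point of height 1 with the same horizontal part lie on one vertical line;
   by [horo_similar] their images have equal horizontal parts. *)
rewrite -fA /f horoW mulr0 scale0r addr0; apply/eqP; rewrite -subr_eq0; apply/eqP.
apply: dot_eq0; rewrite (@horo_similar lam)// horo_above horizontal_id ?horoW//.
by rewrite subrr dot0l mulr0.
Qed.

End fixing_w.

(** Together with [similarityM] this makes arbitrarily chosen data [lam], [A], [b]
    multiplicative. *)
Lemma similarity_unique g lam A b lam' A' b' :
  similarity g lam A b -> similarity g lam' A' b' ->
  [/\ lam = lam', A = A' & b = b'].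
Proof.
move=> [l0 A1 AW bW gx] [l0' A1' AW' bW' gx'].
have ll : lam = lam'.
  have := (gx' (above 0)).1; rewrite (gx _).1 height_above !mulr1; exact.
subst lam'; have bb : b = b'.
  have := (gx' (above 0)).2; rewrite (gx _).2 horo_above horizontal_id ?dot0l//.
  by rewrite !mul0mx !scaler0 !add0r.
subst b'; split => //.
apply/row_matrixP => i; rewrite !rowE.
move: (delta_mx 0 i : 'rV[R]_n) => z.
have {1 2}-> : z = horizontal z + dot z W *: W by rewrite /horizontal subrK.
rewrite [LHS]mulmxDl [RHS]mulmxDl -!scalemxAl AW AW'; congr (_ + _).
have := (gx' (above z)).2; rewrite (gx _).2 horo_above => /addIr.
exact: (scalerI (lt0r_neq0 l0)).
Qed.

Lemma similarityM g h lam A b lam' A' b' :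
  similarity g lam A b -> similarity h lam' A' b' ->
  similarity (g * h)%g (lam * lam') (A' *m A) (lam *: (b' *m A) + b).
Proof.
move=> [l0 A1 AW bW gx] [l0' A1' AW' bW' gx']; split.
- exact: mulr_gt0.
- by rewrite trmx_mul mulmxA -[A' *m A *m _]mulmxA A1 mulmx1.
- by rewrite mulmxA AW' AW.
- by rewrite dotDl dotZl -{1}AW dot_orthogonal// bW' bW mulr0 addr0.
move=> x; rewrite iso_mulE (gx _).1 (gx _).2 (gx' _).1 (gx' _).2; split.
  by rewrite mulrA.
by rewrite mulmxDl scalerDr -scalemxAl scalerA mulmxA addrA.
Qed.

Lemma similarity_boundary g lam A b (xi : boundary R n) :
  similarity g lam A b -> xi <> w ->
  boundary_act g xi <> w /\
  horo (bval (boundary_act g xi)) = lam *: (horo (bval xi) *m A) + b.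
Proof.
move=> [l0 A1 AW bW gx] xiw; have qxi := sqd_bval xiw.
have rxi := @ray_tends_to R n xi; have grxi := @boundary_actP _ _ g xi _ rxi.
have [c1 c2 c3] := cvg_coordinates qxi rxi.
have mxc (s : nat -> 'rV[R]_n) v : s k @[k --> \oo] --> v -> s k *m A @[k --> \oo] --> v *m A.
  move=> sv; apply: cvg_dotB; rewrite -[X in _ --> X](_ : dot (v - v) (v - v) = 0).
    rewrite (_ : (fun k => _) = (fun k => dot (s k - v) (s k - v))).
      by apply: cvg_dot; apply: cvgB => //; exact: cvg_cst.
    by apply/funext => k; rewrite -mulmxBl dot_orthogonal.
  by rewrite subrr dot0l.
have c3' : horo (hval (g (ray xi k))) @[k --> \oo] --> lam *: (horo (bval xi) *m A) + b.
  rewrite (_ : (fun k => _) = (fun k => lam *: (horo (hval (ray xi k)) *m A) + b)); last first.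
    by apply/funext => k; rewrite (gx _).2.
  apply: cvgD; last exact: cvg_cst.
  by apply: cvgZ; [exact: cvg_cst|exact: mxc].
have c2' : height (hval (g (ray xi k))) @[k --> \oo] --> (0 : R).
  rewrite (_ : (fun k => _) = (fun k => lam * height (hval (ray xi k)))); last first.
    by apply/funext => k; rewrite (gx _).1.
  rewrite -[X in _ --> X](mulr0 lam) -(height_bval xi).
  by apply: cvgM; [exact: cvg_cst|exact: c2].
have c1' : sqd (hval (g (ray xi k))) @[k --> \oo] --> sqd (bval (boundary_act g xi)).
  by apply: cvg_dot; apply: cvgB; [exact: grxi|exact: cvg_cst|exact: grxi|exact: cvg_cst].
have qeta : sqd (bval (boundary_act g xi)) != 0.
  apply/eqP => q0; set u := lam *: _ + _ in c3'.
  have l1 : sqd (hval (g (ray xi k))) *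
     (dot (horo (hval (g (ray xi k)))) (horo (hval (g (ray xi k)))) +
      (height (hval (g (ray xi k))) + 2^-1) *
      (height (hval (g (ray xi k))) + 2^-1)) @[k --> \oo] -->
      sqd (bval (boundary_act g xi)) * (dot u u + (0 + 2^-1) * (0 + 2^-1)).
    apply: cvgM => //; apply: cvgD; first by apply: cvg_dot.
    by apply: cvgM; apply: cvgD => //; exact: cvg_cst.
  have l2 : cst (1 : R) k @[k --> \oo] --> (1 : R) by exact: cvg_cst.
  move: l1; rewrite (_ : (fun k => _) = cst 1); last first.
    by apply/funext => k; rewrite -expr2 sqd_horo// gt_eqF// sqd_hval.
  move=> l1; have : sqd (bval (boundary_act g xi)) *
      (dot u u + (0 + 2^-1) * (0 + 2^-1)) = 1 by exact: (cvg_unique _ l1 l2).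
  by rewrite q0 mul0r => /eqP; rewrite eq_sym oner_eq0.
split; first by move=> eta; move: qeta; rewrite eta /sqd subrr dot0l eqxx.
have [_ _ d3] := cvg_coordinates qeta grxi.
exact: (cvg_unique _ d3 c3').
Qed.

End horospherical_coordinates.

(** * Discrete parabolic groups *)

Lemma infinite_pigeonhole (T : choiceType) (X : set T) (I : finType) (c : T -> I) :
  infinite_set X -> exists x y, [/\ X x, X y, x <> y & c x = c y].
Proof.
move=> infX; apply: contrapT => no; apply: infX.
have cinj x y : X x -> X y -> c x = c y -> x = y.
  by move=> Xx Xy cxy; apply: contrapT => xy; apply: no; exists x, y.
have [->|/set0P[x0 Xx0]] := eqVneq X set0; first exact: finite_set0.
have /choice[f fP] i : exists y, X y /\ ((exists2 x, X x & c x = i) -> c y = i).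
  have [[x Xx xi]|nx] := pselect (exists2 x, X x & c x = i); first by exists x.
  by exists x0; split.
apply: (@sub_finite_set _ _ (range f)); last first.
  by apply: finite_image; exact: finite_finset.
move=> x Xx; exists (c x) => //; have [Xf fc] := fP (c x).
by apply: cinj => //; apply: fc; exists x.
Qed.

(** * Discreteness and properness *)

Section isometry_neighborhoods.
Context {R : realType} {T : metricType R}.

(** The isometries moving the points of a bounded ball by less than [e] generate a filter [F]. Near
    each point of a compact set such isometries send points into a prescribed open set, and
    compactness makes this uniform, so [F] converges to the identity in the compact-open
    topology. *)
Lemma nbhs_iso_one (o : T) (V : set (Iso T)) : nbhs (1%g : Iso T) V ->
  exists r e, 0 < e /\ forall f : Iso T,
    (forall x, mdist o x <= r -> mdist (f x) x < e) -> V f.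
Proof.
move=> [_ [[B Bop <-] B1 BV]].
pose U (p : R * R) := [set f : Iso T | forall x, mdist o x <= p.1 -> mdist (f x) x < p.2].
pose F : set_system (Iso T) := filter_from [set p : R * R | 0 < p.2] U.
have FF : Filter F.
  apply: filter_from_filter; first by exists (0, 1); exact: ltr01.
  move=> [r e] [r' e'] /= e0 e'0; exists (Num.max r r', Num.min e e').
    by rewrite /= lt_min e0.
  move=> f /= Uf; split=> x /= xr.
    by have := Uf x; rewrite le_max xr lt_min => /(_ isT)/andP[].
  by have := Uf x; rewrite le_max xr orbT lt_min => /(_ isT)/andP[].
have FB : F [set f : Iso T | B (iso_fun f)].
  pose F' : set_system {compact-open, T -> T} := fmap (@iso_fun R T) F.
  have : F' --> (iso_fun (1%g : Iso T) : {compact-open, T -> T}).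
    apply/compact_open_cvgP => K O cK oO KO.
    have near : \forall f \near F, K `<=` (fun x => O ((f : Iso T) x)).
      apply: ((compact_near_coveringP K).1 cK _ F (fun f x => O (f x)) FF) => x Kx.
      have /nbhs_ballP[e /= e0 xO] : nbhs x O.
        by apply: open_nbhs_nbhs; split => //; apply: KO; exists x.
      have e2 : 0 < e / 2 by rewrite divr_gt0.
      exists (ball x (e / 2), U (mdist o x + e / 2, e / 2)) => /=.
        split; first exact: nbhsx_ballx.
        by exists (mdist o x + e / 2, e / 2).
      move=> [x' f] /= []; rewrite ballEmdist /= => xx' Uf; apply: xO.
      rewrite ballEmdist/=; apply: le_lt_trans (metric_triangle _ x' _) _.
      rewrite (splitr e) ltrD// metric_sym; apply: Uf.
      by apply: le_trans (metric_triangle _ x _) _; rewrite lerD2l ltW.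
    apply: filterS near => f /= fO _ [x Kx <-]; exact: fO.
  move=> /(_ B); apply; exact: open_nbhs_nbhs.
have [[r e] /= e0 UB] := FB; exists r, e; split => // f fr.
by apply: BV; exact: UB.
Qed.

End isometry_neighborhoods.

Section arcosh_bounds.
Context {R : realType}.
Implicit Types (a e : R).

Lemma arcosh_small e : 0 < e ->
  exists2 d, 0 < d & forall a, 1 <= a -> a - 1 <= d -> arcosh a < e.
Proof.
(* The square root is at most [2 * s], and ln (1 + x) <= x then gives
   [arcosh a <= s ^+ 2 + 2 * s <= 3 * s]. *)
move=> e0; pose s := Num.min 1 (e / 4).
have s0 : 0 < s by rewrite lt_min ltr01 divr_gt0.
have s1 : s <= 1 by rewrite ge_min lexx.
have se : s <= e / 4 by rewrite ge_min lexx orbT.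
exists (s ^+ 2) => [|a a1 as2]; first exact: exprn_gt0.
have sq : Num.sqrt (a ^+ 2 - 1) <= 2 * s.
  rewrite -[leRHS]ger0_norm ?mulr_ge0 ?(ltW s0)// -sqrtr_sqr ler_sqrt ?sqr_ge0//.
  have s21 : s ^+ 2 <= 1 by rewrite expr_le1// ltW.
  have : (a - 1) * (a + 1) <= s ^+ 2 * 3 by rewrite ler_pM//; lra.
  by rewrite exprMn; nra.
apply: (@le_lt_trans _ _ ((a - 1) + Num.sqrt (a ^+ 2 - 1))).
  rewrite /arcosh -[a in ln (a + _)](subrKC 1) -addrA.
  by apply: le_ln1Dx; have := sqrtr_ge0 (a ^+ 2 - 1); lra.
by nra.
Qed.

Lemma le_expR_arcosh a : 1 <= a -> a <= expR (arcosh a) <= 2 * a.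
Proof.
move=> a1; rewrite /arcosh lnK ?posrE ?arcosh_arg_gt0//.
rewrite lerDl sqrtr_ge0/= mulr_natl mulr2n lerD2l.
rewrite -[leRHS]ger0_norm; last lra.
by rewrite -sqrtr_sqr ler_sqrt ?sqr_ge0//; lra.
Qed.

End arcosh_bounds.

Section parabolic_subgroup.
Context {R : realType} {n : nat}.
Local Notation H := (hyperbolic_space R n).
Variables (w : boundary R n) (P : set (Iso H)).
Hypothesis cP : group_closed (mem P).
Hypothesis dP : discrete_subset P.
Variables (lam : Iso H -> R) (A : Iso H -> 'M[R]_n) (b : Iso H -> 'rV[R]_n).
Hypothesis simP : forall g, P g -> similarity w g (lam g) (A g) (b g).

Let PM g h : P g -> P h -> P (g * h)%g := @group_closed_mul _ P g h cP.
Let PV g : P g -> P g^-1%g := @group_closed_inv _ P g cP.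

(** Among infinitely many elements with bounded data two have almost equal data. Then [f^-1 * g] is
    almost the identity on a large ball, hence equal to 1 by discreteness. The ratio is only assumed
    bounded, since the statement is used to prove that it is 1. *)
Lemma similarity_proper c r : 1 <= c ->
  finite_set [set g | P g /\ [/\ c^-1 <= lam g, lam g <= c & enorm (b g) <= r]].
Proof.
move=> c1; apply: contrapT => infX; set X := [set g | _] in infX.
have [_ [V V1 VP]] := dP (group_closed_one cP).
have [rho [e [e0 UV]]] := nbhs_iso_one (above w 0) V1.
have [d d0 dP'] := arcosh_small e0.
(* Within [rho] of [above w 0] the horizontal part has norm at most [M] and the height lies between
   [M^-1] and [M]. The constant [K] is the resulting bound for [hcosh (g x) (f x) - 1] divided by
   [eta ^+ 2]. *)
pose M := 2 * expR rho.
have M0 : 0 < M by rewrite mulr_gt0 ?expR_gt0.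
pose K := c ^+ 2 * M ^+ 2 * ((M + c * M + 1) ^+ 2 + M ^+ 2).
have c0 : 0 < c by lra.
have K0 : 0 < K.
  apply: mulr_gt0; first by apply: mulr_gt0; exact: exprn_gt0.
  by apply: ltr_wpDl; [exact: sqr_ge0|exact: exprn_gt0].
pose eta := Num.sqrt (d / K).
have eta0 : 0 < eta by rewrite sqrtr_gt0 divr_gt0.
have etaK : eta ^+ 2 * K = d.
  by rewrite sqr_sqrtr ?divfK ?gt_eqF// divr_ge0 ?ltW.
have [T1 [c1f P1]] := @grid_coloring R 1 c eta eta0.
have [T2 [c2f P2]] := @grid_coloring R (n * n) (Num.sqrt n%:R) eta eta0.
have [T3 [c3f P3]] := @grid_coloring R n r eta eta0.
have [f [g [[Pf [lf1 lf2 bf]] [Pg [lg1 lg2 bg]] fg cfg]]] :=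
  @infinite_pigeonhole _ X (T1 * T2 * T3)%type
    (fun g => (c1f (const_mx (lam g)), c2f (mxvec (A g)), c3f (b g))) infX.
case: cfg => C1 C2 C3.
have [lf0 Af1 _ _ fx] := simP Pf; have [lg0 Ag1 _ _ gx] := simP Pg.
have en1 a : enorm (const_mx a : 'rV[R]_1) = `|a|.
  by rewrite /enorm /dot big_ord_recl big_ord0 addr0 !mxE -expr2 sqrtr_sqr.
have {C1} lfg : `|lam g - lam f| <= eta.
  have := P1 (const_mx (lam g)) (const_mx (lam f)).
  rewrite -[X in _ -> _ -> _ -> enorm X <= _]raddfB/= !en1 (gtr0_norm lf0) (gtr0_norm lg0).
  by apply.
have {C2} Afg : fnorm (A g - A f) <= eta.
  rewrite /fnorm linearB/=; apply: P2 => //.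
    by rewrite -/(fnorm _) fnorm_orthogonal.
  by rewrite -/(fnorm _) fnorm_orthogonal.
have {C3} bfg : enorm (b g - b f) <= eta by exact: P3.
have : (V `&` P) (f^-1 * g)%g.
  split; last exact: PM (PV Pf) Pg.
  apply: UV => x xrho.
  rewrite -(iso_mdist f) -[f _]iso_mulE mulgA mulgV mul1g.
  rewrite mdist_hyperbolicE /hdist.
  apply: dP'; first exact: hcosh_ge1.
  rewrite (hcosh_horo w) (gx _).1 (gx _).2 (fx _).1 (fx _).2.
  move: xrho; rewrite mdist_hyperbolicE /hdist => xrho.
  have := le_expR_arcosh (hcosh_ge1 (above w 0) x) => /andP[+ _].
  have : expR (arcosh (hcosh (above w 0) x)) <= expR rho by rewrite ler_expR.
  move=> /[swap] /le_trans /[apply].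
  rewrite (hcosh_horo w) horo_above height_above horizontal_id ?dot0l// sub0r.
  rewrite dotNl dotNr opprK mulr1.
  have := height_hval w x; set t := height w (hval x); set z := horo w (hval x).
  clearbody t z; rewrite -(enorm_sqr z) => t0.
  have z0 := enorm_ge0 z.
  have Rho1 : 0 < expR rho := expR_gt0 _.
  rewrite -lerBrDl ler_pdivrMr ?mulr_gt0// => bnd.
  have zM : enorm z <= M.
    rewrite -ler_sqr ?nnegrE ?(ltW M0)//; rewrite /M; nra.
  have tM : t <= M by rewrite /M; nra.
  have Mt : 1 <= M * t by rewrite /M; nra.
  pose N := eta * (M + c * M + 1).
  have uN : enorm (lam g *: (z *m A g) + b g - (lam f *: (z *m A f) + b f)) <= N.
    have -> : lam g *: (z *m A g) + b g - (lam f *: (z *m A f) + b f) =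
      ((lam g - lam f) *: (z *m A g) + lam f *: (z *m (A g - A f))) + (b g - b f).
      by rewrite mulmxBr scalerBl scalerBr (addrA _ (lam f *: _)) subrK opprD addrACA.
    apply: le_trans (enormD _ _) _; rewrite /N mulrDr mulr1 lerD//.
    apply: le_trans (enormD _ _) _; rewrite mulrDr lerD// enormZ.
      rewrite enorm_orthogonal// ler_pM ?enorm_ge0//.
    rewrite (gtr0_norm lf0) mulrCA ler_pM ?enorm_ge0//; first exact: ltW.
    apply: le_trans (enorm_mulmx _ _) _.
    by rewrite mulrC ler_pM ?enorm_ge0.
  have u0 := enorm_ge0 (lam g *: (z *m A g) + b g - (lam f *: (z *m A f) + b f)).
  rewrite -enorm_sqr; move: uN u0; set u := enorm _ => uN u0.
  rewrite addrAC subrr add0r -mulrBl exprMn.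
  have lfg2 : (lam g - lam f) ^+ 2 <= eta ^+ 2.
    by rewrite -real_normK ?num_real// lerXn2r ?nnegrE ?(ltW eta0).
  have num : u ^+ 2 + (lam g - lam f) ^+ 2 * t ^+ 2 <=
      eta ^+ 2 * ((M + c * M + 1) ^+ 2 + M ^+ 2).
    rewrite mulrDr lerD//.
      by rewrite -exprMn lerXn2r ?nnegrE//; exact: le_trans uN.
    by rewrite ler_pM ?sqr_ge0// lerXn2r ?nnegrE//; exact: ltW.
  have den : c^-1 ^+ 2 * M^-1 ^+ 2 <= 2 * (lam g * t) * (lam f * t).
    have Mt' : M^-1 <= t by rewrite -div1r ler_pdivrMr// mulrC.
    have ci : 0 < c^-1 by rewrite invr_gt0.
    have Mi : 0 < M^-1 by rewrite invr_gt0.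
    have a1 : c^-1 * M^-1 <= lam g * t by rewrite ler_pM//; exact: ltW.
    have a2 : c^-1 * M^-1 <= lam f * t by rewrite ler_pM//; exact: ltW.
    have a0 : 0 < c^-1 * M^-1 by rewrite mulr_gt0.
    by rewrite -exprMn; nra.
  rewrite ler_pdivrMr; last by rewrite !mulr_gt0.
  apply: le_trans num _.
  have -> : eta ^+ 2 * ((M + c * M + 1) ^+ 2 + M ^+ 2) = d * (c^-1 ^+ 2 * M^-1 ^+ 2).
    rewrite -etaK /K; field; rewrite !gt_eqF//.
  by rewrite ler_wpM2l// ltW.
rewrite VP /= => fg1; apply: fg; rewrite -[LHS]mulg1 -fg1 mulgA mulgV mul1g//.
Qed.

Definition moebius_act (z : 'rV[R]_n) (g : Iso H) := lam g *: (z *m A g) + b g.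

Let data1 : [/\ lam 1%g = 1, A 1%g = 1%:M & b 1%g = 0].
Proof.
apply: (similarity_unique (simP (group_closed_one cP))).
split; rewrite ?ltr01 ?trmx1 ?mulmx1 ?dot0l// => x.
by rewrite mul1r mulmx1 scale1r addr0.
Qed.

Lemma lamM g h : P g -> P h -> lam (g * h)%g = lam g * lam h.
Proof.
move=> Pg Ph.
by have [] := similarity_unique (simP (PM Pg Ph)) (similarityM (simP Pg) (simP Ph)).
Qed.

Lemma linearM g h : P g -> P h -> A (g * h)%g = A h *m A g.
Proof.
move=> Pg Ph.
by have [] := similarity_unique (simP (PM Pg Ph)) (similarityM (simP Pg) (simP Ph)).
Qed.

Lemma translationM g h : P g -> P h -> b (g * h)%g = lam g *: (b h *m A g) + b g.
Proof.
move=> Pg Ph.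
by have [] := similarity_unique (simP (PM Pg Ph)) (similarityM (simP Pg) (simP Ph)).
Qed.

Lemma moebius_actM z g h : P g -> P h ->
  moebius_act z (g * h)%g = moebius_act (moebius_act z h) g.
Proof.
move=> Pg Ph; rewrite /moebius_act lamM// linearM// translationM//.
by rewrite mulmxDl scalerDr -scalemxAl scalerA mulmxA addrA.
Qed.

Lemma moebius_act1 z : moebius_act z 1%g = z.
Proof. by have [l1 A1 b1] := data1; rewrite /moebius_act l1 A1 b1 mulmx1 scale1r addr0. Qed.

Lemma moebius_act_dist u v g : P g ->
  enorm (moebius_act u g - moebius_act v g) = lam g * enorm (u - v).
Proof.
move=> Pg; have [l0 A1 _ _ _] := simP Pg.
rewrite /moebius_act opprD addrACA subrr addr0 -scalerBr -mulmxBl enormZ.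
by rewrite gtr0_norm// enorm_orthogonal.
Qed.

Hypothesis parP : parabolic P.
Hypothesis wP : fixed_by P w.

(** The fixed point comes from linear algebra: [1%:M - lam g *: A g] is injective because [A g]
    preserves norms and [lam g < 1]. *)
Let contracting_fixpoint g : P g -> lam g < 1 ->
  exists2 e, dot e (bval w) = 0 & moebius_act e g = e.
Proof.
move=> Pg lg; have [l0 A1 AW bW _] := simP Pg.
pose M := 1%:M - lam g *: A g.
have Mu : M \in unitmx.
  rewrite -row_free_unit; apply: inj_row_free => u.
  rewrite mulmxBr mulmx1 => /eqP; rewrite subr_eq0 => /eqP uE.
  have : enorm u = lam g * enorm u.
    by rewrite {1}uE -scalemxAr enormZ gtr0_norm// enorm_orthogonal.
  move=> E; apply: enorm_eq0; have := enorm_ge0 u; nra.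
pose e := b g *m invmx M.
have eE : moebius_act e g = e.
  have : e *m M = b g by rewrite /e mulmxKV.
  by rewrite /moebius_act mulmxBr mulmx1 -scalemxAr => <-; rewrite addrC subrK.
exists e => //.
have : dot e (bval w) = lam g * dot e (bval w).
  by rewrite -{1}eE /moebius_act dotDl bW addr0 dotZl -{1}AW dot_orthogonal.
by move=> E; nra.
Qed.

(** The powers of [g] fix [e] and contract, so the conjugate [f k] moves [e] by [lam g ^+ k * D].
    For positive [D] these values are distinct, while the ratios of the [f k] all equal [lam p] and
    their translation parts stay bounded. *)
Let contracting_fixpoint_common g e p : P g -> lam g < 1 ->
  moebius_act e g = e -> P p -> moebius_act e p = e.
Proof.
move=> Pg lg eg Pp; apply: contrapT => ep.
have [lg0 _ _ _ _] := simP Pg; have [lp0 _ _ _ _] := simP Pp.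
have Pk k : P (g ^+ k)%g by exact: group_closed_exp.
have lk k : lam (g ^+ k)%g = lam g ^+ k.
  elim: k => [|k ih]; first by rewrite expg0 expr0; case: data1.
  by rewrite expgS exprS lamM// ih.
have ek k : moebius_act e (g ^+ k)%g = e.
  elim: k => [|k ih]; first by rewrite expg0 moebius_act1.
  by rewrite expgS moebius_actM// ih.
have eVk k : moebius_act e (g ^+ k)^-1%g = e.
  by rewrite -{1}(ek k) -moebius_actM ?mulVg ?moebius_act1//; exact: PV.
have lV h : P h -> lam h^-1%g = (lam h)^-1.
  move=> Ph; have [lh0 _ _ _ _] := simP Ph.
  have := lamM Ph (PV Ph); rewrite mulgV; have [-> _ _] := data1.
  by move=> E; rewrite -[RHS]mulr1 E mulKf// gt_eqF.
pose f k := (g ^+ k * (p * (g ^+ k)^-1))%g.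
have Pf k : P (f k) by apply/PM/PM/PV.
have lf k : lam (f k) = lam p.
  rewrite /f lamM//; last by apply/PM/PV.
  by rewrite lamM ?lV//; [rewrite mulrCA mulfV ?mulr1// lk expf_neq0// gt_eqF|exact: PV].
pose D := enorm (moebius_act e p - e).
have D0 : 0 < D.
  rewrite lt_neqAle enorm_ge0 andbT eq_sym; apply/eqP => /enorm_eq0/eqP.
  by rewrite subr_eq0 => /eqP.
have fe k : enorm (moebius_act e (f k) - e) = lam g ^+ k * D.
  rewrite /f moebius_actM//; last by apply/PM/PV.
  rewrite moebius_actM//; last exact: PV.
  by rewrite eVk -{2}(ek k) moebius_act_dist// lk.
pose c := Num.max 1 (Num.max (lam p) (lam p)^-1).
have c1 : 1 <= c by rewrite le_max lexx.
have fin := similarity_proper (lam p * enorm e + D + enorm e) c1.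
have finj : injective f.
  move=> j k jk; have := fe j; rewrite jk fe => /(mulIf (lt0r_neq0 D0)).
  by move=> E; apply/esym/(ieexprIn lg0 _ E); rewrite lt_eqF.
apply: infinite_nat; rewrite -(preimage_setT f).
apply: (@sub_finite_set _ _ (f @^-1` [set g | P g /\ [/\ c^-1 <= lam g, lam g <= c &
    enorm (b g) <= lam p * enorm e + D + enorm e]])); last first.
  by apply: finite_preimage fin => j k _ _; exact: finj.
move=> k _ /=; split; first exact: Pf.
rewrite lf; split.
- rewrite invf_ple ?posrE//; last by apply: lt_le_trans c1.
  by rewrite !le_max lexx !orbT.
- by rewrite !le_max lexx !orbT.
have -> : b (f k) = moebius_act 0 (f k) by rewrite /moebius_act mul0mx scaler0 add0r.
rewrite -[moebius_act _ _](subrK e); apply: le_trans (enormD _ _) _; rewrite lerD2r.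
apply: le_trans (enorm_triangle (moebius_act e (f k)) _ _) _.
rewrite moebius_act_dist// lf sub0r enormN lerD2l fe ler_piMl ?(ltW D0)//.
by rewrite exprn_ile1// ltW.
Qed.

(** A common fixed point [e] of the similarities is the horizontal part of a boundary point other
    than [w] fixed by [P], against uniqueness. Ratios above 1 are excluded by passing to the inverse
    in [parabolic_lam1]. *)
Lemma parabolic_lam_ge1 g : P g -> 1 <= lam g.
Proof.
move=> Pg; rewrite leNgt; apply/negP => lg.
have [e eW eg] := contracting_fixpoint Pg lg.
pose eta := Boundary (uncoord_eq1 eW (lexx 0) erefl).
have qeta : sqd w (bval eta) != 0.
  rewrite sqd_uncoord//; apply/invr_neq0/lt0r_neq0/ltr_wpDl; first exact: dot_ge0.
  by apply: exprn_gt0; rewrite add0r invr_gt0.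
have etaw : eta <> w.
  by move=> E; move: qeta; rewrite E /sqd subrr dot0l eqxx.
have etaP : fixed_by P eta.
  move=> p Pp; have [pw hp] := similarity_boundary (simP Pp) etaw.
  apply: val_inj; apply: (@coordinates_inj _ _ w) => //.
  - exact: sqd_bval.
  - rewrite hp horo_uncoord//.
    exact: (contracting_fixpoint_common Pg lg eg Pp).
  - by rewrite !height_bval.
have [w' [_ uniq]] := parP.
by apply: etaw; rewrite -(uniq _ etaP) -(uniq _ wP).
Qed.

Lemma parabolic_lam1 g : P g -> lam g = 1.
Proof.
move=> Pg; have := lamM Pg (PV Pg); rewrite mulgV; have [-> _ _] := data1.
by have := parabolic_lam_ge1 Pg; have := parabolic_lam_ge1 (PV Pg); nra.
Qed.

End parabolic_subgroup.

Section torsion_free_orbits.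
Context {G : groupType}.

Lemma torsion_free_finite_powers (P X : set G) g : torsion_free P -> P g ->
  finite_set X -> (forall k, X (g ^+ k)%g) -> g = 1%g.
Proof.
move=> tfP Pg fX Xg; apply: contrapT => g1.
have ginj : injective (fun k => (g ^+ k)%g).
  move=> i j; wlog ij : i j / (i <= j)%N => [hw|gij].
    by have [/hw|/ltnW /hw + gij] := leqP i j; [exact|move=> /(_ (esym gij))].
  apply/eqP; rewrite eqn_leq ij/= leqNgt; apply/negP => ltij.
  apply: g1; apply: (tfP _ (j - i)%N) => //; first by rewrite subn_gt0.
  by apply: (mulgI (g ^+ i)%g); rewrite -expgnDr subnKC// mulg1.
apply: infinite_nat.
rewrite -(_ : (fun k => (g ^+ k)%g) @^-1` X = setT); last first.
  by apply/seteqP; split => // i _; exact: Xg.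
by apply: finite_preimage fX => i j _ _; exact: ginj.
Qed.

End torsion_free_orbits.

(** * Free orbits and positivity of the exponent *)

Section free_orbits.
Context {R : realType} {G : groupType} {n : nat}.
Variables (P : set G) (A : G -> 'M[R]_n) (b : G -> 'rV[R]_n).
Hypothesis cP : group_closed (mem P).
Hypothesis actP : euclidean_action P A b.
Hypothesis properP : forall r, finite_set [set g | P g /\ enorm (b g) <= r].
Hypothesis tfP : torsion_free P.
Variable z : 'rV[R]_n.

Local Notation act := (affine_act A b z).
Local Notation disp := (displacement act).

Let PM g h : P g -> P h -> P (g * h)%g := @group_closed_mul _ P g h cP.
Let PV g : P g -> P g^-1%g := @group_closed_inv _ P g cP.
Let actM k g h : P k -> P g -> P h -> enorm (act (k * g)%g - act (k * h)%g) =
  enorm (act g - act h).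
Proof. exact: affine_act_translate. Qed.

(** All powers of [g] lie in the orbit ball of radius 0, which is finite; torsion freeness does the
    rest. *)
Lemma displacement_eq0 g : P g -> disp g = 0 -> g = 1%g.
Proof.
move=> Pg g0; apply: (torsion_free_finite_powers tfP Pg).
  exact: (orbit_ball_finite cP actP properP z 0).
elim=> [|k [Pk k0]]; first by rewrite expg0; split;
  [exact: group_closed_one|rewrite displacement1].
rewrite expgS; split; first exact: PM.
by apply: le_trans (displacementM cP actM Pg Pk) _; rewrite g0 add0r.
Qed.

(** By invariance the gap between two orbit points is the displacement of [h^-1 * g], and only
    finitely many elements have displacement at most 1. *)
Lemma orbit_separated : exists2 kappa : R, 0 < kappa &
  forall g h, P g -> P h -> g <> h -> kappa <= enorm (act g - act h).
Proof.
have [||e e0 eP] := @finite_set_pos_lb R G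
    [set g | orbit_ball P act 1 g /\ g <> 1%g] disp.
- by apply: sub_finite_set (orbit_ball_finite cP actP properP z 1) => g [].
- move=> g [[Pg _] g1]; rewrite lt_neqAle enorm_ge0 andbT eq_sym.
  by apply/eqP => /displacement_eq0 => /(_ Pg).
exists (Num.min 1 e) => [|g h Pg Ph gh]; first by rewrite lt_min ltr01.
have Phg : P (h^-1 * g)%g := PM (PV Ph) Pg.
rewrite -(displacement_dist cP actM Ph Pg) ge_min.
have [//|lt1] := leP 1 (disp (h^-1 * g)%g).
apply: eP; split; first by split => //; exact: ltW.
by move=> E; apply: gh; apply: (mulgI h^-1%g); rewrite E mulVg.
Qed.

(** With exponent 0 the counts would stay below [C], whereas a nontrivial [g] of infinite order
    makes [P] infinite. *)
Lemma orbit_growth_exponent_gt0 k g : P g -> g <> 1%g -> 0 <= k ->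
  power_growth (orbit_count P act) k -> 0 < k.
Proof.
move=> Pg g1 k0 [C C0 NC]; rewrite lt_neqAle k0 andbT; apply/eqP => k0'.
have infP : infinite_set P.
  move=> fP; apply: g1; apply: (torsion_free_finite_powers tfP Pg fP) => j.
  exact: group_closed_exp.
have [B BP CB] := infinite_set_fset (Num.bound C) infP.
pose r := 1 + \sum_(h <- B) disp h.
have r1 : 1 <= r by rewrite lerDl sumr_ge0// => h _; exact: enorm_ge0.
have /andP[_] := NC _ r1; rewrite -k0' powRr0 mulr1 leNgt => /negP; apply.
apply: lt_le_trans (archi_boundP (ltW C0)) _; rewrite ler_nat.
apply: leq_trans CB _; apply: (fsubset_leq_card).
apply/fsubsetP => h hB; rewrite in_fset_set; last first.
  exact: (orbit_ball_finite cP actP properP).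
rewrite inE; split; first exact: BP.
rewrite /r (bigD1_seq h)//= addrCA lerDl addr_ge0// sumr_ge0// => j _.
exact: enorm_ge0.
Qed.

End free_orbits.

Section parabolic_data.
Context {R : realType} {n : nat}.
Local Notation H := (hyperbolic_space R n).
Variables (P : set (Iso H)).
Hypotheses (cP : group_closed (mem P)) (dP : discrete_subset P).
Hypotheses (parP : parabolic P).

Lemma parabolic_euclidean : exists (w : boundary R n) (A : Iso H -> 'M[R]_n)
    (b : Iso H -> 'rV[R]_n), [/\ fixed_by P w,
    forall g, P g -> similarity w g 1 (A g) (b g), euclidean_action P A b,
    forall r, finite_set [set g | P g /\ enorm (b g) <= r] &
    forall g, P g -> A g = 1%:M -> b g = 0 -> g = 1%g].
Proof.
have [w [wP _]] := parP.
have /choice[lam /choice[A /choice[b simP]]] g : exists l A b, P g -> similarity w g l A b.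
  have [Pg|nP] := pselect (P g); last by exists 1, 1%:M, 0.
  by have [l [A [b s]]] := similarity_exists (wP _ Pg); exists l, A, b.
have lam1 : forall g, P g -> lam g = 1 := parabolic_lam1 cP dP simP parP wP.
exists w, A, b; split => //.
- by move=> g Pg; rewrite -(lam1 _ Pg); exact: simP.
- split.
  + by move=> g /simP[].
  + by move=> g h; exact: (linearM cP simP).
  + by move=> g h Pg Ph; rewrite (translationM cP simP)// lam1// scale1r.
- move=> r; apply: sub_finite_set (similarity_proper cP dP simP r (lexx 1)).
  by move=> g [Pg br]; split => //; rewrite lam1// invr1 lexx.
- move=> g Pg A1 b0; have [_ _ _ _ gx] := simP _ Pg.
  apply: isoP => x; apply: val_inj; apply: (@coordinates_inj _ _ w).
  + by rewrite gt_eqF// sqd_hval.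
  + by rewrite gt_eqF// sqd_hval.
  + by rewrite (gx x).2 lam1// A1 b0 mulmx1 scale1r addr0.
  + by rewrite (gx x).1 lam1// mul1r.
Qed.

End parabolic_data.

(** * Critical exponent *)

Section series_of_power_growth.
Context {R : realType} {T : choiceType}.
Variables (P : set T) (a : T -> R) (k : R).
Hypothesis a0 : forall x, 0 <= a x.
Hypothesis finP : forall r, finite_set [set x | P x /\ a x <= r].
Hypothesis k0 : 0 <= k.
Hypothesis growth : power_growth (fun r => ncard [set x | P x /\ a x <= r]) k.

Lemma geometric_sum_le (q : R) m : 0 <= q < 1 -> \sum_(i < m) q ^+ i <= (1 - q)^-1.
Proof.
move=> /andP[q0 q1]; have q1' : 0 < 1 - q by rewrite subr_gt0.
rewrite -div1r ler_pdivlMr// mulrC -[1 - q]opprB mulNr -subrX1 opprB.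
by rewrite gerBl exprn_ge0.
Qed.

(** Dyadic shells: at most [C] times (2 ^ (i + 1)) ^ k points have [1 + a x] between 2 ^ i and 2 ^
    (i + 1), each contributing at most 2 ^ (- i s), so the shells sum to a geometric series of ratio
    2 ^ (k - s). The bound over finite subsets serves both the Poincare series and the mass argument
    for covers. *)
Lemma power_sum_bounded s : k < s -> exists2 B, 0 < B & forall X : {fset T},
  [set` X] `<=` P -> \sum_(x <- X) (1 + a x) `^ (- s) <= B.
Proof.
move=> ks; have [C C0 NC] := growth.
have /choice[j jP] x : exists j : nat, 2 ^+ j <= 1 + a x < 2 ^+ j.+1.
  by apply: dyadic_scale; rewrite lerDl.
pose q : R := 2 `^ (k - s).
have q0 : 0 < q by rewrite powR_gt0.
have q1 : q < 1.
  by rewrite /q /powR pnatr_eq0/= expR_lt1 nmulr_rlt0 ?subr_lt0// ln_gt0 ?ltr1n.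
have two_pow t i : (2 ^+ i) `^ t = (2 `^ t) ^+ i :> R.
  by rewrite -powR_mulrn// -powRrM mulrC powRrM powR_mulrn// powR_ge0.
exists (C * 2 `^ k * (1 - q)^-1).
  by rewrite !mulr_gt0// ?powR_gt0// invr_gt0 subr_gt0.
move=> X XP; pose m := (\max_(x <- X) j x).+1.
have jm x : x \in X -> (j x < m)%N.
  by move=> xX; rewrite ltnS (big_fsetD1 x)//= leq_maxl.
apply: (@le_trans _ _ (\sum_(x <- X) \sum_(i < m | i == j x :> nat) (2 `^ (- s)) ^+ i)).
  rewrite big_seq [leRHS]big_seq; apply: ler_sum => x xX.
  rewrite (big_pred1 (Ordinal (jm _ xX))) /=; last by [].
  have /andP[j1 _] := jP x.
  rewrite -two_pow !powRN lef_pV2 ?posrE ?powR_gt0 ?exprn_gt0//; last first.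
    by rewrite ltr_wpDr.
  by rewrite ge0_ler_powR ?nnegrE ?exprn_ge0 ?addr_ge0// (le_trans k0)// ltW.
rewrite (exchange_big_dep xpredT)//=.
have q01 : 0 <= q < 1 by rewrite (ltW q0).
have Ck : 0 <= C * 2 `^ k by rewrite mulr_ge0 ?powR_ge0// ltW.
apply: le_trans (ler_wpM2l Ck (geometric_sum_le m q01)).
rewrite mulr_sumr; apply: ler_sum => i _.
rewrite -big_filter big_const_seq count_predT iter_addr_0 -[leLHS]mulr_natl.
have i1 : 1 <= 2 ^+ i.+1 :> R by rewrite exprn_ege1// ler1n.
have /andP[_ Nle] := NC _ i1.
apply: (@le_trans _ _ (C * (2 ^+ i.+1) `^ k * (2 `^ (- s)) ^+ i)).
  rewrite ler_wpM2r ?exprn_ge0 ?powR_ge0//; apply: le_trans Nle.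
  rewrite ler_nat; apply: uniq_leq_size; first by rewrite filter_uniq// fset_uniq.
  move=> x; rewrite mem_filter => /andP[/eqP ij xX]; rewrite in_fset_set//.
  rewrite inE; split; first exact: XP.
  by have /andP[_] := jP x; rewrite -ij => /ltW; lra.
by rewrite two_pow exprS -!mulrA -exprMn -powRD ?pnatr_eq0 ?implybT.
Qed.

(** The points with [a x <= r] alone contribute at least r ^ (k - s) up to a constant; [D] is chosen
    to make this exceed [B]. *)
Lemma power_sum_unbounded s : 0 <= s -> s < k -> forall B, exists2 X : {fset T},
  [set` X] `<=` P & B <= \sum_(x <- X) (1 + a x) `^ (- s).
Proof.
move=> s0 sk B; have [C C0 NC] := growth.
pose D := C * 2 `^ s * (`|B| + 1).
have D0 : 0 < D by rewrite !mulr_gt0 ?powR_gt0// ltr_wpDl.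
pose r := Num.max 1 (D `^ (k - s)^-1).
have r1 : 1 <= r by rewrite le_max lexx.
have rD : D <= r `^ (k - s).
  have ks : 0 < k - s by rewrite subr_gt0.
  have -> : D = (D `^ (k - s)^-1) `^ (k - s).
    by rewrite -powRrM mulVf ?gt_eqF// powRr1// ltW.
  by rewrite ge0_ler_powR ?nnegrE ?powR_ge0 ?(ltW ks) ?(le_trans ler01)// le_max lexx orbT.
exists (fset_set [set x | P x /\ a x <= r]).
  by move=> x /=; rewrite in_fset_set// inE => -[].
have r0 : 0 < r by lra.
apply: (@le_trans _ _ (\sum_(x <- fset_set [set x | P x /\ a x <= r])
    (2 * r) `^ (- s))); last first.
  rewrite big_seq [leRHS]big_seq; apply: ler_sum => x.
  rewrite in_fset_set// inE => -[_ ar].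
  rewrite !powRN lef_pV2 ?posrE ?powR_gt0 ?mulr_gt0//; last by rewrite ltr_wpDr.
  rewrite ge0_ler_powR ?nnegrE ?mulr_ge0 ?addr_ge0 ?(ltW r0)//.
  by lra.
rewrite big_const_seq count_predT iter_addr_0 -[leRHS]mulr_natl.
have /andP[+ _] := NC _ r1; rewrite /ncard => Nr.
apply: le_trans (ler_wpM2r (powR_ge0 _ _) Nr).
rewrite powRM ?(ltW r0)//.
have -> : r `^ k / C * (2 `^ (- s) * r `^ (- s)) = r `^ (k - s) / (C * 2 `^ s).
  rewrite powRD ?(gt_eqF r0) ?implybT// (powRN 2) invfM; ring.
rewrite ler_pdivlMr ?mulr_gt0 ?powR_gt0//; apply: le_trans rD.
rewrite /D mulrC ler_wpM2l ?mulr_ge0 ?powR_ge0 ?(ltW C0)//.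
by have := ler_norm B; lra.
Qed.

End series_of_power_growth.

Section parabolic_critical_exponent.
Context {R : realType} {n : nat}.
Local Notation H := (hyperbolic_space R n).
Variables (P : set (Iso H)) (w : boundary R n).
Variables (A : Iso H -> 'M[R]_n) (b : Iso H -> 'rV[R]_n) (o : H) (k : R).
Hypothesis cP : group_closed (mem P).
Hypothesis simP : forall g, P g -> similarity w g 1 (A g) (b g).
Hypothesis actP : euclidean_action P A b.
Hypothesis properP : forall r, finite_set [set g | P g /\ enorm (b g) <= r].
Hypothesis k0 : 0 < k.

Local Notation z := (horo w (hval o)).
Local Notation t := (height w (hval o)).
Local Notation disp := (displacement (affine_act A b z)).

Hypothesis growth : power_growth (orbit_count P (affine_act A b z)) k.

Let disp0 g : 0 <= disp g. Proof. exact: enorm_ge0. Qed.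

Let finP r : finite_set [set g | P g /\ disp g <= r].
Proof. exact: orbit_ball_finite cP actP properP z r. Qed.

Let hcosh_disp g : P g -> hcosh o (g o) = 1 + disp g ^+ 2 / (2 * t ^+ 2).
Proof.
move=> Pg; have [_ _ _ _ /(_ o)[gt gz]] := simP Pg.
rewrite (hcosh_horo w) gt gz mul1r scale1r subrr expr0n addr0 -mulrA -expr2.
rewrite /displacement (affine_act1 cP actP) enorm_sqr; congr (_ + _ / _).
by rewrite -[in LHS]opprB dotNl dotNr opprK.
Qed.

(** Elements of [P] preserve heights, so [hcosh o (g o)] is quadratic in [disp g], and
    [expR (arcosh a)] lies between [a] and [2 * a]. *)
Let dist_disp : exists2 C : R, 0 < C & forall g, P g ->
  (1 + disp g) ^+ 2 / C <= expR (mdist o (g o)) <= C * (1 + disp g) ^+ 2.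
Proof.
have t0 : 0 < t := height_hval w o.
pose u : R := t ^+ 2; have u0 : 0 < u by rewrite exprn_gt0.
have iu0 : 0 < (2 * u)^-1 by rewrite invr_gt0 mulr_gt0.
pose C : R := 2 + 4 * u + 2 * (2 * u)^-1.
have C0 : 0 < C by rewrite /C; lra.
exists C => // g Pg.
rewrite mdist_hyperbolicE; have /andP[] := le_expR_arcosh (hcosh_ge1 o (g o)).
rewrite -/(hdist o (g o)) hcosh_disp// -/u; have a0 := disp0 g.
move: (disp g) a0 (expR _) => a a0 E E1 E2; apply/andP; split.
  rewrite ler_pdivrMr//; apply: (@le_trans _ _ ((1 + a ^+ 2 / (2 * u)) * C)).
    have -> : (1 + a ^+ 2 / (2 * u)) * C = C + 2 * a ^+ 2 +
        a ^+ 2 * (2 * u)^-1 * (2 + 2 * (2 * u)^-1).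
      by rewrite /C; field; rewrite gt_eqF.
    have : 0 <= a ^+ 2 * (2 * u)^-1 * (2 + 2 * (2 * u)^-1).
      by rewrite !mulr_ge0 ?sqr_ge0// ?ltW// ltr_wpDl// mulr_gt0.
    by have := sqr_ge0 (a - 1); rewrite /C; nra.
  by rewrite ler_wpM2r// ltW.
apply: le_trans E2 _.
have : a ^+ 2 <= (1 + a) ^+ 2 by rewrite lerXn2r ?nnegrE; lra.
have : 1 <= (1 + a) ^+ 2 by rewrite exprn_ege1//; lra.
by move: iu0; rewrite /C; set v := (2 * u)^-1; nra.
Qed.

Let term_bounds s : 0 <= s -> exists2 C : R, 0 < C & forall g, P g ->
  (1 + disp g) `^ (- (2 * s)) / C <= expR (- s * mdist o (g o)) <=
    C * (1 + disp g) `^ (- (2 * s)).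
Proof.
move=> s0; have [C C0 CP] := dist_disp; exists (C `^ s) => [|g Pg].
  exact: powR_gt0.
have a0 := disp0 g; have /andP[E1 E2] := CP g Pg.
have -> : expR (- s * mdist o (g o)) = (expR (mdist o (g o)) `^ s)^-1.
  by rewrite mulNr expRN -expRM mulrC.
have -> : (1 + disp g) `^ (- (2 * s)) = (((1 + disp g) ^+ 2) `^ s)^-1.
  by rewrite powRN powRrM -powR_mulrn// addr_ge0.
move: E1 E2; set x := (1 + disp g) ^+ 2; set E := expR _ => E1 E2.
have x0 : 0 < x by rewrite exprn_gt0// ltr_wpDr.
have E0 : 0 < E := expR_gt0 _; clearbody x E.
rewrite -invfM [C `^ s * _]mulrC; apply/andP; split.
  rewrite lef_pV2 ?posrE ?mulr_gt0 ?powR_gt0// mulrC -powRM ?(ltW C0) ?(ltW x0)//.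
  apply: ge0_ler_powR; rewrite ?nnegrE ?mulr_ge0 ?(ltW C0) ?(ltW x0) ?(ltW E0)//.
rewrite -ler_pdivrMr ?powR_gt0// -invfM lef_pV2 ?posrE ?mulr_gt0 ?powR_gt0//.
rewrite -powRM ?(ltW C0) ?(ltW E0)//.
apply: ge0_ler_powR; rewrite ?nnegrE ?mulr_ge0 ?(ltW C0) ?(ltW x0) ?(ltW E0)//.
by rewrite -ler_pdivrMr.
Qed.

Let poincare_finite s : k < 2 * s -> (poincare_series o P s < +oo)%E.
Proof.
move=> ks; have s0 : 0 <= s.
  by rewrite -(@pmulr_rge0 _ 2)//; apply/ltW/lt_trans/ks.
have [C C0 CP] := term_bounds s0.
have [B B0 BP] := power_sum_bounded disp0 finP (ltW k0) growth ks.
apply: (@le_lt_trans _ _ (C * B)%:E); last exact: ltry.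
apply: ge_ereal_sup => _ [X [fX XP] <-].
rewrite fsbig_finite//= sumEFin lee_fin.
apply: (@le_trans _ _ (\sum_(g <- fset_set X) C * (1 + disp g) `^ (- (2 * s)))).
  rewrite big_seq [leRHS]big_seq; apply: ler_sum => g.
  by rewrite in_fset_set// inE => /XP /CP /andP[].
rewrite -mulr_sumr ler_wpM2l ?(ltW C0)//; apply: BP.
by rewrite fset_setK.
Qed.

Let poincare_infinite s : 2 * s < k -> poincare_series o P s = +oo%E.
Proof.
move=> sk; apply/eqyP => M M0.
(* The comparison with powers of [1 + disp g] is stated for nonnegative exponents; a negative [s] is
   reduced to 0, as the terms decrease in [s]. *)
pose u := Num.max s 0.
have u0 : 0 <= u by rewrite le_max lexx orbT.
have uk : 2 * u < k by rewrite /u maxEle; case: ifP => _; rewrite ?mulr0.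
have [C C0 CP] := term_bounds u0.
have uu0 : 0 <= 2 * u by rewrite mulr_ge0.
have [X XP XM] := power_sum_unbounded disp0 finP growth uu0 uk (C * M).
apply: esum_ge; exists [set` X]; first by split => //; exact: finite_fset.
rewrite fsbig_finite; last exact: finite_fset.
rewrite set_fsetK sumEFin lee_fin.
rewrite -(ler_pM2l C0); apply: le_trans XM _; rewrite mulr_sumr.
rewrite big_seq [leRHS]big_seq; apply: ler_sum => g gX.
have Pg : P g by exact: XP.
have /andP[+ _] := CP g Pg; rewrite ler_pdivrMr// => /le_trans; apply.
rewrite [leLHS]mulrC ler_wpM2l ?(ltW C0)// ler_expR ler_wpM2r ?mdist_ge0// lerN2.
by rewrite le_max lexx.
Qed.

Lemma critical_exponent_growth : critical_exponent o P = (k / 2)%:E.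
Proof.
apply/eqP; rewrite eq_le; apply/andP; split.
  apply/lee_addgt0Pr => e e0; apply: ereal_inf_lbound.
  exists (k / 2 + e); last by rewrite EFinD.
  by apply: poincare_finite; lra.
apply: le_ereal_inf_tmp => _ [s /= sP <-]; rewrite lee_fin leNgt.
apply/negP => sk; move: sP; rewrite poincare_infinite ?ltxx//.
by move: sk; rewrite ltr_pdivlMr// mulrC.
Qed.

End parabolic_critical_exponent.

(** * Box dimension *)

Section angle_chord.
Context {R : realType} {n : nat}.
Implicit Types (x y : boundary R n).

Lemma sin_le_id (a : R) : 0 <= a -> sin a <= a.
Proof.
move=> a0; have [c _] := @MVT_segment R sin cos 0 a a0
  (fun u _ => is_derive_sin u) (continuous_subspaceT (@continuous_sin R)).
rewrite sin0 !subr0 => ->; rewrite ler_piMl//; exact: cos_le1.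
Qed.

Lemma sin_ge_quarter (a : R) : 0 <= a -> a <= pi / 2 -> a / 4 <= sin a.
Proof.
move=> a0 api.
have pi4 : pi <= 4 :> R.
  by have /andP[_ /ltW] := pihalf_02 R; lra.
have half : -1 <= (2^-1 : R) <= 1 by apply/andP; split; lra.
(* Up to [v] the derivative of the sine is at least 1/2; beyond it [sin a >= sin v >= 1/2], while
   [a / 4 <= 1/2] because pi <= 4. *)
pose v : R := acos 2^-1.
have v0 : 0 <= v by exact: acos_ge0.
have cv : cos v = 2^-1 by apply: acosK; rewrite in_itv.
have vpi : v <= pi / 2.
  rewrite leNgt; apply/negP => vpi; have : cos v < cos (pi / 2).
    rewrite ltr_cos// in_itv/= ?v0 ?acos_lepi//; apply/andP; split; lra.
  by rewrite cv cos_pihalf; lra.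
have sv : 2^-1 <= sin v.
  have := cos2Dsin2 v; rewrite cv.
  have : 0 <= sin v by apply: sin_ge0_pi; rewrite v0 acos_lepi.
  by nra.
have [av|va] := leP a v.
  have [c cI] := @MVT_segment R sin cos 0 a a0
    (fun u _ => is_derive_sin u) (continuous_subspaceT (@continuous_sin R)).
  rewrite sin0 !subr0 => ->; rewrite [leRHS]mulrC ler_wpM2l//.
  move: cI; rewrite in_itv/= => /andP[c0 ca].
  apply: (@le_trans _ _ (cos v)); first by rewrite cv; lra.
  by rewrite leNgt ltr_cos ?in_itv/= ?c0 ?v0/= -?leNgt; lra.
have : sin v <= sin a.
  by rewrite leNgt ltr_sin ?in_itv/= -?leNgt; lra.
lra.
Qed.

Lemma chord_sin x y : enorm (bval x - bval y) = 2 * sin (mdist x y / 2).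
Proof.
rewrite mdist_boundaryE.
have itv : -1 <= dot (bval x) (bval y) <= 1.
  have := dot_CauchySchwarz (bval x) (bval y); rewrite !bval1 mulr1 => h.
  by apply/andP; split; nra.
have a0 : 0 <= angle x y := acos_ge0 itv.
have api : angle x y <= pi := acos_lepi itv.
have s0 : 0 <= sin (angle x y / 2).
  by apply: sin_ge0_pi; rewrite divr_ge0//=; have := pi_ge0 R; lra.
have ca : cos (angle x y) = dot (bval x) (bval y) by apply: acosK; rewrite in_itv.
apply/eqP; rewrite -(@eqrXn2 _ 2)// ?mulr_ge0 ?enorm_ge0//; apply/eqP.
rewrite enorm_sqr !dotE (dotC (bval y) (bval x)) !bval1 -ca.
have -> : angle x y = angle x y / 2 + angle x y / 2 by rewrite -splitr.
rewrite cosD -splitr exprMn -!expr2.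
by have := cos2Dsin2 (angle x y / 2); set p := cos _; set q := sin _; lra.
Qed.

Lemma chord_le_angle x y : enorm (bval x - bval y) <= mdist x y.
Proof.
rewrite chord_sin; have := @sin_le_id (mdist x y / 2).
by rewrite divr_ge0 ?mdist_ge0// => /(_ isT); lra.
Qed.

Lemma angle_le_chord x y : mdist x y <= 4 * enorm (bval x - bval y).
Proof.
rewrite chord_sin; have d0 := mdist_ge0 x y.
have itv : -1 <= dot (bval x) (bval y) <= 1.
  have := dot_CauchySchwarz (bval x) (bval y); rewrite !bval1 mulr1 => h.
  by apply/andP; split; nra.
have : mdist x y <= pi := acos_lepi itv.
by move=> dpi; have := @sin_ge_quarter (mdist x y / 2); lra.
Qed.

End angle_chord.

(** Greedy selection along the list. With [r] read as closeness, [t] is separated and at the same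
    time a net for [s]. *)
Lemma maximal_separated (T : eqType) (r : rel T) (s : seq T) :
  reflexive r -> symmetric r -> exists t : seq T,
  [/\ {subset t <= s}, uniq t, {in t &, forall x y, r x y -> x = y} &
      {in s, forall x, exists2 y, y \in t & r y x}].
Proof.
move=> rr sr; elim: s => [|x s [t [ts ut it ct]]]; first by exists [::].
have [/hasP[y yt ryx]|/hasPn nx] := boolP (has (r^~ x) t).
  exists t; split => // [y' /ts y's|y']; first by rewrite in_cons y's orbT.
  by rewrite in_cons => /orP[/eqP ->|/ct//]; exists y.
exists (x :: t); split.
- by move=> y; rewrite !in_cons => /orP[->//|/ts ->]; rewrite orbT.
- by rewrite /= ut andbT; apply/negP => /nx; rewrite rr.
- move=> y y'; rewrite !in_cons => /orP[/eqP ->|yt] /orP[/eqP ->|y't] //.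
  + by rewrite sr => rxy; have := nx _ y't; rewrite rxy.
  + by move=> rxy; have := nx _ yt; rewrite rxy.
  + exact: it.
- move=> y; rewrite in_cons => /orP[/eqP ->|/ct[y' y't ry]].
    by exists x => //; rewrite mem_head.
  by exists y' => //; rewrite in_cons y't orbT.
Qed.

Lemma powR_inv (R : realType) (x s : R) : 0 <= x -> x^-1 `^ s = (x `^ s)^-1.
Proof. by move=> x0; rewrite -(powR_inv1 x0) -powRrM mulN1r powRN. Qed.

(** * Covers of the boundary orbit *)

Section orbit_covering.
Context {R : realType} {n : nat}.
Local Notation H := (hyperbolic_space R n).
Variables (P : set (Iso H)) (w xi : boundary R n).
Variables (A : Iso H -> 'M[R]_n) (b : Iso H -> 'rV[R]_n) (k : R).
Hypothesis cP : group_closed (mem P).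
Hypothesis simP : forall g, P g -> similarity w g 1 (A g) (b g).
Hypothesis actP : euclidean_action P A b.
Hypothesis properP : forall r, finite_set [set g | P g /\ enorm (b g) <= r].
Hypothesis tfP : torsion_free P.
Hypothesis xiw : xi <> w.
Hypothesis k0 : 0 < k.

Local Notation z := (horo w (bval xi)).
Local Notation act := (affine_act A b z).
Local Notation disp := (displacement act).
Local Notation pt g := (boundary_act g xi).
Local Notation F := [set boundary_act p xi | p in P].

Hypothesis growth : power_growth (orbit_count P act) k.

Let disp0 g : 0 <= disp g. Proof. exact: enorm_ge0. Qed.

Let finP r : finite_set [set g | P g /\ disp g <= r].
Proof. exact: orbit_ball_finite cP actP properP z r. Qed.

Let PM g h : P g -> P h -> P (g * h)%g := @group_closed_mul _ P g h cP.
Let PV g : P g -> P g^-1%g := @group_closed_inv _ P g cP.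

Let actM g h l : P g -> P h -> P l -> enorm (act (g * h)%g - act (g * l)%g) =
  enorm (act h - act l).
Proof. exact: affine_act_translate. Qed.

Definition chord (x y : boundary R n) : R := enorm (bval x - bval y).

Let q g := chord (pt g) w.

Let horo_pt g : P g -> pt g <> w /\ horo w (bval (pt g)) = act g.
Proof.
move=> Pg; have [h1 h2] := similarity_boundary (simP Pg) xiw.
by split => //; rewrite h2 scale1r.
Qed.

Let q_sqr g : q g ^+ 2 = sqd w (bval (pt g)).
Proof. exact: enorm_sqr. Qed.

(** The inversion formula [horo_height_dist] at height 0. *)
Let chord_pt g h : P g -> P h ->
  chord (pt g) (pt h) = enorm (act g - act h) * q g * q h.
Proof.
move=> Pg Ph; have [/sqd_bval qg hg] := horo_pt Pg; have [/sqd_bval qh hh] := horo_pt Ph.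
apply/eqP; rewrite -(@eqrXn2 _ 2)// ?mulr_ge0 ?enorm_ge0//; apply/eqP.
rewrite !exprMn !q_sqr !enorm_sqr -hg -hh.
have := horo_height_dist qg qh; rewrite !height_bval subrr expr0n addr0 => ->.
by rewrite -mulrA divfK// mulf_neq0.
Qed.

Let q_bounds : exists2 C : R, 1 <= C & forall g, P g ->
  C^-1 <= q g * (1 + disp g) <= C.
Proof.
pose Z := enorm z; have Z0 : 0 <= Z := enorm_ge0 z.
(* With [M] the reciprocal of the chord to [w], the bounds [1 <= 2 * M], [Z <= 2 * Z * M] and
   [u <= M] add up to [1 + a <= (2 * Z + 3) * M]; the other side is [M <= a + Z + 2^-1]. *)
exists (2 * Z + 3); first lra.
move=> g Pg; have [/sqd_bval qg hg] := horo_pt Pg.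
have := sqd_horo qg; rewrite hg height_bval add0r -q_sqr -enorm_sqr.
have a0 := disp0 g; have q0 : 0 <= q g := enorm_ge0 _.
have dE : disp g = enorm (act g - z) by rewrite /displacement (affine_act1 cP actP).
have u1 : enorm (act g) <= disp g + Z.
  by rewrite dE addrC; exact: enorm_dist.
have u2 : disp g <= enorm (act g) + Z.
  by rewrite dE; apply: le_trans (enormD _ _) _; rewrite enormN.
have u0 := enorm_ge0 (act g); clear dE; clearbody Z.
move: (disp g) (enorm (act g)) (q g) a0 q0 u0 u1 u2 => a u y a0 y0 u0 u1 u2 E.
pose M := Num.sqrt (u ^+ 2 + 2^-1 ^+ 2).
have M2 : M ^+ 2 = u ^+ 2 + 2^-1 ^+ 2 by rewrite sqr_sqrtr// addr_ge0// sqr_ge0.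
have M0 : 0 <= M := sqrtr_ge0 _.
have yM : y * M = 1.
  apply/eqP; rewrite -(@eqrXn2 _ 2)// ?mulr_ge0//.
  by rewrite exprMn M2 expr1n; apply/eqP.
have Mu : u <= M by rewrite -ler_sqr ?nnegrE// M2 lerDl sqr_ge0.
have Mh : 2^-1 <= M by rewrite -ler_sqr ?nnegrE// M2 lerDr sqr_ge0.
have MU : M <= u + 2^-1.
  by rewrite -ler_sqr ?nnegrE ?addr_ge0// M2; nra.
have ZM : 0 <= Z * (M - 2^-1) by rewrite mulr_ge0// subr_ge0.
have Za : 0 <= Z * a by rewrite mulr_ge0.
clearbody M; apply/andP; split; last first.
  apply: (@le_trans _ _ (y * ((2 * Z + 3) * M))); last by rewrite mulrCA yM mulr1.
  by rewrite ler_wpM2l//; nra.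
rewrite -div1r ler_pdivrMr; last lra.
by rewrite -[leLHS]yM -mulrA ler_wpM2l//; nra.
Qed.

Let mdist_ge_chord x y : chord x y <= mdist x y. Proof. exact: chord_le_angle. Qed.

Lemma orbit_cover_lower : exists c d : R, [/\ 0 < c, 0 < d & forall del, 0 < del -> del <= d ->
  forall m (U : 'I_m -> set (boundary R n)), F `<=` \bigcup_i U i ->
  (forall i, (diameter (U i) <= del%:E)%E) -> c * del `^ (- (k / 2)) <= m%:R].
Proof.
have [C C1 CP] := q_bounds; have [kap kap0 kapP] := orbit_separated cP actP properP tfP z.
have [CN CN0 NC] := growth.
have C0 : 0 < C by lra.
(* The value of [d] is set so that, with [rho ^+ 2 = d / del], orbit points of displacement at most
   [rho] are at least [2 * del] apart. No set of the cover then contains two of them. *)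
have : 0 < kap / (8 * C ^+ 2) by rewrite divr_gt0// mulr_gt0// exprn_gt0.
move dE : (kap / (8 * C ^+ 2)) => d d0.
exists (d `^ (k / 2) / CN), d; split => //; first by rewrite divr_gt0 ?powR_gt0.
move=> del del0 deld m U FU dU.
pose rho := Num.sqrt (d / del).
have rho2 : rho ^+ 2 = d / del by rewrite sqr_sqrtr// divr_ge0 ?ltW.
have rho1 : 1 <= rho.
  by rewrite -ler_sqr ?nnegrE ?sqrtr_ge0// expr1n rho2 ler_pdivlMr// mul1r.
have rhok : rho `^ k = d `^ (k / 2) * del `^ (- (k / 2)).
  have -> : rho `^ k = (rho ^+ 2) `^ (k / 2).
    by rewrite -powR_mulrn ?sqrtr_ge0// -powRrM mulrC divfK.
  rewrite rho2 powRM ?invr_ge0 ?(ltW d0) ?(ltW del0)//.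
  by rewrite -(powR_inv1 (ltW del0)) -powRrM mulN1r.
have /andP[+ _] := NC _ rho1; rewrite rhok mulrAC => /le_trans; apply.
rewrite ler_nat.
(* The orbit is nonempty, so the cover has a member; its index 0 is the default value of the choice
   function below. *)
case: m U FU dU => [|m] U FU dU.
  have [|[]//] := FU (pt 1%g).
  by exists 1%g => //; exact: group_closed_one.
have /choice[i iP] g : exists i, P g -> U i (pt g).
  have [Pg|nP] := pselect (P g); last by exists ord0.
  by have [|i _ Ui] := FU (pt g); [exists g|exists i].
rewrite -[leqRHS]muln1 -[X in (_ <= X * _)%N]card_ord.
apply: (@ncard_fibers _ _ _ i) => [|j]; first exact: finP.
rewrite -(ncard_set1 tt); apply: (@ncard_inj _ _ _ _ (fun=> tt)) => //.
  by apply: sub_finite_set (finP rho) => g [].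
move=> g h [[Pg ga] gj] [[Ph ha] hj] _; apply: contrapT => gh.
have := kapP _ _ Pg Ph gh.
have : mdist (pt g) (pt h) <= del.
  rewrite -lee_fin; apply: le_trans (dU j); apply: ereal_sup_ubound.
  exists (pt g); first by rewrite -gj; exact: iP.
  by exists (pt h) => //; rewrite -hj; exact: iP.
have := mdist_ge_chord (pt g) (pt h); rewrite chord_pt//.
have /andP[qg _] := CP _ Pg; have /andP[qh _] := CP _ Ph.
have a0 := disp0 g; have a0' := disp0 h.
have x0 : 0 <= q g := enorm_ge0 _; have y0 : 0 <= q h := enorm_ge0 _.
have D0 := enorm_ge0 (act g - act h).
move: (q g) (q h) (disp g) (disp h) (enorm _) (mdist _ _) qg qh ga ha a0 a0' x0 y0 D0.
move=> x y a a' D e xa ya' ar a'r a0 a'0 x0 y0 D0 De ed kD.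
have lb u c : 0 <= u -> c <= rho -> C^-1 <= u * (1 + c) -> (2 * C * rho)^-1 <= u.
  move=> u0 cr; rewrite -[C^-1]div1r -[(2 * C * rho)^-1]div1r.
  rewrite !ler_pdivrMr ?mulr_gt0//; last lra.
  move=> /le_trans; apply; have -> : u * (2 * C * rho) = u * (2 * rho) * C by ring.
  by rewrite ler_wpM2r ?(ltW C0)// ler_wpM2l//; lra.
have x1 := lb _ _ x0 ar xa; have y1 := lb _ _ y0 a'r ya'.
have i0' : 0 < (2 * C * rho)^-1 by rewrite invr_gt0 !mulr_gt0//; lra.
have : kap * (2 * C * rho)^-1 * (2 * C * rho)^-1 <= D * x * y.
  apply: ler_pM => //; rewrite ?mulr_ge0 ?(ltW kap0) ?(ltW i0')//.
  by apply: ler_pM => //; rewrite ?(ltW kap0) ?(ltW i0').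
have -> : kap * (2 * C * rho)^-1 * (2 * C * rho)^-1 = 2 * del.
  have -> : kap * (2 * C * rho)^-1 * (2 * C * rho)^-1 = kap / (4 * C ^+ 2) / rho ^+ 2.
    by field; rewrite !gt_eqF//; lra.
  by rewrite rho2 -dE; field; rewrite !gt_eqF.
by lra.
Qed.

Let chord_triangle y x v : chord x v <= chord x y + chord y v.
Proof. exact: enorm_triangle. Qed.

Let chordC x y : chord x y = chord y x. Proof. exact: enormB. Qed.

Let translated_count r g X : P g -> (forall h, P h -> enorm (act h - act g) <= r ->
  h \in (X : {fset Iso H})) ->
  (orbit_count P act r <= size [seq h <- X | (enorm (act h - act g) <= r)%R])%N.
Proof.
move=> Pg Xr.
have -> : orbit_count P act r =
    size [seq (g * h)%g | h <- fset_set (orbit_ball P act r)] by rewrite size_map.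
apply: uniq_leq_size; first by rewrite map_inj_uniq ?fset_uniq// => h l /mulgI.
move=> _ /mapP[h + ->]; rewrite in_fset_set ?inE; last exact: finP.
move=> [Ph hr]; have gr : enorm (act (g * h)%g - act g) <= r.
  by have := actM Pg Ph (group_closed_one cP); rewrite mulg1 => ->.
by rewrite mem_filter gr Xr//; exact: PM.
Qed.

(* Each point [p] of a maximal separated family [Q] carries a Euclidean ball of
   radius [r p] comparable to [del * (1 + disp p) ^+ 2].  These balls are disjoint,
   and the [f]-mass of each is at least of the order of [del `^ s]. *)
Lemma orbit_cover_upper s : k < 2 * s -> s <= k -> exists2 B : R, 0 < B &
  forall del, 0 < del -> del < 1 -> exists m (U : 'I_m -> set (boundary R n)),
  [/\ F `<=` \bigcup_i U i, forall i, (diameter (U i) <= del%:E)%E &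
      m%:R <= B * del `^ (- s)].
Proof.
move=> ks sk; have s0 : 0 < s.
  by rewrite -(@pmulr_rgt0 _ 2)//; exact: lt_trans ks.
have [C C1 CP] := q_bounds; have C0 : 0 < C by lra.
have [CN CN0 NC] := growth.
have [B B0 BP] := power_sum_bounded disp0 finP (ltW k0) growth ks.
(* The constant meets two demands: [th1] keeps [r g] below half of [1 + disp g], so displacements
   vary little on a ball, and [th2] keeps the chords from its centre below [del / 16]. Centres of
   overlapping balls are then within [del / 8] in chord and [del / 2] in angle. *)
pose th := (32 * C ^+ 2 * (1 + 8 * C))^-1.
have th0 : 0 < th by rewrite invr_gt0 !mulr_gt0 ?exprn_gt0//; lra.
have C2 : 1 <= C ^+ 2 by rewrite exprn_ege1.
have th1 : th * (1 + 8 * C) <= 2^-1.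
  rewrite /th invfM divfK; last by rewrite gt_eqF//; lra.
  by rewrite lef_pV2 ?posrE ?mulr_gt0 ?exprn_gt0//; lra.
have th2 : 2 * th * C ^+ 2 <= 16^-1.
  have -> : 2 * th * C ^+ 2 = 16^-1 * (1 + 8 * C)^-1.
    by rewrite /th; field; rewrite !gt_eqF//; lra.
  by rewrite ler_piMr// invf_le1; lra.
clearbody th.
pose D := B * (1 + CN) * (4 / th) `^ s.
have D0 : 0 < D by rewrite !mulr_gt0 ?powR_gt0 ?divr_gt0//; lra.
exists (D + 1) => [|del del0 del1]; first lra.
(* Beyond this displacement the orbit points are within [del / 8] of [w]. *)
pose rho := 8 * C / del.
have rho0 : 0 < rho by rewrite divr_gt0// mulr_gt0.
pose near := fset_set [set g | P g /\ disp g <= rho].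
have nearE g : g \in near -> P g /\ disp g <= rho.
  by rewrite in_fset_set// inE.
pose rel g h := mdist (pt g) (pt h) <= del / 2.
have [|g h|Q [Qn Qu Qi Qc]] := @maximal_separated _ rel near.
- by move=> g; rewrite /rel mdistxx divr_ge0// ltW.
- by rewrite /rel metric_sym.
have QP g : g \in Q -> P g by move=> /Qn/nearE[].
have Qd g : g \in Q -> del * (1 + disp g) <= 1 + 8 * C.
  move=> /Qn/nearE[_]; rewrite /rho ler_pdivlMr// mulrDr mulr1 mulrC; lra.
have r1 g : g \in Q -> th * del * (1 + disp g) <= 2^-1.
  move=> /Qd gd; apply: le_trans th1; rewrite -mulrA.
  by rewrite ler_wpM2l// ltW.
pose r g := th * del * (1 + disp g) ^+ 2.
have r0 g : 0 < r g.
  by apply: mulr_gt0; [exact: mulr_gt0|apply: exprn_gt0; exact: ltr_wpDr].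
pose hb g h := enorm (act h - act g) <= r g.
have hb_disp g h : g \in Q -> hb g h ->
    disp h <= disp g + (1 + disp g) / 2 /\ disp g <= disp h + (1 + disp g) / 2.
  move=> gQ; rewrite /hb /r => hg.
  have rg : th * del * (1 + disp g) ^+ 2 <= (1 + disp g) / 2.
    rewrite expr2 mulrA mulrC ler_wpM2l ?addr_ge0//; exact: r1.
  have := enorm_triangle (act g) (act h) (act 1%g).
  have := enorm_triangle (act h) (act g) (act 1%g).
  rewrite [enorm (act g - act h)]enormB -/(disp g) -/(disp h).
  by split; lra.
have hb_chord g h : g \in Q -> P h -> hb g h -> chord (pt g) (pt h) <= del / 16.
  move=> gQ Ph hg; have [_ d2] := hb_disp _ _ gQ hg.
  have Pg := QP _ gQ; rewrite chord_pt// enormB.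
  have /andP[_ qg] := CP _ Pg; have /andP[_ qh] := CP _ Ph.
  have a0 := disp0 g; have a'0 := disp0 h.
  have x0 : 0 <= q g := enorm_ge0 _; have y0 : 0 <= q h := enorm_ge0 _.
  move: hg; rewrite /hb /r.
  move: (q g) (q h) (disp g) (disp h) (enorm _) qg qh d2 a0 a'0 x0 y0.
  move=> x y a a' d xC yC d2 a0 a'0 x0 y0 dr.
  have yC' : y * (1 + a) <= 2 * C.
    apply: (@le_trans _ _ (2 * (y * (1 + a')))); last by rewrite ler_wpM2l.
    by rewrite mulrCA ler_wpM2l//; lra.
  have xy : (x * (1 + a)) * (y * (1 + a)) <= C * (2 * C).
    by apply: ler_pM => //; rewrite mulr_ge0// addr_ge0.
  apply: (@le_trans _ _ (th * del * (1 + a) ^+ 2 * x * y)).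
    by rewrite !ler_wpM2r.
  have -> : th * del * (1 + a) ^+ 2 * x * y =
     th * del * ((x * (1 + a)) * (y * (1 + a))) by ring.
  apply: (@le_trans _ _ (th * del * (C * (2 * C)))).
    by rewrite ler_wpM2l// mulr_ge0// ltW.
  have -> : th * del * (C * (2 * C)) = del * (2 * th * C ^+ 2) by ring.
  by rewrite ler_wpM2l// ltW.
have disj g g' h : g \in Q -> g' \in Q -> P h -> hb g h -> hb g' h -> g = g'.
  move=> gQ g'Q Ph hg hg'; apply: Qi => //; rewrite /rel.
  apply: le_trans (angle_le_chord _ _) _.
  have c1 := hb_chord _ _ gQ Ph hg; have c2 := hb_chord _ _ g'Q Ph hg'.
  have := chord_triangle (pt h) (pt g) (pt g'); rewrite (chordC (pt h)) /chord.
  by move: c1 c2; rewrite /chord; lra.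
pose Y := fset_set [set h | P h /\ disp h <= 2 * (1 + rho)].
have YP : [set` Y] `<=` P by move=> h /=; rewrite in_fset_set// inE => -[].
have hbY g h : g \in Q -> P h -> hb g h -> h \in Y.
  move=> gQ Ph hg; rewrite in_fset_set// inE; split => //.
  have [d1 _] := hb_disp _ _ gQ hg; have [_] := nearE _ (Qn _ gQ); lra.
pose f h := (1 + disp h) `^ (- (2 * s)).
have f0 h : 0 <= f h := powR_ge0 _ _.
have lower g : g \in Q -> (th / 4) `^ s * del `^ s / (1 + CN) <=
    \sum_(h <- Y | hb g h) f h.
  move=> gQ; have Pg := QP _ gQ; have a0 := disp0 g.
  have fE : (2 * (1 + disp g)) `^ (- (2 * s)) =
      (th / 4) `^ s * del `^ s * (r g) `^ (- s).
    have -> : (th / 4) `^ s * del `^ s = (th / 4 * del) `^ s.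
      by rewrite [RHS]powRM ?divr_ge0 ?(ltW th0) ?(ltW del0).
    have u0 : 0 <= 2 * (1 + disp g) by rewrite mulr_ge0// addr_ge0.
    have -> : th / 4 * del = r g * ((2 * (1 + disp g)) ^+ 2)^-1.
      by rewrite /r; field; rewrite gt_eqF// ltr_wpDr.
    rewrite [in RHS]powRM ?invr_ge0 ?sqr_ge0 ?(ltW (r0 g))// powR_inv ?sqr_ge0//.
    rewrite [in RHS]powRN mulrAC mulfV ?gt_eqF ?powR_gt0// mul1r.
    by rewrite powRN powRrM powR_mulrn.
  apply: (@le_trans _ _ (\sum_(h <- Y | hb g h) (2 * (1 + disp g)) `^ (- (2 * s)))).
    rewrite -big_filter big_const_seq count_predT iter_addr_0 -[leRHS]mulr_natl fE.
    have rs0 : 0 < r g `^ s by rewrite powR_gt0.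
    have cnt : (orbit_count P act (r g) <= size [seq h <- Y | hb g h])%N.
      by apply: translated_count => // h Ph; exact: hbY.
    apply: (@le_trans _ _ ((orbit_count P act (r g))%:R *
        ((th / 4) `^ s * del `^ s * r g `^ (- s)))); last first.
      by rewrite ler_wpM2r ?mulr_ge0 ?powR_ge0// ler_nat.
    rewrite mulrCA ler_wpM2l ?mulr_ge0 ?powR_ge0// powRN ler_pdivlMr//.
    (* In both cases the count is at least a constant times the [s]-th power of [r g]: by the growth
       and [s <= k] when [1 <= r g], and otherwise because the identity is counted. *)
    have [rg1|rg1] := leP 1 (r g).
      have /andP[+ _] := NC _ rg1; apply: le_trans.
      rewrite mulrC ler_pM ?powR_ge0 ?invr_ge0 ?addr_ge0// ?(ltW CN0)//.
        by rewrite ler_powR.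
      by rewrite lef_pV2 ?posrE ?addr_gt0// lerDr.
    have N1 : 1 <= (orbit_count P act (r g))%:R :> R.
      rewrite ler1n; apply: orbit_count_gt0; [exact: cP|exact: finP|exact: ltW].
    apply: le_trans N1; rewrite mulrC ler_pdivrMr ?addr_gt0// mul1r.
    apply: (@le_trans _ _ 1); last by rewrite lerDl ltW.
    apply: (@le_trans _ _ (1 `^ s)); last by rewrite powR1.
    by rewrite ge0_ler_powR ?nnegrE ?(ltW s0) ?(ltW (r0 g)) ?(ltW rg1).
  rewrite big_seq_cond [leRHS]big_seq_cond; apply: ler_sum => h /andP[hY hg].
  have [d1 _] := hb_disp _ _ gQ hg; have a'0 := disp0 h.
  rewrite /f !powRN lef_pV2 ?posrE ?powR_gt0//; last 2 first.
  - by rewrite mulr_gt0// ltr_wpDr.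
  - by rewrite ltr_wpDr.
  by rewrite ge0_ler_powR ?nnegrE ?mulr_ge0 ?addr_ge0 ?(ltW s0)//; lra.
have sizeQ : (size Q)%:R * ((th / 4) `^ s * del `^ s / (1 + CN)) <= B.
  apply: le_trans (BP Y YP).
  apply: (@le_trans _ _ (\sum_(g <- Q) \sum_(h <- Y | hb g h) f h)).
    rewrite mulr_natl -(@iter_addr_0 R) -[in leLHS](count_predT Q) -big_const_seq.
    by rewrite big_seq [leRHS]big_seq; apply: ler_sum => g; exact: lower.
  rewrite (exchange_big_dep xpredT)//= big_seq [leRHS]big_seq.
  apply: ler_sum => h hY; have Ph := YP _ hY.
  have [/hasP[g gQ hg]|/hasPn no] := boolP (has (hb^~ h) Q).
    rewrite big_mkcond (bigD1_seq g)//= hg big_seq_cond big1 ?addr0//.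
    move=> g' /andP[g'Q g'g]; case: ifP => // hg'.
    by move: g'g; rewrite (disj g' g h)// eqxx.
  by rewrite big_seq_cond big1 ?f0 // => g /andP[/no/negbTE ->].
have {}sizeQ : (size Q)%:R <= D * del `^ (- s).
  have c0 : 0 < (th / 4) `^ s * del `^ s / (1 + CN).
    by rewrite divr_gt0 ?mulr_gt0 ?powR_gt0 ?divr_gt0//; lra.
  move: sizeQ; rewrite -ler_pdivlMr// => /le_trans; apply.
  rewrite /D; have -> : (4 / th) `^ s = ((th / 4) `^ s)^-1.
    by rewrite -powR_inv ?invf_div// divr_ge0// ltW.
  have x0 : 0 < (th / 4) `^ s by rewrite powR_gt0// divr_gt0.
  have y0 : 0 < del `^ s by rewrite powR_gt0.
  rewrite powRN le_eqVlt; apply/orP; left; apply/eqP.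
  by field; rewrite !gt_eqF//; lra.
(* The points of displacement above [rho] form the single set of index 0. It accounts for the
   summand 1 in [D + 1], as [del < 1]. *)
pose U (i : 'I_(size Q).+1) : set (boundary R n) :=
  if val i is j.+1 then [set x | mdist (pt (nth 1%g Q j)) x <= del / 2]
  else [set pt g | g in [set g | P g /\ rho < disp g]].
exists (size Q).+1, U; split.
- move=> _ [g Pg <-]; have [gr|gr] := leP (disp g) rho; last first.
    by exists ord0 => //; exists g.
  have /Qc[h hQ hg] : g \in near by rewrite in_fset_set// inE.
  have ltQ : ((index h Q).+1 < (size Q).+1)%N by rewrite ltnS index_mem.
  by exists (Ordinal ltQ); [|rewrite /U /= nth_index].
- move=> [[|j] ij]; apply: ge_ereal_sup => _ [x + [y + <-]]; rewrite /U /= lee_fin.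
    move=> [g [Pg gr] <-] [h [Ph hr] <-].
    have far l : P l -> rho < disp l -> chord (pt l) w <= del / 8.
      move=> Pl lr; have /andP[_ ql] := CP _ Pl.
      rewrite -/(q l); have q0 : 0 <= q l := enorm_ge0 _.
      rewrite -(ler_pM2r (_ : 0 < 8 * C / del))//.
      have -> : del / 8 * (8 * C / del) = C by field; rewrite gt_eqF.
      by apply: le_trans ql; rewrite ler_wpM2l// -/rho; lra.
    apply: le_trans (angle_le_chord _ _) _.
    have := chord_triangle w (pt g) (pt h); rewrite (chordC w).
    by have := far _ Pg gr; have := far _ Ph hr; rewrite /chord; lra.
  move=> xd yd; apply: le_trans (metric_triangle _ (pt (nth 1%g Q j)) _) _.
  by rewrite [X in X + _]metric_sym; move: xd yd; lra.
rewrite -natr1 mulrDl mul1r lerD// powRN -[leLHS]invr1 lef_pV2 ?posrE ?powR_gt0//.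
apply: (@le_trans _ _ (1 `^ s)); last by rewrite powR1.
by rewrite ge0_ler_powR ?nnegrE ?(ltW s0) ?(ltW del0) ?(ltW del1).
Qed.

End orbit_covering.

(** * From covering bounds to the box dimension *)

Section box_dimension_from_covers.
Context {R : realType} {T : metricType R}.
Variables (F : set T) (k : R).
Hypothesis k0 : 0 < k.
Hypothesis lower : exists c d : R, [/\ 0 < c, 0 < d & forall r, 0 < r -> r <= d ->
  forall m (U : 'I_m -> set T), F `<=` \bigcup_i U i ->
  (forall i, (diameter (U i) <= r%:E)%E) -> c * r `^ (- (k / 2)) <= m%:R].
Hypothesis upper : forall s, k < 2 * s -> s <= k -> exists2 B : R, 0 < B &
  forall r, 0 < r -> r < 1 -> exists m (U : 'I_m -> set T),
  [/\ F `<=` \bigcup_i U i, forall i, (diameter (U i) <= r%:E)%E &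
      m%:R <= B * r `^ (- s)].

Let covering_bounds s : k < 2 * s -> s <= k ->
  exists c d B : R, [/\ 0 < c, 0 < d, 0 < B & forall r, 0 < r -> r < d ->
  exists v, [/\ covering_number F r = v%:E, c * r `^ (- (k / 2)) <= v &
                v <= B * r `^ (- s)]].
Proof.
move=> ks sk; have [c [d [c0 d0 lo]]] := lower; have [B B0 up] := upper ks sk.
exists c, (Num.min d 1), B; split => // [|r r0]; first by rewrite lt_min d0 ltr01.
rewrite lt_min => /andP[rd r1].
have [m [U [FU dU mB]]] := up _ r0 r1.
have cov_le : (covering_number F r <= (B * r `^ (- s))%:E)%E.
  apply: (@le_trans _ _ m%:R%:E); last by rewrite lee_fin.
  by apply: ereal_inf_lbound; exists m => //; exists U.
have cov_ge : ((c * r `^ (- (k / 2)))%:E <= covering_number F r)%E.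
  apply: le_ereal_inf_tmp => _ [j [V [FV dV]] <-]; rewrite lee_fin.
  exact: (lo _ r0 (ltW rd) _ V).
case: (covering_number F r) cov_le cov_ge => [v| |] //=.
by rewrite !lee_fin => vB cv; exists v.
Qed.

Lemma box_ratio_cvg : box_ratio F r @[r --> 0^'+] --> (k / 2)%:E.
Proof.
apply/fine_cvgP; split.
  (* The admissible value [s = k] is enough to see that the covering numbers are finite and positive
     near 0. *)
  have k2 : k < 2 * k by have := k0; lra.
  have [c [d [B [c0 d0 B0 cb]]]] := covering_bounds k2 (lexx k).
  near=> r; have r0 : 0 < r by near: r; exact: nbhs_right_gt.
  have rd : r < d by near: r; exact: nbhs_right_lt.
  have [v [vE cv _]] := cb _ r0 rd.
  by rewrite /box_ratio vE lne_EFin// (lt_le_trans _ cv)// mulr_gt0// powR_gt0.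
apply/cvgrPdist_le => e e0.
pose s := Num.min k (k / 2 + e / 2).
have sk : s <= k by rewrite ge_min lexx.
have se : s <= k / 2 + e / 2 by rewrite ge_min lexx orbT.
have ks : k < 2 * s by have := k0; rewrite /s minElt; case: ifP => _; lra.
have [c [d [B [c0 d0 B0 cb]]]] := covering_bounds ks sk.
(* For [r] below [expR (- M)] the quantity [e * l] dominates the constants. The factor 2 is due to
   the upper estimate, where [s] already spends half of [e * l]. *)
pose M := 1 + (`|ln c| + 2 * `|ln B|) / e.
have M1 : 1 <= M by rewrite lerDl divr_ge0 ?addr_ge0 ?mulr_ge0// ltW.
near=> r; have r0 : 0 < r by near: r; exact: nbhs_right_gt.
have rd : r < d by near: r; exact: nbhs_right_lt.
have rM : r < expR (- M) by near: r; apply: nbhs_right_lt; exact: expR_gt0.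
have [v [vE cv vB]] := cb _ r0 rd.
have v0 : 0 < v by rewrite (lt_le_trans _ cv)// mulr_gt0// powR_gt0.
rewrite /= /box_ratio vE lne_EFin//=.
pose l := - ln r.
have lM : M < l by rewrite ltrNr -(expRK (- M)) ltr_ln// posrE expR_gt0.
have l0 : 0 < l by lra.
have lnv1 : ln c + k / 2 * l <= ln v.
  have -> : ln c + k / 2 * l = ln (c * r `^ (- (k / 2))).
    by rewrite lnM ?posrE ?powR_gt0// ln_powR /l; ring.
  by rewrite ler_ln// posrE mulr_gt0// powR_gt0.
have lnv2 : ln v <= ln B + s * l.
  have -> : ln B + s * l = ln (B * r `^ (- s)).
    by rewrite lnM ?posrE ?powR_gt0// ln_powR /l; ring.
  by rewrite ler_ln// posrE mulr_gt0// powR_gt0.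
have eM : `|ln c| + 2 * `|ln B| <= e * l.
  apply: (@le_trans _ _ (e * M)); last by rewrite ler_wpM2l// ltW.
  have -> : e * M = e + (`|ln c| + 2 * `|ln B|) by rewrite /M; field; rewrite gt_eqF.
  by rewrite lerDr ltW.
have -> : k / 2 - ln v / l = (k / 2 * l - ln v) / l by field; rewrite gt_eqF.
rewrite normrM normfV (gtr0_norm l0) ler_pdivrMr// ler_norml.
have := ler_norm (ln B); have := ler_norm (- ln c); rewrite normrN => nc nB.
have sl : s * l <= k / 2 * l + e / 2 * l by rewrite -mulrDl ler_wpM2r// ltW.
have nc0 := normr_ge0 (ln c); have nB0 := normr_ge0 (ln B).
have el0 : 0 < e * l by rewrite mulr_gt0.
have e2 : e / 2 * l = (e * l) / 2 by ring.
move: lnv1 lnv2 sl eM el0; rewrite e2.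
move: (k / 2 * l) (s * l) (e * l) => x y u *; apply/andP; split; lra.
Unshelve. all: by end_near. Qed.

End box_dimension_from_covers.

Lemma boundary_act1 (R : realType) (n : nat) (xi : boundary R n) :
  boundary_act (1%g : Iso (hyperbolic_space R n)) xi = xi.
Proof. by apply: boundary_act_unique => u. Qed.

Theorem theorem1p2 (R : realType) (n : nat) (o : hyperbolic_space R n)
    (P : set (Iso (hyperbolic_space R n))) (xi : boundary R n) :
  group_closed (mem P) -> discrete_subset P -> torsion_free P -> parabolic P ->
  ~ fixed_by P xi ->
  has_box_dim [set boundary_act p xi | p in P] /\
  critical_exponent o P = box_dim [set boundary_act p xi | p in P].
Proof.
move=> cP dP tfP parP nfix.
have [w [A [b [wP simP actP properP faithfulP]]]] := parabolic_euclidean cP dP parP.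
have [k k_ge0 growth] := orbit_power_growth cP actP properP faithfulP tfP.
have xiw : xi <> w by move=> E; apply: nfix; rewrite E.
(* A trivial [P] would fix [xi]; a nontrivial element is what makes [k] positive. *)
have [g Pg g1] : exists2 g, P g & g <> 1%g.
  apply: contrapT => no; apply: nfix => p Pp.
  have -> : p = 1%g by apply: contrapT => p1; apply: no; exists p.
  exact: boundary_act1.
have k0 : 0 < k.
  exact: orbit_growth_exponent_gt0 cP actP properP tfP 0 _ _ Pg g1 k_ge0 (growth 0).
have lim := box_ratio_cvg k0
  (orbit_cover_lower cP simP actP properP tfP xiw (growth _))
  (orbit_cover_upper cP simP actP properP xiw k0 (growth _)).
split; first by apply/cvg_ex; exists (k / 2)%:E.
rewrite (critical_exponent_growth cP simP actP properP k0 (growth _)).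
by apply/esym/cvg_lim.
Qed.
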